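(* Let $0<p<1$, $n\ge2$, let $X_1,\dots,X_n$ be i.i.d. with density $f_p(x)=px^{p-1}$ on $(0,1]$, $Q=\sum_{i=1}^n(X_i-\overline X)^2$ with cdf $F_Q$, and $\delta=\min(np,n-1)/2$. Define for $y\ge0$ $$h_p^\pm(y)=p\int_0^\infty e^{-(x\pm y)^2}x^{p-1}\,dx=2^{-p/2}\Gamma(p+1)e^{-y^2/2}U\big(p-\tfrac12,\pm y\sqrt2\big),$$ where $U$ is the parabolic cylinder function. Then, as $x\to0^+$, $$F_Q(x)\sim C_{pn}x^{\delta}\ \ (np\ne n-1),\qquad F_Q(x)\sim C_{pn}x^{(n-1)/2}\ln(1/x)\ \ (np=n-1),$$ where the constants $C_{pn}$ are given by $\Gamma(1+\delta)\sqrt{\pi/n}\,C_{pn}$ being equal to $\int_0^\infty\big((h_p^-(y))^n+(h_p^+(y))^n\big)dy$ if $np<n-1$, to $(p\sqrt\pi)^n/((p-1)n+1)$ if $np>n-1$, and to $(p\sqrt\pi)^n/2$ if $np=n-1$.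
   Context: $a(x)\sim b(x)$ means $a(x)/b(x)\to1$. *)

(* Defs.v *)
From Stdlib Require Import Reals Lra List ClassicalEpsilon.
Open Scope R_scope.

Definition integral_on (g : R -> R) (a b w : R) : Prop :=
  exists pr : Riemann_integrable g a b, RiemannInt pr = w.

Definition improper_0_1 (g : R -> R) (v : R) : Prop :=
  forall eps, 0 < eps -> exists d, 0 < d /\
    forall a, 0 < a < d -> exists w, integral_on g a 1 w /\ Rabs (w - v) < eps.

Definition improper_0_inf (g : R -> R) (v : R) : Prop :=
  forall eps, 0 < eps -> exists d M, 0 < d /\ 0 < M /\
    forall a b, 0 < a < d -> M < b ->
      exists w, integral_on g a b w /\ Rabs (w - v) < eps.

Definition int_0_inf (g : R -> R) : R :=
  epsilon (inhabits 0) (fun v => improper_0_inf g v).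

Definition Gamma (s : R) : R :=
  int_0_inf (fun t => Rpower t (s - 1) * exp (- t)).

(* Expectation of f(X_1,...,X_n) for X_i i.i.d. with density p x^(p-1) on (0,1],
   computed as an iterated (improper Riemann) integral; the list l holds
   (X_1,...,X_n). *)
Fixpoint iter_expect (p : R) (n : nat) (f : list R -> R) (v : R) : Prop :=
  match n with
  | O => f nil = v
  | S m => exists g : R -> R,
      (forall t, 0 < t <= 1 -> iter_expect p m (fun l => f (t :: l)) (g t)) /\
      improper_0_1 (fun t => p * Rpower t (p - 1) * g t) v
  end.

Definition sumR (l : list R) : R := fold_right Rplus 0 l.

Definition Qstat (l : list R) : R :=
  let m := sumR l / INR (length l) in
  fold_right (fun xi acc => (xi - m) ^ 2 + acc) 0 l.

Definition F_Q (p : R) (n : nat) (x : R) : R :=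
  epsilon (inhabits 0)
    (fun v => iter_expect p n (fun l => if Rle_dec (Qstat l) x then 1 else 0) v).

Definition h_minus (p y : R) : R :=
  p * int_0_inf (fun x => exp (- (x - y) ^ 2) * Rpower x (p - 1)).
Definition h_plus (p y : R) : R :=
  p * int_0_inf (fun x => exp (- (x + y) ^ 2) * Rpower x (p - 1)).

Definition delta (p : R) (n : nat) : R := Rmin (INR n * p) (INR n - 1) / 2.

Definition K_pn (p : R) (n : nat) : R :=
  if Rlt_dec (INR n * p) (INR n - 1) then
    int_0_inf (fun y => h_minus p y ^ n + h_plus p y ^ n)
  else if Rlt_dec (INR n - 1) (INR n * p) then
    (p * sqrt PI) ^ n / ((p - 1) * INR n + 1)
  else (p * sqrt PI) ^ n / 2.

Definition C_pn (p : R) (n : nat) : R :=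
  K_pn p n / (Gamma (1 + delta p n) * sqrt (PI / INR n)).

Definition equiv_at_0plus (a b : R -> R) : Prop :=
  forall eps, 0 < eps -> exists d, 0 < d /\
    forall x, 0 < x < d -> Rabs (a x / b x - 1) < eps.

(* Main.v *)
(* Write [L s] for the expectation of [exp (- s Q)]. Since [sum (X_i - y)^2 = Q + n (mean - y)^2],
   integrating [exp (- s sum (X_i - y)^2)] over [y] gives, by independence,
   [sqrt (PI / (n s)) * L s = int_R (E exp (- s (X - y)^2))^n dy], and rescaling by [T = sqrt s] turns
   the right-hand side into [T^(-np-1) * int_R hT(z)^n dz], where [hT] is [h_minus] with its defining
   integral cut at [T]. As [h(z) ~ p sqrt PI z^(p-1)], the last integral converges to that of [h^n]
   when [n (1-p) > 1], and otherwise grows like [(p sqrt PI)^n] times [T^(n(p-1)+1) / (n(p-1)+1)],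
   respectively [ln T]; the contribution of [z > T] stays bounded. A Tauberian theorem then
   transfers the behaviour of [L] at infinity to that of [F_Q] at [0]. In it the polynomials
   [1 - (1 - u)^K], taken at [u = exp (- s Q)], serve as smooth substitutes for the indicator of
   [s Q <= ln K], which avoids Weierstrass approximation. *)
From Coquelicot Require Import Coquelicot.
Require Import Defs.
From Stdlib Require Import Reals Lra Lia List ClassicalEpsilon FunctionalExtensionality.
Open Scope R_scope.

(** * Improper integrals over (0,1] and (0,oo) *)

(** Expectations are iterated improper Riemann integrals, and [F_Q], [Gamma], [h_minus] are picked
    by [epsilon], so each of them needs an existence proof before use. For continuous integrands
    existence comes from uniform continuity on the cube. The indicator of [Q <= x] is discontinuous,
    but its innermost integral is explicit and depends continuously on the other coordinates. The
    second obstacle is to exchange the integral over [z] with the expectation. It becomes a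
    differentiation: the Gaussian in [z] has the primitive [gam], the expectation of that primitive
    is differentiated in [z] with a uniform quadratic error, and the fundamental theorem of calculus
    returns the integral. In the Tauberian step, [1 - (1 - exp (- t))^K] falls from 1 to 0 at
    bounded distance from [t = ln K], so the fall is sharp relative to [ln K]. Dilating by
    [ln K / eta] or [eta ln K] with [eta > 1] gives one-sided bounds on [F_Q]; as [K] grows they
    agree up to powers of [eta], and then [eta] tends to 1. *)

Definition int0 (F : (R -> Prop) -> Prop) (g : R -> R) (v : R) : Prop :=
  is_RInt_gen (V := R_NormedModule) g (at_right 0) F v.

Lemma integral_on_iff g a b w :
  integral_on g a b w <-> is_RInt (V := R_NormedModule) g a b w.
Proof.
  split.
  - intros [pr <-]. rewrite <- RInt_Reals.
    apply (RInt_correct (V := R_CompleteNormedModule)).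
    now apply ex_RInt_Reals_1.
  - intros H.
    assert (E : ex_RInt (V := R_NormedModule) g a b) by now exists w.
    exists (ex_RInt_Reals_0 _ _ _ E). rewrite <- RInt_Reals.
    now apply is_RInt_unique.
Qed.

Lemma at_right0_iff (P : R -> Prop) :
  at_right 0 P <-> exists d, 0 < d /\ forall a, 0 < a < d -> P a.
Proof.
  split.
  - intros [d Hd]. exists d. split; [apply cond_pos|]. intros a Ha.
    apply Hd; [|lra]. change (Rabs (a - 0) < d). rewrite Rabs_right; lra.
  - intros (d & Hd & H). exists (mkposreal d Hd). intros a Ha Ha0.
    change (Rabs (a - 0) < d) in Ha. rewrite Rabs_right in Ha; [|lra]. apply H; lra.
Qed.

Lemma improper_0_1_iff g v : improper_0_1 g v <-> int0 (at_point 1) g v.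
Proof.
  unfold int0, is_RInt_gen. rewrite filterlimi_locally. split.
  - intros H eps. destruct (H eps (cond_pos eps)) as (d & Hd & H').
    apply Filter_prod with (fun a => 0 < a < d) (fun b => b = 1).
    + apply at_right0_iff. now exists d.
    + reflexivity.
    + intros a b Ha ->. destruct (H' a Ha) as (w & Hw & Hv).
      exists w. split; [now apply integral_on_iff|exact Hv].
  - intros H eps He. destruct (H (mkposreal eps He)) as [Q S HQ HS HP].
    apply at_right0_iff in HQ. destruct HQ as (d & Hd & HQ).
    exists d. split; [exact Hd|]. intros a Ha.
    destruct (HP a 1 (HQ a Ha) HS) as (w & Hw & Hv).
    exists w. split; [now apply integral_on_iff|exact Hv].
Qed.

Lemma improper_0_inf_iff g v :
  improper_0_inf g v <-> int0 (Rbar_locally p_infty) g v.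
Proof.
  unfold int0, is_RInt_gen. rewrite filterlimi_locally. split.
  - intros H eps. destruct (H eps (cond_pos eps)) as (d & M & Hd & HM & H').
    apply Filter_prod with (fun a => 0 < a < d) (fun b => M < b).
    + apply at_right0_iff. now exists d.
    + now exists M.
    + intros a b Ha Hb. destruct (H' a b Ha Hb) as (w & Hw & Hv).
      exists w. split; [now apply integral_on_iff|exact Hv].
  - intros H eps He. destruct (H (mkposreal eps He)) as [Q S HQ HS HP].
    apply at_right0_iff in HQ. destruct HQ as (d & Hd & HQ).
    destruct HS as [M HM].
    exists d, (Rmax 1 M). split; [exact Hd|]. split.
    { generalize (Rmax_l 1 M); lra. }
    intros a b Ha Hb.
    destruct (HP a b (HQ a Ha)) as (w & Hw & Hv).
    { apply HM. generalize (Rmax_r 1 M); lra. }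
    exists w. split; [now apply integral_on_iff|exact Hv].
Qed.

(* [Rng] is the set of admissible upper bounds: [b <= 1] for integrals over
   (0,1] and everything for integrals over (0,oo). *)
Record upper_end (F : (R -> Prop) -> Prop) (Rng : R -> Prop) : Prop := {
  ue_filter : ProperFilter F;
  ue_rng : F Rng;
  ue_one : Rng 1;
  ue_dir : forall b0, Rng b0 -> F (fun b => b0 <= b) }.

Lemma upper_end_1 : upper_end (at_point 1) (fun b => b <= 1).
Proof.
  constructor; try (unfold at_point; lra).
  - apply at_point_filter.
  - intros b0 H. exact H.
Qed.

Lemma upper_end_inf : upper_end (Rbar_locally p_infty) (fun _ => True).
Proof.
  constructor; auto.
  - apply Rbar_locally_filter.
  - now exists 0.
  - intros b0 _. exists b0. intros; lra.
Qed.

Section Improper.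
Context (F : (R -> Prop) -> Prop) (Rng : R -> Prop) (HF : upper_end F Rng).

(** Only the upper end differs between the two kinds of integral, so the lower end is made explicit
    and the filter [F] is kept for the upper one. *)
Lemma int0_spec g v :
  int0 F g v <-> forall eps, 0 < eps -> exists d, 0 < d /\
    F (fun b => forall a, 0 < a < d ->
       exists w, is_RInt (V := R_NormedModule) g a b w /\ Rabs (w - v) < eps).
Proof.
  destruct HF as [PF HR H1 HD].
  unfold int0, is_RInt_gen. rewrite filterlimi_locally. split.
  - intros H eps He. destruct (H (mkposreal eps He)) as [Q S HQ HS HP].
    apply at_right0_iff in HQ. destruct HQ as (d & Hd & HQ).
    exists d. split; [exact Hd|].
    apply filter_imp with (2 := HS). intros b Hb a Ha.
    apply (HP a b (HQ a Ha) Hb).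
  - intros H eps. destruct (H eps (cond_pos eps)) as (d & Hd & H').
    apply Filter_prod with (1 := proj2 (at_right0_iff (fun a => 0 < a < d))
      (ex_intro _ d (conj Hd (fun _ h => h)))) (2 := H').
    intros a b Ha Hb. apply (Hb a Ha).
Qed.

Lemma end_ge_1 : F (fun b => 1 <= b).
Proof. apply (ue_dir _ _ HF), (ue_one _ _ HF). Qed.

Lemma int0_le f g v w :
  F (fun b => forall x, 0 < x < b -> f x <= g x) ->
  int0 F f v -> int0 F g w -> v <= w.
Proof.
  intros H Hf Hg. apply Rnot_lt_le. intros C.
  pose proof (ue_filter _ _ HF) as PF.
  destruct (proj1 (int0_spec f v) Hf ((v - w) / 2)) as (d & Hd & H1); [lra|].
  destruct (proj1 (int0_spec g w) Hg ((v - w) / 2)) as (e & He & H2); [lra|].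
  destruct (filter_ex _ (filter_and _ _ H (filter_and _ _ H1
    (filter_and _ _ H2 end_ge_1)))) as (b & K & K1 & K2 & Hb).
  pose (a := Rmin 1 (Rmin d e) / 2).
  assert (0 < a /\ a < d /\ a < e /\ a < 1).
  { unfold a. generalize (Rmin_l 1 (Rmin d e)) (Rmin_r 1 (Rmin d e))
      (Rmin_l d e) (Rmin_r d e) (Rmin_glb_lt d e 0 Hd He).
    intros. assert (0 < Rmin 1 (Rmin d e)) by (apply Rmin_glb_lt; lra). lra. }
  destruct (K1 a) as (x & Hx & Hx'); [lra|].
  destruct (K2 a) as (y & Hy & Hy'); [lra|].
  assert (x <= y).
  { apply (is_RInt_le f g a b); auto; [lra|]. intros t Ht. apply K. lra. }
  apply Rabs_def2 in Hx'. apply Rabs_def2 in Hy'. lra.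
Qed.

Lemma int0_ext f g v :
  F (fun b => forall x, 0 < x < b -> f x = g x) -> int0 F f v -> int0 F g v.
Proof.
  intros H Hf. pose proof (ue_filter _ _ HF) as PF. apply int0_spec.
  intros eps He. destruct (proj1 (int0_spec f v) Hf eps He) as (d & Hd & H1).
  exists (Rmin d 1). split; [apply Rmin_glb_lt; lra|].
  generalize (filter_and _ _ H (filter_and _ _ H1 end_ge_1)).
  apply filter_imp. intros b (K & K1 & Hb) a Ha.
  generalize (Rmin_l d 1) (Rmin_r d 1); intros.
  destruct (K1 a) as (w & Hw & Hw'); [lra|]. exists w. split; auto.
  apply is_RInt_ext with (2 := Hw). intros x Hx.
  rewrite Rmin_left, Rmax_right in Hx by lra. apply K. lra.
Qed.

Lemma int0_lin a b f g v w : int0 F f v -> int0 F g w ->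
  int0 F (fun x => a * f x + b * g x) (a * v + b * w).
Proof.
  intros H1 H2. pose proof (ue_filter _ _ HF) as PF.
  apply (is_RInt_gen_plus (V := R_NormedModule) (fun x => a * f x) (fun x => b * g x)
    (a * v) (b * w)).
  - apply (is_RInt_gen_scal (V := R_NormedModule) f a v H1).
  - apply (is_RInt_gen_scal (V := R_NormedModule) g b w H2).
Qed.

Lemma int0_scal a f v : int0 F f v -> int0 F (fun x => a * f x) (a * v).
Proof.
  intros H1. pose proof (ue_filter _ _ HF) as PF.
  apply (is_RInt_gen_scal (V := R_NormedModule) f a v H1).
Qed.

Definition nice (f : R -> R) :=
  forall x, 0 < x -> Rng x -> continuous f x /\ 0 <= f x.

Hypothesis Rng_down : forall x y, x <= y -> Rng y -> Rng x.

Lemma nice_ex f a b : nice f -> 0 < a -> a <= b -> Rng b ->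
  ex_RInt (V := R_NormedModule) f a b.
Proof.
  intros H Ha Hab Hb. apply (ex_RInt_continuous (V := R_CompleteNormedModule)).
  intros z. rewrite Rmin_left, Rmax_right by lra. intros Hz.
  apply H; [lra|]. apply Rng_down with b; tauto.
Qed.

Lemma nice_mono f a b a' b' : nice f -> 0 < a' -> a' <= a -> a <= b -> b <= b' ->
  Rng b' -> RInt f a b <= RInt f a' b'.
Proof.
  intros H Ha' Haa Hab Hbb Hb'.
  assert (Rb : Rng b) by (apply Rng_down with b'; auto).
  assert (Ra : Rng a) by (apply Rng_down with b; auto).
  assert (E1 := nice_ex f a' a H Ha' Haa Ra).
  assert (E2 := nice_ex f a b H ltac:(lra) Hab Rb).
  assert (E3 := nice_ex f b b' H ltac:(lra) Hbb Hb').
  assert (E12 := nice_ex f a' b H Ha' ltac:(lra) Rb).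
  rewrite <- (RInt_Chasles f a' b b' E12 E3).
  rewrite <- (RInt_Chasles f a' a b E1 E2).
  assert (0 <= RInt f a' a).
  { apply RInt_ge_0; auto. intros x Hx. apply H; [lra|].
    apply Rng_down with a; auto; lra. }
  assert (0 <= RInt f b b').
  { apply RInt_ge_0; auto. intros x Hx. apply H; [lra|].
    apply Rng_down with b'; auto; lra. }
  unfold plus; simpl. lra.
Qed.

Lemma int0_ge f v a b : nice f -> int0 F f v -> 0 < a -> a <= b -> Rng b ->
  RInt f a b <= v.
Proof.
  intros H Hv Ha Hab Hb. apply Rnot_lt_le. intros C.
  pose proof (ue_filter _ _ HF) as PF.
  destruct (proj1 (int0_spec f v) Hv (RInt f a b - v)) as (d & Hd & H1); [lra|].
  destruct (filter_ex _ (filter_and _ _ H1 (filter_and _ _ (ue_rng _ _ HF)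
    (ue_dir _ _ HF b Hb)))) as (b' & K1 & K2 & K3).
  destruct (K1 (Rmin d a / 2)) as (w & Hw & Hw').
  { generalize (Rmin_l d a) (Rmin_glb_lt d a 0 Hd Ha). lra. }
  assert (RInt f a b <= w).
  { rewrite <- (is_RInt_unique _ _ _ _ Hw). apply nice_mono; auto.
    - generalize (Rmin_l d a) (Rmin_glb_lt d a 0 Hd Ha). lra.
    - generalize (Rmin_r d a) (Rmin_glb_lt d a 0 Hd Ha). lra. }
  apply Rabs_def2 in Hw'. lra.
Qed.

Lemma int0_upper f v M : int0 F f v ->
  (forall a b, 0 < a -> a <= b -> Rng b -> RInt f a b <= M) -> v <= M.
Proof.
  intros Hv HM. apply Rnot_lt_le. intros C.
  pose proof (ue_filter _ _ HF) as PF.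
  destruct (proj1 (int0_spec f v) Hv (v - M)) as (d & Hd & H1); [lra|].
  destruct (filter_ex _ (filter_and _ _ H1 (filter_and _ _ (ue_rng _ _ HF)
    end_ge_1))) as (b' & K1 & K2 & K3).
  assert (0 < Rmin d 1) by (apply Rmin_glb_lt; lra).
  destruct (K1 (Rmin d 1 / 2)) as (w & Hw & Hw').
  { generalize (Rmin_l d 1). lra. }
  assert (w <= M).
  { rewrite <- (is_RInt_unique _ _ _ _ Hw). apply HM; auto; [lra|].
    generalize (Rmin_r d 1). lra. }
  apply Rabs_def2 in Hw'. lra.
Qed.

(** For a nonnegative integrand the integral grows with the interval, so the supremum of the proper
    integrals is the limit. All existence proofs for improper integrals of unknown value reduce to
    this. *)
Lemma int0_exists f M : nice f ->
  (forall a b, 0 < a -> a <= b -> Rng b -> RInt f a b <= M) ->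
  exists v, int0 F f v.
Proof.
  intros H HM. pose proof (ue_filter _ _ HF) as PF.
  destruct (completeness (fun w => exists a b, 0 < a /\ a <= b /\ Rng b /\ w = RInt f a b))
    as [v [Hub Hlub]].
  - exists M. intros w (a & b & Ha & Hab & Hb & ->). now apply HM.
  - exists (RInt f 1 1), 1, 1. repeat split; try lra. apply (ue_one _ _ HF).
  - exists v. apply int0_spec. intros eps He.
    assert (N : ~ (is_upper_bound (fun w => exists a b, 0 < a /\ a <= b /\ Rng b /\ w = RInt f a b)
       (v - eps / 2))).
    { intros C. specialize (Hlub _ C). lra. }
    assert (exists a b, 0 < a /\ a <= b /\ Rng b /\ v - eps / 2 < RInt f a b)
      as (a0 & b0 & Ha0 & Hab0 & Hb0 & Hw).
    { apply NNPP. intros C. apply N. intros w (a & b & Ha & Hab & Hb & ->).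
      apply Rnot_lt_le. intros C'. apply C. now exists a, b. }
    exists a0. split; [exact Ha0|].
    generalize (filter_and _ _ (ue_rng _ _ HF) (ue_dir _ _ HF b0 Hb0)).
    apply filter_imp. intros b (Hb & Hbb) a Ha.
    exists (RInt f a b). split.
    + apply (RInt_correct (V := R_CompleteNormedModule)). apply nice_ex; auto; lra.
    + assert (RInt f a b <= v).
      { apply Hub. exists a, b. repeat split; auto; lra. }
      assert (RInt f a0 b0 <= RInt f a b) by (apply nice_mono; auto; lra).
      apply Rabs_def1; lra.
Qed.

End Improper.

(** * The Gaussian integral *)

Lemma exp_le_mono x y : x <= y -> exp x <= exp y.
Proof.
  intros [H | ->]; [apply Rlt_le, exp_increasing, H|apply Rle_refl].
Qed.

Definition gs (v : R) : R := exp (- v ^ 2).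
Definition gam (x : R) : R := RInt gs 0 x.

Lemma gs_continuous (x : R) : continuous gs x.
Proof.
  apply (ex_derive_continuous (K := R_AbsRing) (V := R_NormedModule)).
  unfold gs. auto_derive. trivial.
Qed.

Lemma gs_pos x : 0 < gs x.
Proof. apply exp_pos. Qed.

Lemma gs_le_1 x : gs x <= 1.
Proof.
  unfold gs. rewrite <- exp_0. apply exp_le_mono. nra.
Qed.

Lemma gs_ex a b : ex_RInt (V := R_NormedModule) gs a b.
Proof.
  apply (ex_RInt_continuous (V := R_CompleteNormedModule)).
  intros z _. apply gs_continuous.
Qed.

Lemma gam_derive (x : R) : is_derive gam x (gs x).
Proof.
  apply (is_derive_RInt (V := R_NormedModule) gs gam 0 x).
  - exists (mkposreal 1 Rlt_0_1). intros y _.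
    apply (RInt_correct (V := R_CompleteNormedModule)), gs_ex.
  - apply gs_continuous.
Qed.

Lemma gam_RInt a b : RInt gs a b = gam b - gam a.
Proof.
  assert (H := RInt_Chasles (V := R_CompleteNormedModule) gs 0 a b (gs_ex _ _) (gs_ex _ _)).
  change (RInt gs 0 a + RInt gs a b = RInt gs 0 b) in H. unfold gam. lra.
Qed.

Lemma gam_0 : gam 0 = 0.
Proof. apply (RInt_point (V := R_CompleteNormedModule)). Qed.

Lemma gam_odd x : gam (- x) = - gam x.
Proof.
  unfold gam.
  assert (H := RInt_comp_lin (V := R_CompleteNormedModule) gs (-1) 0 0 (x)).
  replace (-1 * 0 + 0) with 0 in H by ring.
  replace (-1 * x + 0) with (- x) in H by ring.
  rewrite <- H by apply gs_ex.
  rewrite (RInt_ext _ (fun y => opp (gs y))).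
  - rewrite (RInt_opp (V := R_CompleteNormedModule)) by apply gs_ex. reflexivity.
  - intros y _. unfold gs, scal, opp; simpl. unfold mult; simpl.
    replace (-1 * y + 0) with (- y) by ring.
    replace (- y * (- y * 1)) with (y * (y * 1)) by ring. ring.
Qed.

Lemma gam_le a b : a <= b -> gam a <= gam b.
Proof.
  intros H. assert (0 <= RInt gs a b).
  { apply RInt_ge_0; auto; [apply gs_ex|]. intros; apply Rlt_le, gs_pos. }
  rewrite gam_RInt in H0. lra.
Qed.

Lemma gam_nonneg x : 0 <= x -> 0 <= gam x.
Proof. intros H. rewrite <- gam_0. now apply gam_le. Qed.

Lemma gs_decr x y : 0 <= x <= y -> gs y <= gs x.
Proof. intros H. apply exp_le_mono. nra. Qed.

(** The derivative [- 2 c exp (- c^2)] is at most 1 in absolute value, because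
    [2 |c| <= 1 + c^2 <= exp (c^2)]. *)
Lemma gs_lipschitz a b : Rabs (gs a - gs b) <= Rabs (a - b).
Proof.
  destruct (MVT_gen gs b a (fun v => - 2 * v * gs v)) as (c & _ & Hc).
  - intros x _. unfold gs. auto_derive; [trivial|]. simpl; ring.
  - intros x _. apply continuity_pt_filterlim. apply gs_continuous.
  - rewrite Hc, Rabs_mult. rewrite <- (Rmult_1_l (Rabs (a - b))) at 2.
    apply Rmult_le_compat_r; [apply Rabs_pos|].
    rewrite Rabs_mult, (Rabs_right (gs c)) by apply Rle_ge, Rlt_le, gs_pos.
    assert (E : gs c * exp (c ^ 2) = 1).
    { unfold gs. rewrite <- exp_plus. replace (- c ^ 2 + c ^ 2) with 0 by ring. apply exp_0. }
    assert (E1 : 1 + c ^ 2 <= exp (c ^ 2)) by apply exp_ineq1_le.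
    assert (E2 : Rabs (-2 * c) <= 1 + c ^ 2).
    { apply Rabs_le. pose proof (pow2_ge_0 (c-1)). pose proof (pow2_ge_0 (c+1)). split; lra. }
    assert (P := gs_pos c). rewrite <- E, Rmult_comm.
    apply Rmult_le_compat_l; lra.
Qed.

(** Taylor expansion with a remainder uniform in [x]: the mean value theorem leaves
    [h * (gs c - gs x)], and [gs] is 1-Lipschitz. *)
Lemma gam_quad x h : Rabs (gam (x + h) - gam x - h * gs x) <= h ^ 2.
Proof.
  destruct (MVT_gen gam x (x + h) gs) as (c & Hc & E).
  - intros; apply gam_derive.
  - intros y _. apply continuity_pt_filterlim.
    apply (ex_derive_continuous (K := R_AbsRing) (V := R_NormedModule)).
    exists (gs y). apply gam_derive.
  - rewrite E. replace (gs c * (x + h - x) - h * gs x) with (h * (gs c - gs x)) by ring.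
    rewrite Rabs_mult. replace (h ^ 2) with (Rabs h * Rabs h) by (rewrite <- Rabs_mult, Rabs_right; nra).
    apply Rmult_le_compat_l; [apply Rabs_pos|].
    apply Rle_trans with (1 := gs_lipschitz c x).
    unfold Rmin, Rmax in Hc. destruct (Rle_dec x (x + h)).
    + rewrite !Rabs_right; lra.
    + rewrite !Rabs_left1; lra.
Qed.

(* The classical identity
   [gam x ^ 2 + int_0^1 exp (- x^2 (1+t^2)) / (1+t^2) dt = PI / 4]. *)
Definition gauss_aux (x t : R) : R := exp (- (x ^ 2 * (1 + t ^ 2))) / (1 + t ^ 2).

Lemma gauss_aux_ex (x : R) : ex_RInt (V := R_NormedModule) (gauss_aux x) 0 1.
Proof.
  apply (ex_RInt_continuous (V := R_CompleteNormedModule)). intros z _.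
  apply (ex_derive_continuous (K := R_AbsRing) (V := R_NormedModule)).
  unfold gauss_aux. auto_derive. nra.
Qed.

(** Differentiation removes the denominator [1 + t^2], and the substitution [v = x t] recovers
    [gam x]. The result is the opposite of the derivative of [gam x ^ 2], so the sum in the identity
    is constant. *)
Lemma gauss_aux_derive (x : R) :
  is_derive (fun x => RInt (gauss_aux x) 0 1) x (- 2 * gs x * gam x).
Proof.
  assert (D : forall x t, is_derive (fun z => gauss_aux z t) x
     (- 2 * x * exp (- (x ^ 2 * (1 + t ^ 2))))).
  { intros y t. unfold gauss_aux. auto_derive; [nra|]. simpl; field. nra. }
  replace (- 2 * gs x * gam x) with
    (RInt (fun t => Derive (fun u => gauss_aux u t) x) 0 1).
  - apply is_derive_RInt_param.
    + exists (mkposreal 1 Rlt_0_1). intros y _ t _. eexists. apply D.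
    + intros t _.
      apply (continuity_2d_pt_ext (fun u v => - 2 * u * exp (- (u ^ 2 * (1 + v ^ 2))))).
      { intros u v. symmetry. apply is_derive_unique, D. }
      apply continuity_2d_pt_mult.
      * apply continuity_2d_pt_mult; [apply continuity_2d_pt_const|apply continuity_2d_pt_id1].
      * apply (continuity_1d_2d_pt_comp exp (fun u v => - (u ^ 2 * (1 + v ^ 2)))).
        -- apply derivable_continuous_pt, derivable_pt_exp.
        -- apply continuity_2d_pt_opp, continuity_2d_pt_mult.
           ++ simpl. repeat (apply continuity_2d_pt_mult || apply continuity_2d_pt_id1 || apply continuity_2d_pt_const).
           ++ apply continuity_2d_pt_plus; [apply continuity_2d_pt_const|]. simpl.
              repeat (apply continuity_2d_pt_mult || apply continuity_2d_pt_id2 || apply continuity_2d_pt_const).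
    + exists (mkposreal 1 Rlt_0_1). intros y _. apply gauss_aux_ex.
  - assert (C := RInt_comp_lin (V := R_CompleteNormedModule) gs x 0 0 1 (gs_ex _ _)).
    replace (x * 0 + 0) with 0 in C by ring. replace (x * 1 + 0) with x in C by ring.
    change (RInt (fun t => x * gs (x * t + 0)) 0 1 = gam x) in C. rewrite <- C.
    rewrite (RInt_ext _ (fun t => - 2 * gs x * (x * gs (x * t + 0)))).
    + apply (RInt_scal (V := R_CompleteNormedModule) (fun t => x * gs (x * t + 0)) 0 1 (- 2 * gs x)).
      apply (ex_RInt_comp_lin (V := R_NormedModule)), gs_ex.
    + intros t _. change (Derive (fun u => gauss_aux u t) x = - 2 * gs x * (x * gs (x * t + 0))). etransitivity; [exact (is_derive_unique _ _ _ (D x t))|].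
      unfold gs. replace (- (x ^ 2 * (1 + t ^ 2))) with (- x ^ 2 + - (x * t + 0) ^ 2) by ring.
      rewrite exp_plus. ring.
Qed.

Lemma gauss_identity (x : R) : gam x ^ 2 + RInt (gauss_aux x) 0 1 = PI / 4.
Proof.
  assert (H : forall y : R, is_derive (fun x => gam x ^ 2 + RInt (gauss_aux x) 0 1) y 0).
  { intros y. evar_last.
    - apply (is_derive_plus (K := R_AbsRing) (V := R_NormedModule)
        (fun x => gam x ^ 2) (fun x => RInt (gauss_aux x) 0 1)).
      + apply (is_derive_pow gam 2). apply gam_derive.
      + apply gauss_aux_derive.
    - unfold plus; simpl. ring. }
  transitivity (gam 0 ^ 2 + RInt (gauss_aux 0) 0 1).
  - destruct (MVT_gen (fun x => gam x ^ 2 + RInt (gauss_aux x) 0 1) 0 x (fun _ => 0)) as (c & _ & E).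
    + intros; apply H.
    + intros y _. apply continuity_pt_filterlim.
      apply (ex_derive_continuous (K := R_AbsRing) (V := R_NormedModule)
        (fun x => gam x ^ 2 + RInt (gauss_aux x) 0 1)).
      exists 0. apply H.
    + lra.
  - rewrite gam_0.
    assert (E : is_RInt (V := R_NormedModule) (gauss_aux 0) 0 1 (minus (atan 1) (atan 0))).
    { apply (is_RInt_derive (V := R_CompleteNormedModule)).
      - intros t _. unfold gauss_aux.
        replace (exp (- (0 ^ 2 * (1 + t ^ 2))) / (1 + t ^ 2)) with (/ (1 + t ^ 2)).
        + apply is_derive_Reals. apply derivable_pt_lim_atan.
        + replace (- (0 ^ 2 * (1 + t ^ 2))) with 0 by ring. rewrite exp_0. field. nra.
      - intros z _.
        apply (ex_derive_continuous (K := R_AbsRing) (V := R_NormedModule)).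
        unfold gauss_aux. auto_derive. nra. }
    rewrite (is_RInt_unique _ _ _ _ E), atan_1, atan_0. unfold minus, plus, opp; simpl. ring.
Qed.

Lemma sqrtPI_pos : 0 < sqrt PI.
Proof. apply sqrt_lt_R0, PI_RGT_0. Qed.

(** The error term of the identity lies between 0 and [gs x], since [gauss_aux x t <= exp (- x^2)]
    on the unit interval. *)
Lemma gam_bounds x : 0 <= x -> PI / 4 - gs x <= gam x ^ 2 <= PI / 4.
Proof.
  intros Hx. assert (E := gauss_identity x).
  assert (0 <= RInt (gauss_aux x) 0 1).
  { apply RInt_ge_0; [lra|apply gauss_aux_ex|]. intros t _.
    apply Rlt_le, Rdiv_lt_0_compat; [apply exp_pos|nra]. }
  assert (RInt (gauss_aux x) 0 1 <= RInt (fun _ => gs x) 0 1).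
  { apply RInt_le; [lra|apply gauss_aux_ex|apply ex_RInt_const|].
    intros t _. unfold gauss_aux. apply Rle_trans with (exp (- (x ^ 2 * (1 + t ^ 2)))).
    - rewrite <- (Rdiv_1_r (exp (- (x ^ 2 * (1 + t ^ 2))))) at 2.
      apply Rmult_le_compat_l; [apply Rlt_le, exp_pos|].
      apply Rinv_le_contravar; nra.
    - apply exp_le_mono. nra. }
  rewrite (RInt_const (V := R_CompleteNormedModule)) in H0. unfold scal in H0; simpl in H0.
  unfold mult in H0; simpl in H0. lra.
Qed.

Lemma gam_le_lim x : gam x <= sqrt PI / 2.
Proof.
  destruct (Rle_lt_dec 0 x).
  - apply Rsqr_incr_0_var; [|generalize sqrtPI_pos; lra].
    replace ((sqrt PI / 2)²) with (PI / 4).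
    + unfold Rsqr. destruct (gam_bounds x r). lra.
    + unfold Rsqr. transitivity (sqrt PI * sqrt PI / 4); [|field].
      rewrite sqrt_sqrt; [reflexivity|generalize PI_RGT_0; lra].
  - generalize (gam_le x 0) sqrtPI_pos. rewrite gam_0. lra.
Qed.

Lemma gs_RInt_le a b : RInt gs a b <= sqrt PI.
Proof.
  rewrite gam_RInt. generalize (gam_le_lim b) (gam_le_lim (- a)). rewrite gam_odd. lra.
Qed.

Lemma gam_lim : is_lim gam p_infty (sqrt PI / 2).
Proof.
  apply is_lim_spec. intros eps.
  assert (Hs := sqrtPI_pos). assert (He := cond_pos eps).
  assert (Q : 0 < eps * (sqrt PI / 2)) by nra.
  exists (Rmax 0 (/ (eps * (sqrt PI / 2)))). intros x Hx.
  assert (0 < x) by (generalize (Rmax_l 0 (/ (eps * (sqrt PI / 2)))); lra).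
  assert (/ (eps * (sqrt PI / 2)) < x) by (generalize (Rmax_r 0 (/ (eps * (sqrt PI / 2)))); lra).
  assert (G := gam_le_lim x). assert (G0 := gam_nonneg x ltac:(lra)).
  destruct (gam_bounds x) as [B _]; [lra|].
  assert (Hsq : sqrt PI * sqrt PI = PI) by (apply sqrt_sqrt; generalize PI_RGT_0; lra).
  assert (E : gs x < eps * (sqrt PI / 2)).
  { assert (gs x * (1 + x ^ 2) <= 1).
    { assert (E : gs x * exp (x ^ 2) = 1).
      { unfold gs. rewrite <- exp_plus. replace (- x ^ 2 + x ^ 2) with 0 by ring. apply exp_0. }
      apply Rle_trans with (gs x * exp (x ^ 2)); [|lra].
      apply Rmult_le_compat_l; [apply Rlt_le, gs_pos|apply exp_ineq1_le]. }
    assert (1 < x * (eps * (sqrt PI / 2))).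
    { apply Rmult_lt_compat_r with (r := eps * (sqrt PI / 2)) in H0; auto.
      rewrite Rinv_l in H0; lra. }
    assert (x <= 1 + x ^ 2) by nra.
    assert (P := gs_pos x).
    apply Rnot_le_lt. intros C. nra. }
  simpl. rewrite Rabs_left1 by lra.
  (* [(l - gam) l <= l^2 - gam^2 < eps l] with [l = sqrt PI / 2] *)
  apply Rnot_le_lt. intros C.
  assert (eps * (sqrt PI / 2) <= (sqrt PI / 2 - gam x) * (sqrt PI / 2)) by nra.
  assert ((sqrt PI / 2 - gam x) * gam x >= 0) by nra.
  nra.
Qed.

(** * Iterated expectations of uniformly continuous functions *)

Lemma Rpower_small p eps : 0 < p -> 0 < eps ->
  exists d, 0 < d /\ forall a, 0 < a < d -> 0 < Rpower a p < eps.
Proof.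
  intros Hp He. exists (Rpower eps (/ p)). split; [apply exp_pos|].
  intros a Ha. split; [apply exp_pos|].
  assert (E : Rpower (Rpower eps (/ p)) p = eps).
  { rewrite Rpower_mult, Rinv_l, Rpower_1; lra. }
  rewrite <- E. apply Rlt_Rpower_l; lra.
Qed.

Lemma Rpower_derive (q x : R) : 0 < x ->
  is_derive (fun t => Rpower t q) x (q * Rpower x (q - 1)).
Proof. intros H. apply is_derive_Reals, derivable_pt_lim_power, H. Qed.

Lemma Rpower_continuous (q x : R) : 0 < x -> continuous (fun t => Rpower t q) x.
Proof.
  intros H. apply (ex_derive_continuous (K := R_AbsRing) (V := R_NormedModule)).
  eexists. now apply Rpower_derive.
Qed.

Lemma weight_RInt p a b : 0 < a -> 0 < b ->
  is_RInt (V := R_NormedModule) (fun t => p * Rpower t (p - 1)) a b (Rpower b p - Rpower a p).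
Proof.
  intros Ha Hb.
  apply (is_RInt_derive (V := R_CompleteNormedModule) (fun t => Rpower t p)).
  - intros x Hx. apply Rpower_derive.
    apply Rlt_le_trans with (2 := proj1 Hx). now apply Rmin_glb_lt.
  - intros x Hx. apply (continuous_scal_r (V := R_NormedModule) p).
    apply Rpower_continuous.
    apply Rlt_le_trans with (2 := proj1 Hx). now apply Rmin_glb_lt.
Qed.

Lemma Rpower_1_l q : Rpower 1 q = 1.
Proof. unfold Rpower. rewrite ln_1, Rmult_0_r. apply exp_0. Qed.

(** Clamped on both sides because it is evaluated at [mean l + rad l] and [mean l - rad l], which
    may leave the unit interval. *)
Definition cdf p c := if Rle_dec c 0 then 0 else Rmin 1 (Rpower c p).

(** The value [g c] is left free, so that strict and weak indicators are both covered. *)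
Lemma cdf_int p g c : 0 < p -> (forall t, t < c -> g t = 1) -> (forall t, c < t -> g t = 0) ->
  int0 (at_point 1) (fun t => p * Rpower t (p - 1) * g t) (cdf p c).
Proof.
  intros Hp H1 H0. apply (int0_spec _ _ upper_end_1). intros eps He.
  destruct (Rpower_small p eps Hp He) as (d & Hd & Hsmall).
  unfold cdf. destruct (Rle_dec c 0) as [Hc|Hc].
  - exists 1. split; [lra|]. intros a Ha. exists 0. split; [|replace (0 - 0) with 0 by ring; rewrite Rabs_R0; lra].
    apply is_RInt_ext with (fun _ => 0).
    + rewrite Rmin_left, Rmax_right by lra. intros t Ht. rewrite H0 by lra. symmetry; apply Rmult_0_r.
    + evar_last; [apply (is_RInt_const (V := R_NormedModule))|].
      unfold scal; simpl; unfold mult; simpl; ring.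
  - assert (Hc0 : 0 < c) by lra. exists (Rmin (Rmin d 1) c).
    split; [repeat apply Rmin_glb_lt; lra|]. intros a Ha.
    assert (0 < a /\ a < d /\ a < 1 /\ a < c) as (A1 & A2 & A3 & A4).
    { generalize (Rmin_l (Rmin d 1) c) (Rmin_r (Rmin d 1) c) (Rmin_l d 1) (Rmin_r d 1). lra. }
    specialize (Hsmall a ltac:(lra)).
    destruct (Rle_lt_dec 1 c) as [C|C].
    + exists (Rpower 1 p - Rpower a p). split.
      * apply is_RInt_ext with (2 := weight_RInt p a 1 A1 Rlt_0_1).
        rewrite Rmin_left, Rmax_right by lra. intros t Ht. rewrite H1 by lra. symmetry; apply Rmult_1_r.
      * rewrite Rpower_1_l. assert (1 <= Rpower c p).
        { rewrite <- (Rpower_O c) by lra. apply Rle_Rpower; lra. }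
        rewrite Rmin_left by lra. apply Rabs_def1; lra.
    + exists (plus (Rpower c p - Rpower a p) 0). split.
      * apply (is_RInt_Chasles (V := R_NormedModule)) with c.
        -- apply is_RInt_ext with (2 := weight_RInt p a c A1 Hc0).
           rewrite Rmin_left, Rmax_right by lra. intros t Ht. rewrite H1 by lra. symmetry; apply Rmult_1_r.
        -- apply is_RInt_ext with (fun _ => 0).
           ++ rewrite Rmin_left, Rmax_right by lra. intros t Ht. rewrite H0 by lra. symmetry; apply Rmult_0_r.
           ++ evar_last; [apply (is_RInt_const (V := R_NormedModule))|].
              unfold scal; simpl; unfold mult; simpl; ring.
      * assert (Rpower c p <= 1).
        { rewrite <- (Rpower_1_l p). apply Rle_Rpower_l; lra. }
        rewrite Rmin_right by lra. unfold plus; simpl. apply Rabs_def1; lra.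
Qed.

Lemma weight_int p : 0 < p -> int0 (at_point 1) (fun t => p * Rpower t (p - 1)) 1.
Proof.
  intros Hp.
  (* Any threshold above 1 would do: the indicator is then identically 1 on the interval. *)
  apply (int0_ext _ _ upper_end_1 (fun t => p * Rpower t (p - 1) * (if Rlt_dec t 2 then 1 else 0))).
  - unfold at_point. intros x Hx. destruct Rlt_dec; [ring|lra].
  - replace 1 with (cdf p 2) at 2.
    + apply cdf_int; auto; intros t Ht; destruct Rlt_dec; lra.
    + unfold cdf. destruct Rle_dec; [lra|]. apply Rmin_left.
      rewrite <- (Rpower_O 2) by lra. apply Rle_Rpower; lra.
Qed.

Lemma continuity_pt_local f g x d : 0 < d -> (forall y, Rabs (y - x) < d -> f y = g y) ->
  continuity_pt f x -> continuity_pt g x.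
Proof.
  intros Hd H. rewrite !continuity_pt_filterlim. intros Hf.
  apply (continuous_ext_loc g f) with (2 := Hf).
  exists (mkposreal d Hd). intros y Hy. apply H. exact Hy.
Qed.

Lemma continuity_pt_Rmin1 f x : continuity_pt f x -> continuity_pt (fun y => Rmin 1 (f y)) x.
Proof.
  intros H. apply (continuity_pt_ext (fun y => (1 + f y - Rabs (1 - f y)) * (/ 2))).
  - intros y. unfold Rmin. destruct (Rle_dec 1 (f y)).
    + rewrite Rabs_left1; lra.
    + rewrite Rabs_right; lra.
  - assert (C : forall k : R, continuity_pt (fun _ => k) x).
    { intros k. apply continuity_const. intros a b; reflexivity. }
    apply (continuity_pt_mult (fun y => 1 + f y - Rabs (1 - f y)) (fun _ => / 2)); [|apply C].
    apply (continuity_pt_minus (fun y => 1 + f y) (fun y => Rabs (1 - f y))).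
    + apply (continuity_pt_plus (fun _ => 1) f); auto.
    + apply (continuity_pt_comp (fun y => 1 - f y) Rabs).
      * apply (continuity_pt_minus (fun _ => 1) f); auto.
      * apply Rcontinuity_abs.
Qed.

Lemma cdf_continuous p : 0 < p -> continuity (cdf p).
Proof.
  intros Hp c. destruct (Rtotal_order c 0) as [C|[C|C]].
  - apply (continuity_pt_local (fun _ => 0) _ c (- c)); [lra| |].
    + intros y Hy. apply Rabs_def2 in Hy. unfold cdf. destruct Rle_dec; [reflexivity|lra].
    + apply continuity_const. intros a b; reflexivity.
  - subst c. intros eps He. destruct (Rpower_small p eps Hp He) as (d & Hd & Hs).
    exists d. split; [exact Hd|]. intros x [_ Hx]. simpl in *. unfold R_dist in *.
    rewrite Rminus_0_r in Hx. unfold cdf. destruct (Rle_dec 0 0); [|lra].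
    destruct (Rle_dec x 0).
    + rewrite Rminus_0_r, Rabs_R0. exact He.
    + rewrite Rabs_right in Hx by lra. specialize (Hs x ltac:(lra)).
      assert (0 < Rmin 1 (Rpower x p)) by (apply Rmin_glb_lt; lra).
      generalize (Rmin_r 1 (Rpower x p)). intros. apply Rabs_def1; lra.
  - apply (continuity_pt_local (fun y => Rmin 1 (Rpower y p)) _ c c); [lra| |].
    + intros y Hy. apply Rabs_def2 in Hy. unfold cdf. destruct Rle_dec; [lra|reflexivity].
    + apply continuity_pt_Rmin1. apply continuity_pt_filterlim, Rpower_continuous; lra.
Qed.

(** * Iterated expectations: order, linearity, independence, existence *)

Definition cube (n : nat) (l : list R) : Prop :=
  length l = n /\ Forall (fun t => 0 < t <= 1) l.

Lemma cube_cons n t l : 0 < t <= 1 -> cube n l -> cube (S n) (t :: l).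
Proof. intros Ht [H1 H2]. split; [simpl; congruence|now constructor]. Qed.

Section IterExpect.
Context (p : R) (hp : 0 < p).

Lemma iter_expect_ext n : forall f g v, (forall l, cube n l -> f l = g l) ->
  iter_expect p n f v -> iter_expect p n g v.
Proof.
  induction n as [|n IH]; simpl; intros f g v H.
  - intros <-. symmetry. apply H. split; [reflexivity|constructor].
  - intros (h & Hh & Hv). exists h. split; [|exact Hv]. intros t Ht.
    apply IH with (2 := Hh t Ht). intros l Hl. apply H. now apply cube_cons.
Qed.

Lemma iter_expect_le n : forall f g v w, (forall l, cube n l -> f l <= g l) ->
  iter_expect p n f v -> iter_expect p n g w -> v <= w.
Proof.
  induction n as [|n IH]; simpl; intros f g v w H.
  - intros <- <-. apply H. split; [reflexivity|constructor].
  - intros (h & Hh & Hv) (k & Hk & Hw).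
    apply improper_0_1_iff in Hv. apply improper_0_1_iff in Hw.
    apply (int0_le _ _ upper_end_1) with (2 := Hv) (3 := Hw). intros t Ht.
    apply Rmult_le_compat_l.
    + apply Rmult_le_pos; [lra|apply Rlt_le, exp_pos].
    + apply IH with (2 := Hh t ltac:(lra)) (3 := Hk t ltac:(lra)).
      intros l Hl. apply H. apply cube_cons; auto; lra.
Qed.

Lemma iter_expect_unique n f v w :
  iter_expect p n f v -> iter_expect p n f w -> v = w.
Proof.
  intros H1 H2. apply Rle_antisym; eapply iter_expect_le; eauto; intros; lra.
Qed.

Lemma iter_expect_lin a b n : forall f g v w,
  iter_expect p n f v -> iter_expect p n g w ->
  iter_expect p n (fun l => a * f l + b * g l) (a * v + b * w).
Proof.
  induction n as [|n IH]; simpl; intros f g v w.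
  - intros <- <-. reflexivity.
  - intros (h & Hh & Hv) (k & Hk & Hw).
    apply improper_0_1_iff in Hv. apply improper_0_1_iff in Hw.
    exists (fun t => a * h t + b * k t). split.
    + intros t Ht. apply IH; auto.
    + apply improper_0_1_iff.
      apply (int0_ext _ _ upper_end_1) with (2 := int0_lin _ _ upper_end_1 a b _ _ _ _ Hv Hw).
      intros t _. ring.
Qed.

Lemma iter_expect_const c n : iter_expect p n (fun _ => c) c.
Proof.
  induction n as [|n IH]; simpl; [reflexivity|].
  exists (fun _ => c). split; [auto|]. apply improper_0_1_iff.
  assert (E := int0_scal _ _ upper_end_1 c _ _ (weight_int p hp)). rewrite Rmult_1_r in E.
  apply (int0_ext _ _ upper_end_1) with (2 := E).
  intros t _. ring.
Qed.

(** Independence in iterated form: the factor [phi t] is a constant for the inner integrals. *)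
Lemma iter_expect_prod phi v n :
  int0 (at_point 1) (fun t => p * Rpower t (p - 1) * phi t) v ->
  iter_expect p n (fun l => fold_right (fun t acc => phi t * acc) 1 l) (v ^ n).
Proof.
  intros Hv. induction n as [|n IH]; simpl; [reflexivity|].
  exists (fun t => phi t * v ^ n). split.
  - intros t _.
    replace (phi t * v ^ n) with (phi t * v ^ n + 0 * v ^ n) by ring.
    apply iter_expect_ext with (2 := iter_expect_lin (phi t) 0 n _ _ _ _ IH IH).
    intros l _. ring.
  - apply improper_0_1_iff. replace (v * v ^ n) with (v ^ n * v) by ring.
    apply (int0_ext _ _ upper_end_1) with (2 := int0_scal _ _ upper_end_1 (v ^ n) _ _ Hv).
    intros t _. ring.
Qed.

(** [iter_expect] peels off the first coordinate as the outermost integral. This gives access to the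
    innermost one, the last coordinate, so that it can be evaluated in closed form. *)
Lemma iter_expect_snoc k : forall f w v,
  (forall l, cube k l -> iter_expect p 1 (fun l' => f (l ++ l')) (w l)) ->
  iter_expect p k w v -> iter_expect p (S k) f v.
Proof.
  induction k as [|k IH]; intros f w v H.
  - intros <-. apply (H nil). split; [reflexivity|constructor].
  - intros (g & Hg & Hv). exists g. split; [|exact Hv]. intros t Ht.
    apply (IH (fun l => f (t :: l)) (fun l => w (t :: l))); auto.
    intros l Hl. apply (H (t :: l)). now apply cube_cons.
Qed.

(** Uniformity is what survives integration: an expectation has total mass one, so slices
    [f (a :: l)] and [f (b :: l)] that are uniformly close have close expectations, and the inner
    integral is continuous in the outer variable. *)
Definition UC n (f : list R -> R) := forall eps, 0 < eps -> exists d, 0 < d /\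
  forall l l', cube n l -> cube n l' -> Forall2 (fun a b => Rabs (a - b) < d) l l' ->
    Rabs (f l - f l') < eps.

Definition bdd n (f : list R -> R) B := forall l, cube n l -> Rabs (f l) <= B.

Lemma iter_expect_exists n : forall f B, UC n f -> bdd n f B -> exists v, iter_expect p n f v.
Proof.
  induction n as [|n IH]; intros f B Hf HB.
  { exists (f nil). reflexivity. }
  pose (g0 := fun t => epsilon (inhabits 0) (fun v => iter_expect p n (fun l => f (t :: l)) v)).
  assert (Hg0 : forall t, 0 < t <= 1 -> iter_expect p n (fun l => f (t :: l)) (g0 t)).
  { intros t Ht. apply epsilon_spec. apply IH with B.
    - intros eps He. destruct (Hf eps He) as (d & Hd & H). exists d. split; [exact Hd|].
      intros l l' Hl Hl' HH. apply H; try (now apply cube_cons).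
      constructor; auto. replace (t - t) with 0 by ring. now rewrite Rabs_R0.
    - intros l Hl. apply HB. now apply cube_cons. }
  (* [g0] is arbitrary beyond 1, whereas [nice] asks for two-sided continuity at the endpoint 1;
     extending by the value at 1 provides it. *)
  pose (g := fun t => g0 (Rmin 1 t)).
  assert (Hmin : forall t, 0 < t -> 0 < Rmin 1 t <= 1).
  { intros t Ht. split; [apply Rmin_glb_lt; lra|apply Rmin_l]. }
  assert (Hg : forall t, 0 < t <= 1 -> iter_expect p n (fun l => f (t :: l)) (g t)).
  { intros t Ht. unfold g. rewrite Rmin_right by lra. now apply Hg0. }
  assert (Bg : forall t, 0 < t -> - B <= g t <= B).
  { intros t Ht. specialize (Hmin t Ht). split.
    - apply iter_expect_le with (2 := iter_expect_const (- B) n) (3 := Hg0 _ Hmin).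
      intros l Hl. generalize (HB _ (cube_cons _ _ _ Hmin Hl)). intros C. apply Rabs_le_between in C. lra.
    - apply iter_expect_le with (2 := Hg0 _ Hmin) (3 := iter_expect_const B n).
      intros l Hl. generalize (HB _ (cube_cons _ _ _ Hmin Hl)). intros C. apply Rabs_le_between in C. lra. }
  assert (Cg : forall t, 0 < t -> continuous g t).
  { intros t Ht. apply (proj1 (continuity_pt_filterlim g t)). intros eps He.
    destruct (Hf (eps / 2)) as (d & Hd & H); [lra|].
    assert (D : 0 < Rmin d t) by (apply Rmin_glb_lt; lra).
    exists (Rmin d t). split; [exact D|].
    intros x [_ Hx]. simpl in *. unfold R_dist in *.
    generalize (Rmin_l d t) (Rmin_r d t); intros D1 D2.
    assert (X : 0 < x) by (apply Rabs_def2 in Hx; lra).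
    assert (M : Rabs (Rmin 1 x - Rmin 1 t) < d).
    { apply Rle_lt_trans with (Rabs (x - t)); [|lra].
      unfold Rmin. destruct (Rle_dec 1 x), (Rle_dec 1 t);
      unfold Rabs; repeat destruct Rcase_abs; lra. }
    assert (K : forall a b, 0 < a <= 1 -> 0 < b <= 1 -> Rabs (a - b) < d -> g0 a <= g0 b + eps / 2).
    { intros a b Ha Hb Hab.
      replace (g0 b + eps / 2) with (1 * g0 b + 1 * (eps / 2)) by ring.
      apply iter_expect_le with (2 := Hg0 a Ha)
        (3 := iter_expect_lin 1 1 n _ _ _ _ (Hg0 b Hb) (iter_expect_const (eps / 2) n)).
      intros l Hl.
      assert (Rabs (f (a :: l) - f (b :: l)) < eps / 2).
      { apply H; try (now apply cube_cons). constructor; auto.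
        clear - Hd. induction l; constructor; auto.
        replace (a - a) with 0 by ring. now rewrite Rabs_R0. }
      apply Rabs_def2 in H0. lra. }
    assert (K1 := K _ _ (Hmin x X) (Hmin t Ht) M).
    rewrite Rabs_minus_sym in M.
    assert (K2 := K _ _ (Hmin t Ht) (Hmin x X) M).
    unfold g. apply Rabs_def1; lra. }
  (* Adding the bound [B] makes the integrand nonnegative, so that [int0_exists] applies. The shift
     is undone at the end with [weight_int]. *)
  assert (N : nice (fun b => b <= 1) (fun t => p * Rpower t (p - 1) * (g t + B))).
  { intros t Ht _. split.
    - apply (continuous_mult (K := R_AbsRing) (fun t => p * Rpower t (p - 1)) (fun t => g t + B)).
      + apply (continuous_scal_r (V := R_NormedModule) p). now apply Rpower_continuous.
      + apply (continuous_plus (V := R_NormedModule) g (fun _ => B)); [auto|apply continuous_const].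
    - apply Rmult_le_pos; [|specialize (Bg t Ht); lra].
      apply Rmult_le_pos; [lra|apply Rlt_le, exp_pos]. }
  destruct (int0_exists _ _ upper_end_1 ltac:(intros; lra) _ (2 * B) N) as (v & Hv).
  { intros a b Ha Hab Hb.
    apply Rle_trans with (2 * B * (Rpower b p - Rpower a p)).
    - apply (is_RInt_le (fun t => p * Rpower t (p - 1) * (g t + B)) (fun t => 2 * B * (p * Rpower t (p - 1))) a b); auto.
      + apply (RInt_correct (V := R_CompleteNormedModule)).
        apply (nice_ex (fun b => b <= 1)); auto. intros; lra.
      + apply (is_RInt_scal (V := R_NormedModule)). apply weight_RInt; lra.
      + intros t Ht. specialize (Bg t ltac:(lra)).
        assert (0 < Rpower t (p - 1)) by apply exp_pos.
        assert (0 < p * Rpower t (p - 1)) by (apply Rmult_lt_0_compat; lra). nra.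
    - assert (0 < Rpower a p) by apply exp_pos.
      assert (Rpower b p <= 1).
      { rewrite <- (Rpower_1_l p). apply Rle_Rpower_l; lra. }
      specialize (Bg 1 Rlt_0_1). nra. }
  exists (1 * v + - B * 1), g. split; [exact Hg|]. apply improper_0_1_iff.
  apply (int0_ext _ _ upper_end_1) with
    (2 := int0_lin _ _ upper_end_1 1 (- B) _ _ _ _ Hv (weight_int p hp)).
  intros t _. ring.
Qed.

End IterExpect.

(** * The law of Q *)

Definition UCB n f := UC n f /\ exists B, bdd n f B.

Lemma UCB_ext n f g : (forall l, cube n l -> f l = g l) -> UCB n f -> UCB n g.
Proof.
  intros H [U [B HB]]. split.
  - intros eps He. destruct (U eps He) as (d & Hd & K). exists d. split; auto.
    intros l l' Hl Hl' HH. rewrite <- !H by auto. now apply K.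
  - exists B. intros l Hl. rewrite <- H by auto. now apply HB.
Qed.

(** Boundedness puts the range of [f] in a compact interval, on which [phi] is bounded and uniformly
    continuous by Heine's theorem. This is why the two properties travel together in [UCB]. *)
Lemma UCB_comp n phi f : continuity phi -> UCB n f -> UCB n (fun l => phi (f l)).
Proof.
  intros Hphi [U [B HB]].
  assert (HB' : forall l, cube n l -> - (Rabs B) <= f l <= Rabs B).
  { intros l Hl. apply Rabs_le_between. apply Rle_trans with (1 := HB l Hl), Rle_abs. }
  assert (PB : - Rabs B <= Rabs B) by (generalize (Rabs_pos B); lra).
  split.
  - intros eps He.
    destruct (Heine_cor2 (f := phi) (a := - Rabs B) (b := Rabs B)
      (fun x _ => Hphi x) (mkposreal eps He)) as [d Hd].
    destruct (U d (cond_pos d)) as (d' & Hd' & K). exists d'. split; [exact Hd'|].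
    intros l l' Hl Hl' HH. apply Hd; auto.
  - destruct (continuity_ab_maj (fun x => Rabs (phi x)) (- Rabs B) (Rabs B) PB) as (M & HM & _).
    { intros c _. apply (continuity_pt_comp phi Rabs); [apply Hphi|apply Rcontinuity_abs]. }
    exists (Rabs (phi M)). intros l Hl. apply HM. auto.
Qed.

Lemma UCB_const n c : UCB n (fun _ => c).
Proof.
  split.
  - intros eps He. exists 1. split; [lra|]. intros. replace (c - c) with 0 by ring.
    now rewrite Rabs_R0.
  - exists (Rabs c). intros l _. apply Rle_refl.
Qed.

Lemma UCB_plus n f g : UCB n f -> UCB n g -> UCB n (fun l => f l + g l).
Proof.
  intros [U [B HB]] [V [C HC]]. split.
  - intros eps He. destruct (U (eps / 2)) as (d & Hd & H1); [lra|].
    destruct (V (eps / 2)) as (e & He' & H2); [lra|].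
    exists (Rmin d e). split; [apply Rmin_glb_lt; lra|].
    intros l l' Hl Hl' HH.
    assert (K1 : Rabs (f l - f l') < eps / 2).
    { apply H1; auto. eapply Forall2_impl; [|exact HH]. simpl. intros.
      generalize (Rmin_l d e); lra. }
    assert (K2 : Rabs (g l - g l') < eps / 2).
    { apply H2; auto. eapply Forall2_impl; [|exact HH]. simpl. intros.
      generalize (Rmin_r d e); lra. }
    replace (f l + g l - (f l' + g l')) with ((f l - f l') + (g l - g l')) by ring.
    apply Rle_lt_trans with (1 := Rabs_triang _ _). lra.
  - exists (B + C). intros l Hl. apply Rle_trans with (1 := Rabs_triang _ _).
    generalize (HB l Hl) (HC l Hl). lra.
Qed.

Lemma UCB_scal n c f : UCB n f -> UCB n (fun l => c * f l).
Proof.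
  apply (UCB_comp n (fun x => c * x)). apply continuity_scal.
  apply derivable_continuous, derivable_id.
Qed.

Lemma UCB_minus n f g : UCB n f -> UCB n g -> UCB n (fun l => f l - g l).
Proof.
  intros U V. apply (UCB_ext n (fun l => f l + -1 * g l)); [intros; ring|].
  apply UCB_plus; auto. now apply UCB_scal.
Qed.

Lemma continuity_sq : continuity (fun x => x ^ 2).
Proof. apply derivable_continuous, derivable_pow. Qed.

(** Polarization reduces products to squares, which are compositions. *)
Lemma UCB_mult n f g : UCB n f -> UCB n g -> UCB n (fun l => f l * g l).
Proof.
  intros U V.
  apply (UCB_ext n (fun l => / 4 * ((f l + g l) ^ 2 - (f l - g l) ^ 2))); [intros; field|].
  apply UCB_scal, UCB_minus.
  - apply (UCB_comp n (fun x => x ^ 2)); [apply continuity_sq|]. now apply UCB_plus.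
  - apply (UCB_comp n (fun x => x ^ 2)); [apply continuity_sq|]. now apply UCB_minus.
Qed.

Lemma UCB_sum phi n : continuity phi ->
  UCB n (fun l => fold_right (fun t acc => phi t + acc) 0 l).
Proof.
  intros Hphi. induction n as [|n IH].
  { apply (UCB_ext 0 (fun _ => 0)); [|apply UCB_const].
    intros [|t l] [H _]; [reflexivity|discriminate H]. }
  destruct IH as [U [B HB]]. split.
  - intros eps He. destruct (U (eps / 2)) as (d & Hd & H1); [lra|].
    assert (He2 : 0 < eps / 2) by lra.
    destruct (Heine_cor2 (f := phi) (a := 0) (b := 1)
      (fun x _ => Hphi x) (mkposreal _ He2)) as [e H2].
    exists (Rmin d e). split; [apply Rmin_glb_lt; auto; apply cond_pos|].
    intros [|t l] [|t' l'] [Hn Hl] [Hn' Hl'] HH; try discriminate.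
    apply Forall_cons_iff in Hl. apply Forall_cons_iff in Hl'. destruct Hl as [Ht Hl], Hl' as [Ht' Hl'].
    inversion HH; subst. simpl.
    assert (K1 : Rabs (fold_right (fun t acc => phi t + acc) 0 l
       - fold_right (fun t acc => phi t + acc) 0 l') < eps / 2).
    { apply H1; [split; auto|split; auto|]. eapply Forall2_impl; [|eassumption]. simpl. intros.
      generalize (Rmin_l d e); lra. }
    assert (K2 : Rabs (phi t - phi t') < eps / 2).
    { apply H2; try lra. generalize (Rmin_r d e); lra. }
    match goal with |- Rabs (_ + ?a - (_ + ?b)) < _ =>
      replace (phi t + a - (phi t' + b)) with ((phi t - phi t') + (a - b)) by ring end.
    apply Rle_lt_trans with (1 := Rabs_triang _ _). lra.
  - destruct (continuity_ab_maj (fun x => Rabs (phi x)) 0 1 ltac:(lra)) as (M & HM & _).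
    { intros c _. apply (continuity_pt_comp phi Rabs); [apply Hphi|apply Rcontinuity_abs]. }
    exists (Rabs (phi M) + B). intros [|t l] [Hn Hl]; try discriminate.
    apply Forall_cons_iff in Hl. destruct Hl as [Ht Hl]. simpl.
    apply Rle_trans with (1 := Rabs_triang _ _). apply Rplus_le_compat.
    + apply (HM t). lra.
    + apply HB. split; auto.
Qed.

(** * Algebra of the statistic Q *)

Definition sumsq (l : list R) : R := fold_right (fun t acc => t ^ 2 + acc) 0 l.

Lemma sum_shift l m : fold_right (fun xi acc => (xi - m) ^ 2 + acc) 0 l =
  sumsq l - 2 * m * sumR l + INR (length l) * m ^ 2.
Proof.
  induction l as [|t l IH].
  - unfold sumsq, sumR. simpl. ring.
  - change (length (t :: l)) with (S (length l)). rewrite S_INR.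
    change (sumsq (t :: l)) with (t ^ 2 + sumsq l).
    change (sumR (t :: l)) with (t + sumR l). cbn [fold_right]. rewrite IH. ring.
Qed.

Lemma Qstat_eq l : (length l <> 0)%nat ->
  Qstat l = sumsq l - sumR l ^ 2 / INR (length l).
Proof.
  intros H. unfold Qstat. rewrite sum_shift. field. now apply not_0_INR.
Qed.

Lemma Qstat_nonneg l : 0 <= Qstat l.
Proof.
  unfold Qstat. generalize (sumR l / INR (length l)) as m. intros m.
  induction l as [|t l IH]; cbn [fold_right]; [lra|]. generalize (pow2_ge_0 (t - m)). lra.
Qed.

Lemma Qstat_shift l y : (length l <> 0)%nat ->
  fold_right (fun xi acc => (xi - y) ^ 2 + acc) 0 l =
  Qstat l + INR (length l) * (sumR l / INR (length l) - y) ^ 2.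
Proof.
  intros H. rewrite Qstat_eq by auto. rewrite sum_shift. field. now apply not_0_INR.
Qed.

(** Welford's update: as a function of the new coordinate, Q is a quadratic with its minimum at the
    old mean. Its sublevel sets are therefore intervals centred there. *)
Lemma Qstat_snoc l t : (length l <> 0)%nat ->
  Qstat (l ++ t :: nil) = Qstat l +
    INR (length l) / (INR (length l) + 1) * (t - sumR l / INR (length l)) ^ 2.
Proof.
  intros H. assert (E : length (l ++ t :: nil) = S (length l)) by (rewrite length_app; simpl; lia).
  rewrite !Qstat_eq by lia. rewrite E, S_INR.
  assert (S1 : sumsq (l ++ t :: nil) = sumsq l + t ^ 2).
  { clear. unfold sumsq. induction l as [|x l IH]; cbn [app fold_right]; [ring|]. rewrite IH. ring. }
  assert (S2 : sumR (l ++ t :: nil) = sumR l + t).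
  { clear. unfold sumR. induction l as [|x l IH]; cbn [app fold_right]; [ring|]. rewrite IH. ring. }
  rewrite S1, S2. field. apply not_0_INR in H. generalize (pos_INR (length l)). lra.
Qed.

Definition mean (l : list R) : R := sumR l / INR (length l).

Lemma UCB_mean n : UCB n mean.
Proof.
  apply (UCB_ext n (fun l => / INR n * sumR l)).
  - intros l [Hn _]. unfold mean. rewrite Hn. unfold Rdiv. ring.
  - apply UCB_scal. apply (UCB_sum (fun t => t)). apply derivable_continuous, derivable_id.
Qed.

Lemma UCB_Qstat n : (n <> 0)%nat -> UCB n Qstat.
Proof.
  intros H.
  apply (UCB_ext n (fun l => sumsq l - / INR n * (sumR l * sumR l))).
  - intros l [Hn _]. rewrite Qstat_eq by lia. rewrite Hn. field. now apply not_0_INR.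
  - assert (U : UCB n sumR) by (apply (UCB_sum (fun t => t)); apply derivable_continuous, derivable_id).
    apply UCB_minus.
    + apply (UCB_sum (fun t => t ^ 2)), continuity_sq.
    + apply UCB_scal. now apply UCB_mult.
Qed.

Lemma mean_cube n l : (n <> 0)%nat -> cube n l -> 0 <= mean l <= 1.
Proof.
  intros Hn0 [Hn Hl]. assert (0 <= sumR l <= INR (length l)).
  { clear - Hl. induction Hl as [|t l Ht Hl IH]; [simpl; split; lra|].
    change (length (t :: l)) with (S (length l)). rewrite S_INR.
    change (sumR (t :: l)) with (t + sumR l). split; lra. }
  assert (0 < INR (length l)) by (apply lt_0_INR; lia).
  unfold mean. split.
  - apply Rdiv_le_0_compat; lra.
  - apply Rle_div_l; lra.
Qed.

(** [(q + Rabs q) / 2] is the positive part of [q], which makes the radius of a possibly empty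
    interval a continuous function. *)
Lemma continuity_sqrt_pos : continuity (fun q => sqrt ((q + Rabs q) / 2)).
Proof.
  intros q. apply (continuity_pt_comp (fun q => (q + Rabs q) / 2) sqrt).
  - apply (continuity_pt_mult (fun q => q + Rabs q) (fun _ => / 2)).
    + apply (continuity_pt_plus (fun q => q) Rabs); [|apply Rcontinuity_abs].
      apply derivable_continuous_pt, derivable_pt_id.
    + apply continuity_const. intros a b; reflexivity.
  - apply continuity_pt_sqrt. generalize (Rle_abs (- q)). rewrite Rabs_Ropp. lra.
Qed.

(** * Expectation as a function, and existence of the distribution function of Q *)

Section Law.
Context (p : R) (hp : 0 < p).

Lemma UCB_exists n f : UCB n f -> exists v, iter_expect p n f v.
Proof. intros [U [B HB]]. now apply (iter_expect_exists p hp n f B). Qed.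

Definition expect n (f : list R -> R) : R :=
  epsilon (inhabits 0) (fun v => iter_expect p n f v).

Lemma expect_spec n f : UCB n f -> iter_expect p n f (expect n f).
Proof. intros U. unfold expect. apply epsilon_spec. now apply UCB_exists. Qed.

Lemma expect_unique n f v : iter_expect p n f v -> expect n f = v.
Proof.
  intros H. apply (iter_expect_unique p hp n f); auto.
  unfold expect. apply epsilon_spec. now exists v.
Qed.

Lemma expect_le n f g : UCB n f -> UCB n g -> (forall l, cube n l -> f l <= g l) ->
  expect n f <= expect n g.
Proof.
  intros U V H. apply (iter_expect_le p hp n f g); auto; now apply expect_spec.
Qed.

Lemma expect_ext n f g : UCB n f -> (forall l, cube n l -> f l = g l) ->
  expect n f = expect n g.
Proof.
  intros U H. symmetry. apply expect_unique.
  apply iter_expect_ext with f; auto. now apply expect_spec.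
Qed.

Lemma expect_lin n a b f g : UCB n f -> UCB n g ->
  expect n (fun l => a * f l + b * g l) = a * expect n f + b * expect n g.
Proof.
  intros U V. apply expect_unique. apply iter_expect_lin; now apply expect_spec.
Qed.

Lemma expect_const n c : expect n (fun _ => c) = c.
Proof. apply expect_unique. now apply iter_expect_const. Qed.

(* Given the first [n-1] coordinates, [Q <= x] cuts out an interval for the last one. *)
Lemma Qind_exists n x : (2 <= n)%nat -> exists v,
  iter_expect p n (fun l => if Rle_dec (Qstat l) x then 1 else 0) v.
Proof.
  intros Hn. destruct n as [|k]; [lia|]. assert (Hk : (k <> 0)%nat) by lia.
  assert (HK : 0 < INR k) by (apply lt_0_INR; lia).
  (* By [Qstat_snoc], the condition on the last coordinate [t] is [(t - mean l)^2 <= (k + 1) / k *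
     (x - Qstat l)]. The positive part sets the radius to 0 when there is no solution. *)
  pose (rad := fun l => sqrt (((INR k + 1) / INR k * (x - Qstat l) +
                   Rabs ((INR k + 1) / INR k * (x - Qstat l))) / 2)).
  pose (w := fun l => cdf p (mean l + rad l) - cdf p (mean l - rad l)).
  assert (Ur : UCB k rad).
  { apply (UCB_comp k (fun q => sqrt ((q + Rabs q) / 2))); [apply continuity_sqrt_pos|].
    apply UCB_scal, UCB_minus; [apply UCB_const|now apply UCB_Qstat]. }
  assert (Uw : UCB k w).
  { apply UCB_minus; apply (UCB_comp k (cdf p)); try (now apply cdf_continuous).
    - apply UCB_plus; auto. apply UCB_mean.
    - apply UCB_minus; auto. apply UCB_mean. }
  exists (expect k w). apply iter_expect_snoc with w; [|now apply expect_spec].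
  intros l [Hl Hl1]. simpl.
  exists (fun t => if Rle_dec (Qstat (l ++ t :: nil)) x then 1 else 0).
  split; [auto|]. apply improper_0_1_iff.
  assert (J1 := cdf_int p (fun t => if Rle_dec t (mean l + rad l) then 1 else 0) (mean l + rad l) hp
    ltac:(intros; cbv beta; destruct Rle_dec; lra) ltac:(intros; cbv beta; destruct Rle_dec; lra)).
  (* Subtracting a strict indicator at the left end yields the indicator of the closed interval
     exactly, with no exceptional point. *)
  assert (J2 := cdf_int p (fun t => if Rlt_dec t (mean l - rad l) then 1 else 0) (mean l - rad l) hp
    ltac:(intros; cbv beta; destruct Rlt_dec; lra) ltac:(intros; cbv beta; destruct Rlt_dec; lra)).
  assert (J3 := cdf_int p (fun t => if Rle_dec t (mean l - rad l) then 1 else 0) (mean l - rad l) hp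
    ltac:(intros; cbv beta; destruct Rle_dec; lra) ltac:(intros; cbv beta; destruct Rle_dec; lra)).
  assert (EQ : forall t, Qstat (l ++ t :: nil) = Qstat l + INR k / (INR k + 1) * (t - mean l) ^ 2).
  { intros t. rewrite Qstat_snoc by lia. unfold mean. now rewrite Hl. }
  assert (Hc : 0 < (INR k + 1) / INR k) by (apply Rdiv_lt_0_compat; lra).
  destruct (Rle_lt_dec (Qstat l) x) as [C|C].
  - assert (Hr0 : 0 <= rad l) by apply sqrt_pos.
    assert (Hr : rad l ^ 2 = (INR k + 1) / INR k * (x - Qstat l)).
    { assert (0 <= (INR k + 1) / INR k * (x - Qstat l)) by (apply Rmult_le_pos; lra).
      unfold rad. rewrite (Rabs_right) by lra. rewrite pow2_sqrt; lra. }
    unfold w. replace (cdf p (mean l + rad l) - cdf p (mean l - rad l)) with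
      (1 * cdf p (mean l + rad l) + -1 * cdf p (mean l - rad l)) by ring.
    apply (int0_ext _ _ upper_end_1) with (2 := int0_lin _ _ upper_end_1 1 (-1) _ _ _ _ J1 J2).
    intros t _. rewrite EQ.
    assert (Ex : x = Qstat l + INR k / (INR k + 1) * rad l ^ 2).
    { rewrite Hr. field. lra. }
    assert (Hc' : 0 < INR k / (INR k + 1)) by (apply Rdiv_lt_0_compat; lra).
    destruct (Rle_dec (Qstat l + INR k / (INR k + 1) * (t - mean l) ^ 2) x) as [D|D];
    destruct (Rle_dec t (mean l + rad l)) as [D1|D1]; destruct (Rlt_dec t (mean l - rad l)) as [D2|D2];
    try ring; exfalso.
    + assert ((t - mean l) ^ 2 <= rad l ^ 2) by nra. nra.
    + lra.
    + assert ((t - mean l) ^ 2 <= rad l ^ 2) by nra. nra.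
    + apply D. rewrite Ex. apply Rplus_le_compat_l. apply Rmult_le_compat_l; [lra|]. nra.
    + lra.
  (* The interval is empty and the two terms of [w] cancel. [J3] only supplies a convergent integral
     to be multiplied by 0. *)
  - assert (Hr : rad l = 0).
    { unfold rad. rewrite Rabs_left1.
      - match goal with |- sqrt ?a = 0 => replace a with 0 by (field; lra); apply sqrt_0 end.
      - nra. }
    unfold w. rewrite Hr, Rplus_0_r, Rminus_0_r. rewrite Hr, Rminus_0_r in J3.
    replace (cdf p (mean l) - cdf p (mean l)) with (0 * cdf p (mean l)) by ring.
    apply (int0_ext _ _ upper_end_1) with (2 := int0_scal _ _ upper_end_1 0 _ _ J3).
    intros t _. rewrite EQ. destruct (Rle_dec (Qstat l + INR k / (INR k + 1) * (t - mean l) ^ 2) x) as [D|D]; [|ring]. exfalso.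
    assert (0 < INR k / (INR k + 1)) by (apply Rdiv_lt_0_compat; lra).
    generalize (pow2_ge_0 (t - mean l)). intros. nra.
Qed.

Lemma F_Q_spec n x : (2 <= n)%nat ->
  iter_expect p n (fun l => if Rle_dec (Qstat l) x then 1 else 0) (F_Q p n x).
Proof. intros Hn. unfold F_Q. apply epsilon_spec. now apply Qind_exists. Qed.

End Law.

(** * The functions h and their truncations *)

Lemma RInt_Chasles_R (f : R -> R) a b c : ex_RInt (V := R_NormedModule) f a b ->
  ex_RInt (V := R_NormedModule) f b c -> RInt f a b + RInt f b c = RInt f a c.
Proof. intros H1 H2. exact (RInt_Chasles (V := R_CompleteNormedModule) f a b c H1 H2). Qed.

Lemma RInt_scal_R (f : R -> R) a b k : ex_RInt (V := R_NormedModule) f a b ->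
  RInt (fun x => k * f x) a b = k * RInt f a b.
Proof. intros H. exact (RInt_scal (V := R_CompleteNormedModule) f a b k H). Qed.

Lemma Rpower_mult_l x y q : 0 < x -> 0 < y -> Rpower (x * y) q = Rpower x q * Rpower y q.
Proof. intros. symmetry. now apply Rpower_mult_distr. Qed.

Lemma Rpower_neg_le x y q : q <= 0 -> 0 < x -> x <= y -> Rpower y q <= Rpower x q.
Proof.
  intros Hq Hx Hxy. replace q with (- (- q)) by ring. rewrite !(Rpower_Ropp _ (- q)).
  apply Rinv_le_contravar; [apply exp_pos|]. apply Rle_Rpower_l; lra.
Qed.

Lemma RInt_shift (f : R -> R) z a b : (forall x : R, continuous f x) ->
  RInt (fun x => f (x - z)) a b = RInt f (a - z) (b - z).
Proof.
  intros H. assert (E := RInt_comp_lin (V := R_CompleteNormedModule) f 1 (- z) a b).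
  replace (1 * a + - z) with (a - z) in E by ring.
  replace (1 * b + - z) with (b - z) in E by ring.
  rewrite <- E by (apply (ex_RInt_continuous (V := R_CompleteNormedModule)); intros; apply H).
  apply RInt_ext. intros x _. change (f (x - z) = 1 * f (1 * x + - z)).
  rewrite !Rmult_1_l. reflexivity.
Qed.

Section Kernel.
Context (p : R) (hp : 0 < p < 1).

Definition ker z x := gs (x - z) * Rpower x (p - 1).

Lemma ker_pos z x : 0 < ker z x.
Proof. apply Rmult_lt_0_compat; [apply gs_pos|apply exp_pos]. Qed.

Lemma gs_shift_continuous z (x : R) : continuous (fun x => gs (x - z)) x.
Proof.
  apply (continuous_comp (fun x => x - z) gs).
  - apply (continuous_minus (V := R_NormedModule) (fun x => x) (fun _ => z));
    [apply continuous_id|apply continuous_const].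
  - apply gs_continuous.
Qed.

Lemma ker_continuous z x : 0 < x -> continuous (ker z) x.
Proof.
  intros H. apply (continuous_mult (K := R_AbsRing) (fun x => gs (x - z)) (fun x => Rpower x (p - 1))).
  - apply gs_shift_continuous.
  - now apply Rpower_continuous.
Qed.

Lemma pos_ex_RInt (f : R -> R) a b : (forall x, 0 < x -> continuous f x) -> 0 < a -> a <= b ->
  ex_RInt (V := R_NormedModule) f a b.
Proof.
  intros H Ha Hab. apply (ex_RInt_continuous (V := R_CompleteNormedModule)).
  intros x. rewrite Rmin_left, Rmax_right by lra. intros Hx. apply H. lra.
Qed.

Lemma ker_ex z a b : 0 < a -> a <= b -> ex_RInt (V := R_NormedModule) (ker z) a b.
Proof. apply pos_ex_RInt, ker_continuous. Qed.

Lemma pow_ex a b : 0 < a -> a <= b ->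
  ex_RInt (V := R_NormedModule) (fun x => Rpower x (p - 1)) a b.
Proof. apply pos_ex_RInt. intros; now apply Rpower_continuous. Qed.

Lemma pow_RInt a b : 0 < a -> a <= b ->
  p * RInt (fun x => Rpower x (p - 1)) a b = Rpower b p - Rpower a p.
Proof.
  intros Ha Hab. rewrite <- RInt_scal_R by now apply pow_ex.
  apply is_RInt_unique. apply weight_RInt; lra.
Qed.

Lemma ker_le_pow z M a b : 0 < a -> a <= b -> (forall x, a < x < b -> gs (x - z) <= M) ->
  p * RInt (ker z) a b <= M * (Rpower b p - Rpower a p).
Proof.
  intros Ha Hab H. rewrite <- (pow_RInt a b) by auto.
  replace (M * (p * RInt (fun x => Rpower x (p - 1)) a b)) with
    (p * (M * RInt (fun x => Rpower x (p - 1)) a b)) by ring.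
  rewrite <- (RInt_scal_R (fun x => Rpower x (p - 1)) a b M) by now apply pow_ex.
  apply Rmult_le_compat_l; [lra|]. apply RInt_le; auto.
  - now apply ker_ex.
  - apply (ex_RInt_scal (V := R_NormedModule)). now apply pow_ex.
  - intros x Hx. apply Rmult_le_compat_r; [apply Rlt_le, exp_pos|now apply H].
Qed.

Lemma gs_shift_RInt z a b : RInt (fun x => gs (x - z)) a b = gam (b - z) - gam (a - z).
Proof. rewrite RInt_shift by apply gs_continuous. apply gam_RInt. Qed.

Lemma gs_shift_ex z a b : ex_RInt (V := R_NormedModule) (fun x => gs (x - z)) a b.
Proof.
  apply (ex_RInt_continuous (V := R_CompleteNormedModule)). intros; apply gs_shift_continuous.
Qed.

Lemma ker_le_gs z c a b : 0 < c -> c <= a -> a <= b ->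
  RInt (ker z) a b <= Rpower c (p - 1) * (gam (b - z) - gam (a - z)).
Proof.
  intros Hc Ha Hab. rewrite <- gs_shift_RInt, <- RInt_scal_R by apply gs_shift_ex.
  apply RInt_le; auto.
  - apply ker_ex; lra.
  - apply (ex_RInt_scal (V := R_NormedModule)), gs_shift_ex.
  - intros x Hx. unfold ker. rewrite Rmult_comm.
    apply Rmult_le_compat_r; [apply Rlt_le, gs_pos|]. apply Rpower_neg_le; lra.
Qed.

Lemma ker_ge_gs z c a b : 0 < a -> a <= b -> b <= c ->
  Rpower c (p - 1) * (gam (b - z) - gam (a - z)) <= RInt (ker z) a b.
Proof.
  intros Hc Ha Hab. rewrite <- gs_shift_RInt, <- RInt_scal_R by apply gs_shift_ex.
  apply RInt_le; auto.
  - apply (ex_RInt_scal (V := R_NormedModule)), gs_shift_ex.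
  - apply ker_ex; lra.
  - intros x Hx. unfold ker. rewrite Rmult_comm.
    apply Rmult_le_compat_l; [apply Rlt_le, gs_pos|]. apply Rpower_neg_le; lra.
Qed.

Lemma gam_diff_le a b : gam a - gam b <= sqrt PI.
Proof. generalize (gam_le_lim a) (gam_le_lim (- b)). rewrite gam_odd. lra. Qed.

Lemma ker_tail z c a b : 0 < c -> c <= a -> a <= b ->
  p * RInt (ker z) a b <= p * sqrt PI * Rpower c (p - 1).
Proof.
  intros Hc Ha Hab. rewrite Rmult_assoc. apply Rmult_le_compat_l; [lra|].
  apply Rle_trans with (1 := ker_le_gs z c a b Hc Ha Hab). rewrite Rmult_comm.
  apply Rmult_le_compat_r; [apply Rlt_le, exp_pos|apply gam_diff_le].
Qed.

(** The two sides of the cut need different estimates: near 0 the weight is unbounded but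
    integrable, while beyond [c] it is at most [c^(p-1)] and the Gaussian has mass at most
    [sqrt PI]. The cut is later placed at 1, at [T] and at a fraction of [z]. *)
Lemma ker_split z c A B : 0 < c -> 0 <= A -> 0 <= B ->
  (forall a b, 0 < a -> a <= b -> b <= c -> p * RInt (ker z) a b <= A) ->
  (forall a b, c <= a -> a <= b -> p * RInt (ker z) a b <= B) ->
  forall a b, 0 < a -> a <= b -> p * RInt (ker z) a b <= A + B.
Proof.
  intros Hc HA HB H1 H2 a b Ha Hab.
  destruct (Rle_lt_dec b c) as [C|C]; [generalize (H1 a b Ha Hab C); lra|].
  destruct (Rle_lt_dec c a) as [D|D]; [generalize (H2 a b D Hab); lra|].
  rewrite <- (RInt_Chasles_R (ker z) a c b) by (apply ker_ex; lra).
  generalize (H1 a c Ha ltac:(lra) ltac:(lra)) (H2 c b ltac:(lra) ltac:(lra)). lra.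
Qed.

Lemma ker_bound z a b : 0 < a -> a <= b -> p * RInt (ker z) a b <= 1 + p * sqrt PI.
Proof.
  apply (ker_split z 1); try lra.
  - apply Rmult_le_pos; [lra|]. apply Rlt_le, sqrtPI_pos.
  - intros x y Hx Hxy Hy.
    apply Rle_trans with (1 * (Rpower y p - Rpower x p)).
    + apply ker_le_pow; auto. intros; apply gs_le_1.
    + assert (0 < Rpower x p) by apply exp_pos.
      assert (Rpower y p <= 1) by (rewrite <- (Rpower_1_l p); apply Rle_Rpower_l; lra). lra.
  - intros x y Hx Hxy. rewrite <- (Rmult_1_r (p * sqrt PI)), <- (Rpower_1_l (p - 1)).
    apply ker_tail; lra.
Qed.

Lemma ker_nice Rng z : nice Rng (ker z).
Proof. intros x Hx _. split; [now apply ker_continuous|apply Rlt_le, ker_pos]. Qed.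

(** One function on the whole line suffices, since [h_plus] is its reflection. *)
Definition h z := h_minus p z.

Lemma h_spec z : exists I, h z = p * I /\ int0 (Rbar_locally p_infty) (ker z) I.
Proof.
  exists (int_0_inf (ker z)). split; [reflexivity|]. apply improper_0_inf_iff.
  unfold int_0_inf. apply epsilon_spec.
  destruct (int0_exists _ _ upper_end_inf (fun _ _ _ h => h) (ker z) ((1 + p * sqrt PI) / p)
    (ker_nice _ z)) as (v & Hv).
  - intros a b Ha Hab _. apply (Rmult_le_reg_l p); [lra|].
    replace (p * ((1 + p * sqrt PI) / p)) with (1 + p * sqrt PI) by (field; lra).
    now apply ker_bound.
  - exists v. now apply improper_0_inf_iff.
Qed.

Lemma h_plus_eq y : h_plus p y = h (- y).
Proof.
  unfold h_plus, h, h_minus. f_equal. f_equal. apply FunctionalExtensionality.functional_extensionality.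
  intros x. now replace (x - - y) with (x + y) by ring.
Qed.

Lemma h_ge z a b : 0 < a -> a <= b -> p * RInt (ker z) a b <= h z.
Proof.
  intros Ha Hab. destruct (h_spec z) as (I & -> & HI). apply Rmult_le_compat_l; [lra|].
  apply (int0_ge _ _ upper_end_inf (fun _ _ _ h => h) _ _ _ _ (ker_nice _ z) HI); auto.
Qed.

Lemma h_le z M : (forall a b, 0 < a -> a <= b -> p * RInt (ker z) a b <= M) -> h z <= M.
Proof.
  intros H. destruct (h_spec z) as (I & -> & HI).
  apply Rle_trans with (p * (M / p)); [|right; field; lra].
  apply Rmult_le_compat_l; [lra|].
  apply (int0_upper _ _ upper_end_inf _ _ _ HI). intros a b Ha Hab _.
  apply Rle_div_r; [lra|]. rewrite Rmult_comm. now apply H.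
Qed.

(** The expectation of [exp (- (T X - z)^2)] for a single variable [X], that is, the factor
    contributed by each coordinate at [z = T y]. *)
Definition uT T z :=
  epsilon (inhabits 0) (int0 (at_point 1) (fun t => p * Rpower t (p - 1) * gs (T * t - z))).

(** The substitution [x = T t] turns the weight and the differential into a factor [T^(-p)], which
    this normalisation cancels. *)
Definition hT T z := Rpower T p * uT T z.

Lemma uT_nice Rng T z : nice Rng (fun t => p * Rpower t (p - 1) * gs (T * t - z)).
Proof.
  intros x Hx _. split.
  - apply (continuous_mult (K := R_AbsRing) (fun t => p * Rpower t (p - 1)) (fun t => gs (T * t - z))).
    + apply (continuous_scal_r (V := R_NormedModule) p). now apply Rpower_continuous.
    + apply (continuous_comp (fun t => T * t - z) gs); [|apply gs_continuous].
      apply (ex_derive_continuous (K := R_AbsRing) (V := R_NormedModule)). auto_derive. trivial.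
  - apply Rmult_le_pos; [|apply Rlt_le, gs_pos].
    apply Rmult_le_pos; [lra|apply Rlt_le, exp_pos].
Qed.

Lemma uT_RInt T z a b : 0 < T -> 0 < a -> a <= b ->
  Rpower T p * RInt (fun t => p * Rpower t (p - 1) * gs (T * t - z)) a b =
  p * RInt (ker z) (T * a) (T * b).
Proof.
  intros HT Ha Hab.
  assert (E := RInt_comp_lin (V := R_CompleteNormedModule) (ker z) T 0 a b).
  rewrite !Rplus_0_r in E.
  rewrite <- E by (apply ker_ex; nra).
  change (Rpower T p * RInt (fun t => p * Rpower t (p - 1) * gs (T * t - z)) a b =
    p * RInt (fun t => T * ker z (T * t + 0)) a b).
  assert (X : ex_RInt (V := R_NormedModule) (fun t => p * Rpower t (p - 1) * gs (T * t - z)) a b).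
  { apply pos_ex_RInt; auto. intros x Hx. apply (uT_nice (fun _ => True) T z x Hx I). }
  rewrite <- RInt_scal_R by exact X.
  rewrite <- RInt_scal_R.
  - apply RInt_ext. rewrite Rmin_left, Rmax_right by lra. intros t Ht.
    unfold ker. rewrite Rplus_0_r. rewrite Rpower_mult_l by lra.
    assert (EP : Rpower T p = T * Rpower T (p - 1)).
    { rewrite <- (Rpower_1 T) at 2 by lra. rewrite <- Rpower_plus. f_equal. ring. }
    rewrite EP. match goal with |- ?a = ?b => change (@eq R a b) end. ring.
  - apply (ex_RInt_comp_lin (V := R_NormedModule)). rewrite !Rplus_0_r. apply ker_ex; nra.
Qed.

Lemma uT_spec T z : 0 < T ->
  int0 (at_point 1) (fun t => p * Rpower t (p - 1) * gs (T * t - z)) (uT T z).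
Proof.
  intros HT. unfold uT. apply epsilon_spec.
  apply (int0_exists _ _ upper_end_1 ltac:(intros; lra) _ ((1 + p * sqrt PI) / Rpower T p)).
  - apply uT_nice.
  - intros a b Ha Hab _. apply Rle_div_r; [apply exp_pos|]. rewrite Rmult_comm, uT_RInt by auto.
    apply ker_bound; nra.
Qed.

Lemma hT_ge T z a b : 0 < a -> a <= b -> b <= T -> p * RInt (ker z) a b <= hT T z.
Proof.
  intros Ha Hab Hb. assert (HT : 0 < T) by lra.
  replace a with (T * (a / T)) by (field; lra). replace b with (T * (b / T)) by (field; lra).
  assert (0 < / T) by now apply Rinv_0_lt_compat.
  assert (0 < a / T) by (apply Rdiv_lt_0_compat; lra).
  assert (a / T <= b / T) by (apply Rmult_le_compat_r; lra).
  rewrite <- uT_RInt by auto.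
  apply Rmult_le_compat_l; [apply Rlt_le, exp_pos|].
  apply (int0_ge _ _ upper_end_1 ltac:(intros; lra) _ _ _ _ (uT_nice _ T z) (uT_spec T z HT)); auto.
  apply Rle_div_l; lra.
Qed.

Lemma hT_le T z M : 0 < T ->
  (forall a b, 0 < a -> a <= b -> b <= T -> p * RInt (ker z) a b <= M) -> hT T z <= M.
Proof.
  intros HT H. unfold hT.
  assert (P : 0 < Rpower T p) by apply exp_pos.
  apply Rle_trans with (Rpower T p * (M / Rpower T p)); [|right; field; lra].
  apply Rmult_le_compat_l; [lra|].
  apply (int0_upper _ _ upper_end_1 _ _ _ (uT_spec T z HT)). intros a b Ha Hab Hb.
  apply Rle_div_r; [lra|]. rewrite Rmult_comm, uT_RInt by auto. apply H; nra.
Qed.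

Lemma h_nonneg z : 0 <= h z.
Proof.
  apply Rle_trans with (2 := h_ge z 1 1 ltac:(lra) ltac:(lra)).
  rewrite RInt_point. change (0 <= p * 0). lra.
Qed.

Lemma hT_nonneg T z : 0 < T -> 0 <= hT T z.
Proof.
  intros HT. apply Rle_trans with (2 := hT_ge T z T T HT ltac:(lra) ltac:(lra)).
  rewrite RInt_point. change (0 <= p * 0). lra.
Qed.

Lemma hT_le_h T z : 0 < T -> hT T z <= h z.
Proof. intros HT. apply hT_le; auto. intros. now apply h_ge. Qed.

(** The part of the integral cut off at [T] is bounded uniformly in [z], and the bound tends to 0
    because [p < 1]. Together with [hT_le_h] this is uniform convergence of [hT] to [h]. *)
Lemma h_le_hT T z : 0 < T -> h z <= hT T z + p * sqrt PI * Rpower T (p - 1).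
Proof.
  intros HT. apply h_le. apply (ker_split z T); auto.
  - now apply hT_nonneg.
  - apply Rmult_le_pos; [|apply Rlt_le, exp_pos]. apply Rmult_le_pos; [lra|].
    apply Rlt_le, sqrtPI_pos.
  - intros. now apply hT_ge.
  - intros. now apply ker_tail.
Qed.

Lemma h_bound z : h z <= 1 + p * sqrt PI.
Proof. apply h_le. intros. now apply ker_bound. Qed.

(** [gs] is 1-Lipschitz and the weight has mass [T^p] on the interval from 0 to [T]. *)
Lemma hT_lip T z z' : 0 < T -> hT T z <= hT T z' + Rpower T p * Rabs (z - z').
Proof.
  intros HT. apply hT_le; auto. intros a b Ha Hab Hb.
  apply Rle_trans with (p * RInt (ker z') a b + Rabs (z - z') * (Rpower b p - Rpower a p)).
  - rewrite <- pow_RInt by auto.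
    replace (Rabs (z - z') * (p * RInt (fun x => Rpower x (p - 1)) a b)) with
      (p * (Rabs (z - z') * RInt (fun x => Rpower x (p - 1)) a b)) by ring.
    rewrite <- Rmult_plus_distr_l. apply Rmult_le_compat_l; [lra|].
    rewrite <- (RInt_scal_R (fun x => Rpower x (p - 1))) by now apply pow_ex.
    assert (E1 := ker_ex z' a b Ha Hab).
    assert (E2 : ex_RInt (V := R_NormedModule) (fun x => Rabs (z - z') * Rpower x (p - 1)) a b).
    { apply (ex_RInt_scal (V := R_NormedModule)). now apply pow_ex. }
    assert (E := RInt_plus (V := R_CompleteNormedModule) _ _ a b E1 E2).
    unfold plus in E at 2. simpl in E. rewrite <- E.
    apply RInt_le; auto; [now apply ker_ex|now apply (ex_RInt_plus (V := R_NormedModule))|].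
    intros x Hx. unfold plus, ker; simpl. rewrite <- Rmult_plus_distr_r.
    apply Rmult_le_compat_r; [apply Rlt_le, exp_pos|].
    generalize (gs_lipschitz (x - z) (x - z')).
    replace (x - z - (x - z')) with (- (z - z')) by ring. rewrite Rabs_Ropp. intros L.
    apply Rabs_le_between in L. lra.
  - apply Rplus_le_compat; [now apply hT_ge|]. rewrite Rmult_comm.
    apply Rmult_le_compat_r; [apply Rabs_pos|].
    assert (0 < Rpower a p) by apply exp_pos.
    assert (Rpower b p <= Rpower T p) by (apply Rle_Rpower_l; lra). lra.
Qed.

Lemma hT_continuous T (z : R) : 0 < T -> continuous (hT T) z.
Proof.
  intros HT. apply (proj1 (continuity_pt_filterlim (hT T) z)). intros eps He.
  assert (P : 0 < Rpower T p) by apply exp_pos.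
  exists (eps / Rpower T p). split; [now apply Rdiv_lt_0_compat|].
  intros x [_ Hx]. simpl in *. unfold R_dist in *.
  apply Rlt_div_r in Hx; [|lra].
  assert (H1 := hT_lip T x z HT). assert (H2 := hT_lip T z x HT).
  rewrite (Rabs_minus_sym z x) in H2. apply Rabs_def1; nra.
Qed.

Lemma tail_small eps : 0 < eps ->
  exists T0, 0 < T0 /\ forall T, T0 <= T -> p * sqrt PI * Rpower T (p - 1) < eps.
Proof.
  intros He. assert (HS := sqrtPI_pos).
  assert (HA : 0 < p * sqrt PI) by (apply Rmult_lt_0_compat; lra).
  assert (HB : 0 < eps / (2 * (p * sqrt PI))) by (apply Rdiv_lt_0_compat; lra).
  (* The solution [T] of [p * sqrt PI * T^(p-1) = eps / 2]. *)
  exists (Rpower (eps / (2 * (p * sqrt PI))) (/ (p - 1))). split; [apply exp_pos|].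
  intros T HT. apply Rle_lt_trans with (p * sqrt PI * (eps / (2 * (p * sqrt PI)))).
  - apply Rmult_le_compat_l; [lra|].
    apply Rle_trans with (Rpower (Rpower (eps / (2 * (p * sqrt PI))) (/ (p - 1))) (p - 1)).
    + apply Rpower_neg_le; [lra|apply exp_pos|exact HT].
    + rewrite Rpower_mult, Rinv_l, Rpower_1 by lra. lra.
  - replace (p * sqrt PI * (eps / (2 * (p * sqrt PI)))) with (eps / 2) by (field; lra). lra.
Qed.

(** A uniform limit of the Lipschitz functions [hT T]. Their constants [T^p] blow up, so [T] is
    fixed before the increment is chosen. *)
Lemma h_continuous (z : R) : continuous h z.
Proof.
  apply (proj1 (continuity_pt_filterlim h z)). intros eps He.
  destruct (tail_small (eps / 2)) as (T & HT & Hs); [lra|]. specialize (Hs T (Rle_refl _)).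
  assert (P : 0 < Rpower T p) by apply exp_pos.
  exists (eps / 2 / Rpower T p). split; [apply Rdiv_lt_0_compat; lra|].
  intros x [_ Hx]. simpl in *. unfold R_dist in *.
  apply Rlt_div_r in Hx; [|lra].
  assert (H1 := hT_lip T x z HT). assert (H2 := hT_lip T z x HT).
  rewrite (Rabs_minus_sym z x) in H2.
  generalize (hT_le_h T x HT) (hT_le_h T z HT) (h_le_hT T x HT) (h_le_hT T z HT). intros.
  apply Rabs_def1; nra.
Qed.

(** For nonnegative [w] and [x], [(x + w)^2 >= x^2 + w^2]. This gives [h] Gaussian decay on the
    negative axis, so only the positive axis matters for the asymptotics. *)
Lemma ker_neg w x : 0 <= w -> 0 < x -> ker (- w) x <= gs w * ker 0 x.
Proof.
  intros Hw Hx. unfold ker. rewrite <- Rmult_assoc.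
  apply Rmult_le_compat_r; [apply Rlt_le, exp_pos|].
  unfold gs. rewrite <- exp_plus. apply exp_le_mono. nra.
Qed.

Lemma h_neg w : 0 <= w -> h (- w) <= gs w * h 0.
Proof.
  intros Hw. apply h_le. intros a b Ha Hab.
  apply Rle_trans with (gs w * (p * RInt (ker 0) a b)).
  - replace (gs w * (p * RInt (ker 0) a b)) with (p * (gs w * RInt (ker 0) a b)) by ring.
    apply Rmult_le_compat_l; [lra|].
    rewrite <- (RInt_scal_R _ a b (gs w)) by now apply ker_ex.
    apply RInt_le; auto; [now apply ker_ex|apply (ex_RInt_scal (V := R_NormedModule)); now apply ker_ex|].
    intros x Hx. apply ker_neg; lra.
  - apply Rmult_le_compat_l; [apply Rlt_le, gs_pos|]. now apply h_ge.
Qed.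

(** The integral stops at [T], and for [x <= T] one has [(x - T - w)^2 >= (x - T)^2 + w^2]. Hence
    [hT T] decays like a Gaussian past [T]. *)
Lemma hT_beyond T w : 0 < T -> 0 <= w -> hT T (T + w) <= gs w * h T.
Proof.
  intros HT Hw. apply hT_le; auto. intros a b Ha Hab Hb.
  apply Rle_trans with (gs w * (p * RInt (ker T) a b)).
  - replace (gs w * (p * RInt (ker T) a b)) with (p * (gs w * RInt (ker T) a b)) by ring.
    apply Rmult_le_compat_l; [lra|].
    rewrite <- (RInt_scal_R _ a b (gs w)) by now apply ker_ex.
    apply RInt_le; auto; [now apply ker_ex|apply (ex_RInt_scal (V := R_NormedModule)); now apply ker_ex|].
    intros x Hx. unfold ker. rewrite <- Rmult_assoc.
    apply Rmult_le_compat_r; [apply Rlt_le, exp_pos|].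
    unfold gs. rewrite <- exp_plus. apply exp_le_mono. nra.
  - apply Rmult_le_compat_l; [apply Rlt_le, gs_pos|]. now apply h_ge.
Qed.

(** The integral is cut at [th * z] with [th < 1]. Beyond the cut the weight is at most
    [(th z)^(p-1)], a factor [1 + e / 2] above [z^(p-1)]; before it the Gaussian is at most
    [gs ((1 - th) z)], which is negligible. *)
Lemma h_upper e : 0 < e -> exists Z, 0 < Z /\ forall z, Z <= z ->
  h z <= (1 + e) * (p * sqrt PI) * Rpower z (p - 1).
Proof.
  intros He. assert (HS := sqrtPI_pos).
  assert (HA : 0 < p * sqrt PI) by (apply Rmult_lt_0_compat; lra).
  pose (th := Rpower (1 + e / 2) (/ (p - 1))).
  assert (Hth : 0 < th < 1).
  { split; [apply exp_pos|]. rewrite <- (Rpower_O (1 + e / 2)) by lra. apply Rpower_lt; [lra|].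
    apply Rinv_lt_0_compat. lra. }
  assert (Eth : Rpower th (p - 1) = 1 + e / 2).
  { unfold th. rewrite Rpower_mult, Rinv_l, Rpower_1; lra. }
  pose (et := 1 - th). assert (Het : 0 < et ^ 2) by (apply pow_lt; unfold et; lra).
  (* Beyond this threshold [z * gs (et z) <= p * sqrt PI * e / 2], by [gs y <= 1 / (1 + y^2)]. Since
     [z^p = z * z^(p-1)], this is the other half of the allowance [e]. *)
  exists (Rmax 1 (/ (et ^ 2 * (p * sqrt PI * (e / 2))))).
  split; [generalize (Rmax_l 1 (/ (et ^ 2 * (p * sqrt PI * (e / 2))))); lra|].
  intros z Hz.
  assert (1 <= z) by (generalize (Rmax_l 1 (/ (et ^ 2 * (p * sqrt PI * (e / 2))))); lra).
  assert (Hz2 : / (et ^ 2 * (p * sqrt PI * (e / 2))) <= z)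
    by (generalize (Rmax_r 1 (/ (et ^ 2 * (p * sqrt PI * (e / 2))))); lra).
  assert (PD : 0 < et ^ 2 * (p * sqrt PI * (e / 2))).
  { apply Rmult_lt_0_compat; [lra|]. apply Rmult_lt_0_compat; lra. }
  assert (Hz3 : 1 <= z * (et ^ 2 * (p * sqrt PI * (e / 2)))).
  { apply Rmult_le_compat_r with (r := et ^ 2 * (p * sqrt PI * (e / 2))) in Hz2; [|lra].
    rewrite Rinv_l in Hz2; lra. }
  assert (Pz : 0 < Rpower z (p - 1)) by apply exp_pos.
  assert (B : z * gs (et * z) <= p * sqrt PI * (e / 2)).
  { assert (G : gs (et * z) * (1 + (et * z) ^ 2) <= 1).
    { assert (E : gs (et * z) * exp ((et * z) ^ 2) = 1).
      { unfold gs. rewrite <- exp_plus. replace (- (et * z) ^ 2 + (et * z) ^ 2) with 0 by ring. apply exp_0. }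
      apply Rle_trans with (gs (et * z) * exp ((et * z) ^ 2)); [|lra].
      apply Rmult_le_compat_l; [apply Rlt_le, gs_pos|apply exp_ineq1_le]. }
    assert (Gp := gs_pos (et * z)).
    apply (Rmult_le_reg_r (et ^ 2 * z)); [nra|].
    apply Rle_trans with 1; nra. }
  apply Rle_trans with (gs (et * z) * Rpower z p + p * sqrt PI * Rpower (th * z) (p - 1)).
  - assert (C : 0 < th * z) by nra.
    apply h_le. apply (ker_split z (th * z)); auto.
    + apply Rmult_le_pos; apply Rlt_le; [apply gs_pos|apply exp_pos].
    + apply Rmult_le_pos; [lra|apply Rlt_le, exp_pos].
    + intros a b Ha Hab Hb.
      apply Rle_trans with (gs (et * z) * (Rpower b p - Rpower a p)).
      * apply ker_le_pow; auto. intros x Hx.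
        replace (gs (x - z)) with (gs (z - x)) by (unfold gs; f_equal; ring).
        apply gs_decr. unfold et. nra.
      * apply Rmult_le_compat_l; [apply Rlt_le, gs_pos|].
        assert (0 < Rpower a p) by apply exp_pos.
        assert (Rpower b p <= Rpower z p) by (apply Rle_Rpower_l; nra). lra.
    + intros a b Ha Hab. now apply ker_tail.
  - rewrite Rpower_mult_l, Eth by lra.
    assert (EP : Rpower z p = z * Rpower z (p - 1)).
    { rewrite <- (Rpower_1 z) at 2 by lra. rewrite <- Rpower_plus. f_equal. ring. }
    rewrite EP. nra.
Qed.

(** The window of radius [K] around [z] carries nearly all the Gaussian mass, and the weight hardly
    varies on it once [z] is large compared with [K]. The condition [z + K <= T] keeps the window
    clear of the truncation. *)
Lemma hT_lower e : 0 < e < 1 -> exists K Z, 0 < K /\ 0 < Z /\ forall z T, Z <= z -> z + K <= T ->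
  (1 - e) * (p * sqrt PI) * Rpower z (p - 1) <= hT T z.
Proof.
  intros He. assert (HS := sqrtPI_pos).
  destruct (proj2 (is_lim_spec _ _ _) gam_lim (mkposreal (e / 4 * sqrt PI) ltac:(nra))) as [M HM].
  simpl in HM. pose (K := Rmax 1 (M + 1)).
  assert (HK : 1 <= K) by apply Rmax_l.
  assert (GK : (1 - e / 2) * sqrt PI <= 2 * gam K).
  { specialize (HM K). generalize (Rmax_r 1 (M + 1)). fold K. intros.
    specialize (HM ltac:(lra)). apply Rabs_def2 in HM. lra. }
  (* This choice gives [K / z <= e / 2]. Both the mass and the weight then lose a factor
     [1 - e / 2], and [(1 - e / 2)^2 >= 1 - e]. *)
  exists K, (2 * K / e). split; [lra|]. split; [apply Rdiv_lt_0_compat; lra|].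
  intros z T Hz HT. apply Rle_div_l in Hz; [|lra].
  assert (z > K) by nra.
  apply Rle_trans with (p * RInt (ker z) (z - K) (z + K)); [|apply hT_ge; lra].
  rewrite (Rmult_comm (1 - e)), !Rmult_assoc. apply Rmult_le_compat_l; [lra|].
  apply Rle_trans with (2 := ker_ge_gs z (z + K) (z - K) (z + K) ltac:(lra) ltac:(lra) ltac:(lra)).
  replace (z + K - z) with K by ring. replace (z - K - z) with (- K) by ring. rewrite gam_odd.
  assert (R1 : (1 - e / 2) * Rpower z (p - 1) <= Rpower (z + K) (p - 1)).
  { replace (z + K) with (z * (1 + K / z)) by (field; lra).
    assert (0 < K / z) by (apply Rdiv_lt_0_compat; lra).
    rewrite Rpower_mult_l by lra. rewrite Rmult_comm.
    apply Rmult_le_compat_l; [apply Rlt_le, exp_pos|].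
    apply Rle_trans with (Rpower (1 + K / z) (Ropp 1)).
    - rewrite Rpower_Ropp, Rpower_1 by lra.
      apply (Rmult_le_reg_r (1 + K / z)); [lra|]. rewrite Rinv_l by lra.
      assert (K / z <= e / 2) by (apply Rle_div_l; [lra|]; nra). nra.
    - apply Rle_Rpower; lra. }
  assert (Pz : 0 < Rpower z (p - 1)) by apply exp_pos.
  apply Rle_trans with ((1 - e / 2) * Rpower z (p - 1) * ((1 - e / 2) * sqrt PI)).
  - assert (0 < sqrt PI * Rpower z (p - 1)) by (apply Rmult_lt_0_compat; lra). nra.
  - apply Rmult_le_compat; try nra.
Qed.

End Kernel.

(** * The Laplace transform of Q *)

(** An explicit error bound passes through an expectation by monotonicity, unlike a limit of
    difference quotients. *)
Lemma is_derive_quadratic (f : R -> R) (x df C : R) :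
  (forall h, Rabs (f (x + h) - f x - h * df) <= C * h ^ 2) -> is_derive f x df.
Proof.
  intros H. apply is_derive_Reals. intros eps He.
  assert (HC : 0 <= C).
  { specialize (H 1). generalize (Rabs_pos (f (x + 1) - f x - 1 * df)). lra. }
  assert (D : 0 < eps / (C + 1)) by (apply Rdiv_lt_0_compat; lra).
  exists (mkposreal _ D). intros h Hh Hd. simpl in Hd. apply Rlt_div_r in Hd; [|lra].
  replace ((f (x + h) - f x) / h - df) with ((f (x + h) - f x - h * df) / h) by (field; auto).
  unfold Rdiv. rewrite Rabs_mult, Rabs_inv.
  assert (0 < Rabs h) by now apply Rabs_pos_lt.
  apply Rlt_div_l; [lra|].
  apply Rle_lt_trans with (1 := H h). rewrite <- pow2_abs. nra.
Qed.

(** Links the theorem's shape, two functions on a half-line, with the Gaussian identity, one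
    function on a symmetric interval. *)
Lemma RInt_fold (f : R -> R) B : (forall x : R, continuous f x) ->
  RInt (fun z => f z + f (- z)) 0 B = RInt f (- B) B.
Proof.
  intros Hf.
  assert (expectQ : forall a b, ex_RInt (V := R_NormedModule) f a b).
  { intros. apply (ex_RInt_continuous (V := R_CompleteNormedModule)). intros; apply Hf. }
  assert (Hf' : forall x : R, continuous (fun z => f (- z)) x).
  { intros x. apply (continuous_comp (fun z => - z) f); [|apply Hf].
    apply (continuous_opp (V := R_NormedModule)), continuous_id. }
  assert (Ex' : forall a b, ex_RInt (V := R_NormedModule) (fun z => f (- z)) a b).
  { intros. apply (ex_RInt_continuous (V := R_CompleteNormedModule)). intros; apply Hf'. }
  assert (E := RInt_plus (V := R_CompleteNormedModule) _ _ 0 B (expectQ 0 B) (Ex' 0 B)).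
  change (RInt (fun z => f z + f (- z)) 0 B = RInt f 0 B + RInt (fun z => f (- z)) 0 B) in E.
  rewrite E.
  assert (E2 := RInt_comp_lin (V := R_CompleteNormedModule) f (-1) 0 0 B (expectQ _ _)).
  replace (-1 * 0 + 0) with 0 in E2 by ring. replace (-1 * B + 0) with (- B) in E2 by ring.
  rewrite (RInt_ext _ (fun z => -1 * f (- z))) in E2.
  2:{ intros x _. change (-1 * f (-1 * x + 0) = -1 * f (- x)). do 2 f_equal. ring. }
  rewrite RInt_scal_R in E2 by apply Ex'.
  assert (E3 := RInt_Chasles_R f (- B) 0 B (expectQ _ _) (expectQ _ _)).
  assert (E4 := opp_RInt_swap (V := R_CompleteNormedModule) f (- B) 0 (expectQ _ _)).
  change (- RInt f (- B) 0 = RInt f 0 (- B)) in E4. lra.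
Qed.

Section Laplace.
Context (p : R) (hp : 0 < p < 1) (n : nat) (hn : (n <> 0)%nat).
Let hp0 : 0 < p := proj1 hp.

Definition expectQ phi := expect p n (fun l => phi (Qstat l)).
Definition laplaceQ s := expectQ (fun q => exp (- (s * q))).

Lemma UCB_phi phi : continuity phi -> UCB n (fun l => phi (Qstat l)).
Proof. intros H. apply UCB_comp; auto. now apply UCB_Qstat. Qed.

Lemma continuity_derivable (f : R -> R) : (forall x : R, ex_derive f x) -> continuity f.
Proof.
  intros H x. apply continuity_pt_filterlim.
  apply (ex_derive_continuous (K := R_AbsRing) (V := R_NormedModule)). apply H.
Qed.

Lemma continuity_expn s : continuity (fun q => exp (- (s * q))).
Proof. apply continuity_derivable. intros x. auto_derive. trivial. Qed.

Definition sqrt_n := sqrt (INR n).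

Lemma INR_n_pos : 0 < INR n.
Proof. apply lt_0_INR. lia. Qed.

Lemma sqrt_n_sq : sqrt_n ^ 2 = INR n.
Proof. unfold sqrt_n. apply pow2_sqrt, Rlt_le, INR_n_pos. Qed.

Lemma sqrt_n_pos : 0 < sqrt_n.
Proof. apply sqrt_lt_R0, INR_n_pos. Qed.

(** Up to the factor [sqrt_n], a primitive in [z] of [uT T z ^ n], with the [z]-integration already
    performed inside the expectation. It takes the place of Fubini's theorem. *)
Definition Phi T z :=
  expect p n (fun l => exp (- (T ^ 2 * Qstat l)) * gam (sqrt_n * (z - T * mean l))).

Lemma gam_continuity : continuity gam.
Proof. apply continuity_derivable. intros x. eexists. apply gam_derive. Qed.

Lemma UCB_affine a b : UCB n (fun l => sqrt_n * (a - b * mean l)).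
Proof.
  apply UCB_scal, UCB_minus; [apply UCB_const|]. apply UCB_scal, UCB_mean.
Qed.

Lemma UCB_laplace T : UCB n (fun l => exp (- (T ^ 2 * Qstat l))).
Proof. apply (UCB_phi (fun q => exp (- (T ^ 2 * q)))), continuity_expn. Qed.

Lemma UCB_Phi T z :
  UCB n (fun l => exp (- (T ^ 2 * Qstat l)) * gam (sqrt_n * (z - T * mean l))).
Proof.
  apply UCB_mult; [apply UCB_laplace|].
  apply (UCB_comp n gam); [apply gam_continuity|apply UCB_affine].
Qed.

Lemma gs_continuity : continuity gs.
Proof. intros x. apply continuity_pt_filterlim, gs_continuous. Qed.

Lemma UCB_phi' T z :
  UCB n (fun l => exp (- (T ^ 2 * Qstat l)) * gs (sqrt_n * (z - T * mean l))).
Proof.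
  apply UCB_mult; [apply UCB_laplace|].
  apply (UCB_comp n gs); [apply gs_continuity|apply UCB_affine].
Qed.

Lemma gauss_product T z l : 0 < T -> cube n l ->
  fold_right (fun t acc => gs (T * t - z) * acc) 1 l =
  exp (- (T ^ 2 * Qstat l)) * gs (sqrt_n * (z - T * mean l)).
Proof.
  intros HT [Hl _].
  transitivity (exp (- (T ^ 2 * fold_right (fun xi acc => (xi - z / T) ^ 2 + acc) 0 l))).
  - clear - HT. induction l as [|t l IH]; cbn [fold_right].
    + rewrite Rmult_0_r, Ropp_0. now rewrite exp_0.
    + rewrite IH. unfold gs. rewrite <- exp_plus. f_equal.
      field. lra.
  - rewrite Qstat_shift by lia. unfold gs. rewrite <- exp_plus. f_equal.
    rewrite Rpow_mult_distr, sqrt_n_sq. unfold mean. rewrite Hl.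
    assert (P := INR_n_pos). field. split; lra.
Qed.

Lemma expect_product T z : 0 < T ->
  expect p n (fun l => exp (- (T ^ 2 * Qstat l)) * gs (sqrt_n * (z - T * mean l))) = uT p T z ^ n.
Proof.
  intros HT. apply expect_unique; auto.
  apply iter_expect_ext with (fun l => fold_right (fun t acc => gs (T * t - z) * acc) 1 l).
  - intros l Hl. now apply gauss_product.
  - apply (iter_expect_prod p (fun t => gs (T * t - z))). now apply uT_spec.
Qed.

(* The exchange of [d/dz] and the expectation is justified by the second order
   bound [gam_quad], which is uniform in [l]. *)
Lemma Phi_derive T (z : R) : 0 < T -> is_derive (Phi T) z (sqrt_n * uT p T z ^ n).
Proof.
  intros HT. apply is_derive_quadratic with (INR n). intros e.
  rewrite <- expect_product by auto. unfold Phi.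
  pose (F := fun z l => exp (- (T ^ 2 * Qstat l)) * gam (sqrt_n * (z - T * mean l))).
  pose (G := fun l => exp (- (T ^ 2 * Qstat l)) * gs (sqrt_n * (z - T * mean l))).
  change (Rabs (expect p n (F (z + e)) - expect p n (F z) - e * (sqrt_n * expect p n G)) <= INR n * e ^ 2).
  assert (U1 : UCB n (F (z + e))) by apply UCB_Phi.
  assert (U2 : UCB n (F z)) by apply UCB_Phi.
  assert (U3 : UCB n G) by apply UCB_phi'.
  assert (U4 : UCB n (fun l => 1 * F z l + (e * sqrt_n) * G l)).
  { apply UCB_plus; now apply UCB_scal. }
  replace (expect p n (F (z + e)) - expect p n (F z) - e * (sqrt_n * expect p n G)) with
    (1 * expect p n (F (z + e)) + -1 * (1 * expect p n (F z) + (e * sqrt_n) * expect p n G)) by ring.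
  rewrite <- (expect_lin p hp0 n 1 (e * sqrt_n)) by auto.
  rewrite <- (expect_lin p hp0 n 1 (-1) (F (z + e))) by auto.
  assert (K : forall l, Rabs (1 * F (z + e) l + -1 * (1 * F z l + e * sqrt_n * G l)) <= INR n * e ^ 2).
  { intros l. unfold F, G.
    assert (Q := gam_quad (sqrt_n * (z - T * mean l)) (sqrt_n * e)).
    replace (sqrt_n * (z - T * mean l) + sqrt_n * e) with (sqrt_n * (z + e - T * mean l)) in Q by ring.
    rewrite Rpow_mult_distr, sqrt_n_sq in Q.
    match goal with |- Rabs ?a <= _ => replace a with (exp (- (T ^ 2 * Qstat l)) *
      (gam (sqrt_n * (z + e - T * mean l)) - gam (sqrt_n * (z - T * mean l)) -
       sqrt_n * e * gs (sqrt_n * (z - T * mean l)))) by ring end.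
    rewrite Rabs_mult, Rabs_right by apply Rle_ge, Rlt_le, exp_pos.
    assert (exp (- (T ^ 2 * Qstat l)) <= 1).
    { rewrite <- exp_0. apply exp_le_mono. generalize (Qstat_nonneg l). nra. }
    assert (0 < exp (- (T ^ 2 * Qstat l))) by apply exp_pos.
    match goal with |- _ * ?a <= _ => assert (0 <= a) by apply Rabs_pos end. nra. }
  assert (U5 : UCB n (fun l => 1 * F (z + e) l + -1 * (1 * F z l + e * sqrt_n * G l))).
  { apply UCB_plus; now apply UCB_scal. }
  apply Rabs_le. split.
  - rewrite <- (expect_const p hp0 n (- (INR n * e ^ 2))). apply expect_le; auto; [apply UCB_const|].
    intros l _. specialize (K l). apply Rabs_le_between in K. lra.
  - rewrite <- (expect_const p hp0 n (INR n * e ^ 2)). apply expect_le; auto; [apply UCB_const|].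
    intros l _. specialize (K l). apply Rabs_le_between in K. lra.
Qed.

Lemma hT_pow_continuous T (z : R) : 0 < T -> continuous (fun z => hT p T z ^ n) z.
Proof.
  intros HT. apply (continuous_comp (hT p T) (fun y => y ^ n)); [now apply hT_continuous|].
  apply (ex_derive_continuous (K := R_AbsRing) (V := R_NormedModule)). auto_derive. trivial.
Qed.

Lemma Rpower_pow_n T : Rpower T p ^ n = Rpower T (INR n * p).
Proof.
  rewrite <- Rpower_pow by apply exp_pos. rewrite Rpower_mult. f_equal. ring.
Qed.

Lemma Phi_RInt T a b : 0 < T ->
  RInt (fun z => hT p T z ^ n) a b = Rpower T (INR n * p) / sqrt_n * (Phi T b - Phi T a).
Proof.
  intros HT. assert (R0 := sqrt_n_pos). apply is_RInt_unique.
  assert (E : Rpower T (INR n * p) / sqrt_n * (Phi T b - Phi T a) =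
    Rpower T (INR n * p) / sqrt_n * Phi T b + - (Rpower T (INR n * p) / sqrt_n * Phi T a)) by ring.
  rewrite E.
  apply (is_RInt_derive (V := R_CompleteNormedModule) (fun z => Rpower T (INR n * p) / sqrt_n * Phi T z)).
  - intros x _. evar_last.
    + apply (is_derive_scal (Phi T)). now apply Phi_derive.
    + unfold hT. rewrite Rpow_mult_distr, Rpower_pow_n.
      match goal with |- ?a = ?b => change (@eq R a b) end. field. lra.
  - intros x _. now apply hT_pow_continuous.
Qed.

(** The integral of [hT T z ^ n] over the whole line, in the closed form given by the Gaussian
    identity. [Jint_ge] and [Jint_le] characterise it as the supremum of the truncations [Jtrunc],
    which is all that is used of it later. *)
Definition Jint T := sqrt (PI / INR n) * Rpower T (INR n * p) * laplaceQ (T ^ 2).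

Definition Jtrunc T B : R := RInt (fun z => hT p T z ^ n + hT p T (- z) ^ n) 0 B.

Lemma Jtrunc_eq T B : 0 < T -> Jtrunc T B = Rpower T (INR n * p) / sqrt_n *
  expect p n (fun l => 1 * (exp (- (T ^ 2 * Qstat l)) * gam (sqrt_n * (B - T * mean l))) +
    -1 * (exp (- (T ^ 2 * Qstat l)) * gam (sqrt_n * (- B - T * mean l)))).
Proof.
  intros HT. unfold Jtrunc. rewrite (RInt_fold (fun z => hT p T z ^ n)).
  - match goal with |- ?x = ?y => change (@eq R x y) end.
    rewrite Phi_RInt by auto. rewrite (expect_lin p hp0) by apply UCB_Phi. unfold Phi. ring.
  - intros x. now apply hT_pow_continuous.
Qed.

Lemma UCB_Jtrunc T B : UCB n (fun l => 1 * (exp (- (T ^ 2 * Qstat l)) * gam (sqrt_n * (B - T * mean l))) +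
    -1 * (exp (- (T ^ 2 * Qstat l)) * gam (sqrt_n * (- B - T * mean l)))).
Proof. apply UCB_plus; apply UCB_scal, UCB_Phi. Qed.

Lemma expect_scal_laplaceQ T c : expect p n (fun l => c * exp (- (T ^ 2 * Qstat l))) = c * laplaceQ (T ^ 2).
Proof.
  transitivity (expect p n (fun l => c * exp (- (T ^ 2 * Qstat l)) + 0 * exp (- (T ^ 2 * Qstat l)))).
  - apply expect_ext; auto; [apply UCB_scal, UCB_laplace|]. intros; ring.
  - rewrite (expect_lin p hp0) by apply UCB_laplace. unfold laplaceQ, expectQ. ring.
Qed.

Lemma Jint_alt T : Jint T = Rpower T (INR n * p) / sqrt_n * (sqrt PI * laplaceQ (T ^ 2)).
Proof.
  unfold Jint, sqrt_n. rewrite sqrt_div_alt by apply INR_n_pos. field.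
  generalize sqrt_n_pos. unfold sqrt_n. lra.
Qed.

Lemma Jint_ge T B : 0 < T -> Jtrunc T B <= Jint T.
Proof.
  intros HT. rewrite Jtrunc_eq, Jint_alt by auto.
  apply Rmult_le_compat_l.
  { apply Rlt_le, Rdiv_lt_0_compat; [apply exp_pos|apply sqrt_n_pos]. }
  rewrite <- expect_scal_laplaceQ. apply expect_le; auto.
  - apply UCB_Jtrunc.
  - apply UCB_scal, UCB_laplace.
  - intros l _. generalize (gam_diff_le (sqrt_n * (B - T * mean l)) (sqrt_n * (- B - T * mean l))).
    assert (0 < exp (- (T ^ 2 * Qstat l))) by apply exp_pos. nra.
Qed.

Lemma Jint_le T M : 0 < T -> (forall B, 0 <= B -> Jtrunc T B <= M) -> Jint T <= M.
Proof.
  intros HT HM. rewrite Jint_alt. assert (R0 := sqrt_n_pos).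
  pose (c := Rpower T (INR n * p) / sqrt_n).
  assert (Hc : 0 < c) by (apply Rdiv_lt_0_compat; [apply exp_pos|lra]).
  (* With [B = T + x / sqrt_n] and the mean between 0 and 1, both Gaussian endpoints lie at distance
     at least [x] from 0 on opposite sides, uniformly in the sample. Letting [x] grow then recovers
     the full mass [sqrt PI]. *)
  assert (K : forall x, 0 <= x -> 2 * c * laplaceQ (T ^ 2) * gam x <= M).
  { intros x Hx. apply Rle_trans with (2 := HM (T + x / sqrt_n)
      ltac:(assert (0 <= x / sqrt_n) by (apply Rdiv_le_0_compat; lra); lra)).
    rewrite Jtrunc_eq by auto. fold c.
    replace (2 * c * laplaceQ (T ^ 2) * gam x) with (c * ((2 * gam x) * laplaceQ (T ^ 2))) by ring.
    apply Rmult_le_compat_l; [lra|]. rewrite <- expect_scal_laplaceQ. apply expect_le; auto.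
    - apply UCB_scal, UCB_laplace.
    - apply UCB_Jtrunc.
    - intros l Hl. assert (Hm := mean_cube n l hn Hl).
      assert (G1 : gam x <= gam (sqrt_n * (T + x / sqrt_n - T * mean l))).
      { apply gam_le. replace x with (sqrt_n * (x / sqrt_n)) at 1 by (field; lra).
        apply Rmult_le_compat_l; nra. }
      assert (G2 : gam x <= gam (sqrt_n * (T + x / sqrt_n + T * mean l))).
      { apply gam_le. replace x with (sqrt_n * (x / sqrt_n)) at 1 by (field; lra).
        apply Rmult_le_compat_l; nra. }
      replace (sqrt_n * (- (T + x / sqrt_n) - T * mean l)) with (- (sqrt_n * (T + x / sqrt_n + T * mean l))) by ring.
      rewrite gam_odd. assert (0 < exp (- (T ^ 2 * Qstat l))) by apply exp_pos. nra. }
  assert (Lim : is_lim (fun x => 2 * c * laplaceQ (T ^ 2) * gam x) p_infty (2 * c * laplaceQ (T ^ 2) * (sqrt PI / 2))).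
  { apply (is_lim_scal_l gam (2 * c * laplaceQ (T ^ 2)) p_infty (sqrt PI / 2)), gam_lim. }
  fold c. replace (c * (sqrt PI * laplaceQ (T ^ 2))) with (2 * c * laplaceQ (T ^ 2) * (sqrt PI / 2)) by field.
  apply (is_lim_le_loc _ (fun _ => M) p_infty _ M) with (2 := Lim) (3 := is_lim_const M p_infty).
  exists 0. intros x Hx. apply K. lra.
Qed.

End Laplace.

(** * Asymptotics of the truncated integrals *)

Lemma cont_ex (f : R -> R) a b : (forall x : R, continuous f x) -> ex_RInt (V := R_NormedModule) f a b.
Proof.
  intros H. apply (ex_RInt_continuous (V := R_CompleteNormedModule)). intros; apply H.
Qed.

Lemma RInt_plus_R (f g : R -> R) a b : ex_RInt (V := R_NormedModule) f a b ->
  ex_RInt (V := R_NormedModule) g a b ->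
  RInt (fun x => f x + g x) a b = RInt f a b + RInt g a b.
Proof. intros H1 H2. exact (RInt_plus (V := R_CompleteNormedModule) f g a b H1 H2). Qed.

Lemma RInt_const_R a b c : RInt (fun _ => c) a b = (b - a) * c.
Proof. exact (RInt_const (V := R_CompleteNormedModule) a b c). Qed.

Lemma RInt_nonneg_mono (f : R -> R) a b a' b' : (forall x : R, continuous f x) ->
  (forall x, 0 <= f x) -> a' <= a -> a <= b -> b <= b' -> RInt f a b <= RInt f a' b'.
Proof.
  intros Hc H0 H1 H2 H3.
  rewrite <- (RInt_Chasles_R f a' b b'), <- (RInt_Chasles_R f a' a b) by now apply cont_ex.
  assert (0 <= RInt f a' a) by (apply RInt_ge_0; auto; now apply cont_ex).
  assert (0 <= RInt f b b') by (apply RInt_ge_0; auto; now apply cont_ex). lra.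
Qed.

(** The crude [H ^ n], permitted by [1 <= H], keeps the induction free of predecessors. *)
Lemma pow_diff x y H n : 0 <= y -> y <= x -> x <= H -> 1 <= H ->
  x ^ n - y ^ n <= INR n * H ^ n * (x - y).
Proof.
  intros Hy Hxy Hx HH. induction n as [|n IH]; [simpl; lra|].
  rewrite S_INR. simpl.
  assert (0 <= y ^ n) by now apply pow_le.
  assert (y ^ n <= H ^ n) by (apply pow_incr; lra).
  assert (0 < H ^ n) by (apply pow_lt; lra).
  assert (P := pos_INR n).
  replace (x * x ^ n - y * y ^ n) with (x * (x ^ n - y ^ n) + (x - y) * y ^ n) by ring.
  apply Rle_trans with (H * (INR n * H ^ n * (x - y)) + (x - y) * (H * H ^ n)); [|nra].
  apply Rplus_le_compat.
  - apply Rle_trans with (x * (INR n * H ^ n * (x - y))).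
    + apply Rmult_le_compat_l; lra.
    + apply Rmult_le_compat_r; [|lra]. repeat apply Rmult_le_pos; lra.
  - apply Rmult_le_compat_l; nra.
Qed.

Lemma Rpower_lim q : 0 < q -> is_lim (fun x => Rpower x q) p_infty p_infty.
Proof.
  intros Hq. apply is_lim_spec. intros M. exists (Rpower (Rmax 1 M) (/ q)). intros x Hx.
  assert (0 < Rmax 1 M) by (generalize (Rmax_l 1 M); lra).
  apply Rle_lt_trans with (1 := Rmax_r 1 M).
  replace (Rmax 1 M) with (Rpower (Rpower (Rmax 1 M) (/ q)) q).
  - apply Rlt_Rpower_l; [lra|]. split; [apply exp_pos|exact Hx].
  - rewrite Rpower_mult, Rinv_l, Rpower_1; lra.
Qed.

Lemma pow_near_1 n e : 0 < e -> exists d, 0 < d < 1 /\ (1 + d) ^ n < 1 + e /\ 1 - e < (1 - d) ^ n.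
Proof.
  intros He.
  assert (C : continuity_pt (fun x => x ^ n) 1) by apply derivable_continuous_pt, derivable_pt_pow.
  destruct (C e He) as (d & Hd & H). exists (Rmin (d / 2) (1 / 2)).
  assert (0 < Rmin (d / 2) (1 / 2)) by (apply Rmin_glb_lt; lra).
  generalize (Rmin_l (d / 2) (1 / 2)) (Rmin_r (d / 2) (1 / 2)). intros.
  split; [lra|].
  assert (H' : forall x, x <> 1 -> Rabs (x - 1) < d -> Rabs (x ^ n - 1) < e).
  { intros x Hx1 Hx2. assert (K := H x). simpl in K. unfold R_dist, D_x, no_cond in K.
    rewrite pow1 in K. apply K. split; auto. }
  split.
  - assert (K := H' (1 + Rmin (d / 2) (1 / 2)) ltac:(lra) ltac:(apply Rabs_def1; lra)).
    apply Rabs_def2 in K. lra.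
  - assert (K := H' (1 - Rmin (d / 2) (1 / 2)) ltac:(lra) ltac:(apply Rabs_def1; lra)).
    apply Rabs_def2 in K. lra.
Qed.

Section Asymptotics.
Context (p : R) (hp : 0 < p < 1) (n : nat) (hn : (n <> 0)%nat).
Notation h := (h p). Notation hT := (hT p).

Definition hmax := 1 + p * sqrt PI.

Lemma hmax_ge_1 : 1 <= hmax.
Proof. unfold hmax. generalize sqrtPI_pos. nra. Qed.

Lemma h_range z : 0 <= h z <= hmax.
Proof. split; [now apply h_nonneg|now apply h_bound]. Qed.

Lemma h_pow_continuous (z : R) : continuous (fun z => h z ^ n) z.
Proof.
  apply (continuous_comp h (fun y => y ^ n)); [now apply h_continuous|].
  apply (ex_derive_continuous (K := R_AbsRing) (V := R_NormedModule)). auto_derive. trivial.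
Qed.

Lemma continuous_reflect (f : R -> R) : (forall x : R, continuous f x) ->
  forall x : R, continuous (fun z => f (- z)) x.
Proof.
  intros Hf x. apply (continuous_comp (fun z => - z) f); [|apply Hf].
  apply (continuous_opp (V := R_NormedModule)), continuous_id.
Qed.

Definition hsum z := h z ^ n + h (- z) ^ n.

Lemma hsum_continuous (z : R) : continuous hsum z.
Proof.
  apply (continuous_plus (V := R_NormedModule) (fun z => h z ^ n) (fun z => h (- z) ^ n)).
  - apply h_pow_continuous.
  - apply (continuous_reflect (fun z => h z ^ n)), h_pow_continuous.
Qed.

Lemma hsum_nonneg z : 0 <= hsum z.
Proof. apply Rplus_le_le_0_compat; apply pow_le, h_range. Qed.

Lemma gs_pow_le z : gs z ^ n <= gs z.
Proof.
  destruct n as [|m]; [lia|]. simpl. assert (P := gs_pos z). assert (Q := gs_le_1 z).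
  assert (PM : gs z ^ m <= 1 ^ m) by (apply pow_incr; lra). rewrite pow1 in PM. nra.
Qed.

Lemma gs_pow_bound x z : 0 <= x -> x <= gs z * hmax -> x ^ n <= hmax ^ n * gs z.
Proof.
  intros H0 H1. apply Rle_trans with ((gs z * hmax) ^ n); [apply pow_incr; lra|].
  rewrite Rpow_mult_distr, Rmult_comm. apply Rmult_le_compat_l; [|apply gs_pow_le].
  apply pow_le. generalize hmax_ge_1; lra.
Qed.

Lemma int_h_neg B : 0 <= B -> RInt (fun z => h (- z) ^ n) 0 B <= hmax ^ n * sqrt PI.
Proof.
  intros HB. apply Rle_trans with (RInt (fun z => hmax ^ n * gs z) 0 B).
  - apply RInt_le; auto.
    + apply cont_ex, (continuous_reflect (fun z => h z ^ n)), h_pow_continuous.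
    + apply (ex_RInt_scal (V := R_NormedModule)), gs_ex.
    + intros z Hz. apply gs_pow_bound; [apply h_range|].
      apply Rle_trans with (1 := h_neg p hp z ltac:(lra)).
      apply Rmult_le_compat_l; [apply Rlt_le, gs_pos|apply h_range].
  - rewrite RInt_scal_R by apply gs_ex. apply Rmult_le_compat_l; [|apply gs_RInt_le].
    apply pow_le. generalize hmax_ge_1; lra.
Qed.

Lemma int_hT_beyond T B : 0 < T -> T <= B -> RInt (fun z => hT T z ^ n) T B <= hmax ^ n * sqrt PI.
Proof.
  intros HT HB. apply Rle_trans with (RInt (fun z => hmax ^ n * gs (z - T)) T B).
  - apply RInt_le; auto.
    + apply cont_ex. intros; now apply hT_pow_continuous.
    + apply (ex_RInt_scal (V := R_NormedModule)), gs_shift_ex.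
    + intros z Hz. apply gs_pow_bound; [now apply hT_nonneg|].
      replace z with (T + (z - T)) at 1 by ring.
      apply Rle_trans with (1 := hT_beyond p hp T (z - T) HT ltac:(lra)).
      apply Rmult_le_compat_l; [apply Rlt_le, gs_pos|apply h_range].
  - rewrite RInt_scal_R by apply gs_shift_ex. rewrite gs_shift_RInt.
    apply Rmult_le_compat_l; [|apply gam_diff_le].
    apply pow_le. generalize hmax_ge_1; lra.
Qed.

(** The exponent in [h z ^ n ~ (p sqrt PI)^n z^al]. As [al + 1 = n p - (n - 1)], its sign separates
    the three cases of the theorem. *)
Definition al := INR n * (p - 1).

Lemma pow_al c z : 0 < z -> (c * Rpower z (p - 1)) ^ n = c ^ n * Rpower z al.
Proof.
  intros Hz. rewrite Rpow_mult_distr. f_equal. rewrite <- Rpower_pow by apply exp_pos.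
  rewrite Rpower_mult. unfold al. f_equal. ring.
Qed.

Lemma al_neg : al < 0.
Proof. unfold al. assert (0 < INR n) by (apply lt_0_INR; lia). nra. Qed.

(** * Growth bounds through an arbitrary primitive of [y^al], a power or a logarithm *)

Section Primitive.
Context (A : R -> R) (HA : forall y : R, 0 < y -> is_derive A y (Rpower y al)).

Lemma A_RInt a b : 0 < a -> a <= b -> RInt (fun y => Rpower y al) a b = A b - A a.
Proof.
  intros Ha Hab. apply is_RInt_unique.
  apply (is_RInt_derive (V := R_CompleteNormedModule) A).
  - intros x. rewrite Rmin_left, Rmax_right by lra. intros Hx. apply HA; lra.
  - intros x. rewrite Rmin_left, Rmax_right by lra. intros Hx. apply Rpower_continuous; lra.
Qed.

Lemma al_ex a b : 0 < a -> a <= b -> ex_RInt (V := R_NormedModule) (fun y => Rpower y al) a b.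
Proof. apply pos_ex_RInt. intros; now apply Rpower_continuous. Qed.

Lemma int_h_upper e : 0 < e -> exists Z M, 0 < Z /\ forall b, Z <= b ->
  RInt (fun z => h z ^ n) 0 b <= M + ((1 + e) * (p * sqrt PI)) ^ n * (A b - A Z).
Proof.
  intros He. destruct (h_upper p hp e He) as (Z & HZ & Hu).
  exists Z, (Z * hmax ^ n). split; auto. intros b Hb.
  rewrite <- (RInt_Chasles_R _ 0 Z b) by apply cont_ex, h_pow_continuous.
  apply Rplus_le_compat.
  - replace (Z * hmax ^ n) with ((Z - 0) * hmax ^ n) by ring. rewrite <- RInt_const_R.
    apply RInt_le; [lra|apply cont_ex, h_pow_continuous|apply (ex_RInt_const (V := R_NormedModule))|].
    intros z _. apply pow_incr, h_range.
  - rewrite <- A_RInt by auto. rewrite <- RInt_scal_R by now apply al_ex.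
    apply RInt_le; auto; [apply cont_ex, h_pow_continuous|apply (ex_RInt_scal (V := R_NormedModule)); now apply al_ex|].
    intros z Hz. rewrite <- pow_al by lra. apply pow_incr.
    split; [apply h_range|]. apply Hu. lra.
Qed.

Lemma Jtrunc_split T B : 0 < T -> Jtrunc p n T B =
  RInt (fun z => hT T z ^ n) 0 B + RInt (fun z => hT T (- z) ^ n) 0 B.
Proof.
  intros HT. apply RInt_plus_R; apply cont_ex.
  - intros; now apply hT_pow_continuous.
  - apply (continuous_reflect (fun z => hT T z ^ n)). intros; now apply hT_pow_continuous.
Qed.

Lemma hT_pow_le T z : 0 < T -> hT T z ^ n <= h z ^ n.
Proof. intros HT. apply pow_incr. split; [now apply hT_nonneg|now apply hT_le_h]. Qed.

Lemma Jtrunc_mono T B B' : 0 < T -> 0 <= B -> B <= B' -> Jtrunc p n T B <= Jtrunc p n T B'.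
Proof.
  intros HT HB HB'. apply RInt_nonneg_mono; auto; try lra.
  - intros x. apply (continuous_plus (V := R_NormedModule) (fun z => hT T z ^ n) (fun z => hT T (- z) ^ n)).
    + now apply hT_pow_continuous.
    + apply (continuous_reflect (fun z => hT T z ^ n)). intros; now apply hT_pow_continuous.
  - intros x. apply Rplus_le_le_0_compat; apply pow_le; now apply hT_nonneg.
Qed.

Lemma Jint_upper e : 0 < e -> exists Z M, 0 < Z /\ forall T, Z <= T ->
  Jint p n T <= M + ((1 + e) * (p * sqrt PI)) ^ n * A T.
Proof.
  intros He. destruct (int_h_upper e He) as (Z & M & HZ & HM).
  (* Only the range from 0 to [T] grows with [T]. The negative axis and the range beyond [T] each
     cost at most [hmax ^ n * sqrt PI], whence the factor 2. *)
  exists Z, (M - ((1 + e) * (p * sqrt PI)) ^ n * A Z + 2 * (hmax ^ n * sqrt PI)).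
  split; auto. intros T HT. apply Jint_le; auto; [lra|]. intros B HB.
  (* Enlarging [B] past [T] allows the positive half to be split at [T]. *)
  apply Rle_trans with (Jtrunc p n T (Rmax B T)).
  { apply Jtrunc_mono; try lra. apply Rmax_l. }
  assert (HR := Rmax_r B T). rewrite Jtrunc_split by lra.
  assert (C : forall x : R, continuous (fun z => hT T z ^ n) x) by (intros; apply hT_pow_continuous; auto; lra).
  rewrite <- (RInt_Chasles_R (fun z => hT T z ^ n) 0 T (Rmax B T)) by now apply cont_ex.
  assert (E1 := int_hT_beyond T (Rmax B T) ltac:(lra) HR).
  assert (E2 := int_h_neg (Rmax B T) ltac:(lra)).
  assert (E3 := HM T HT).
  assert (E4 : RInt (fun z => hT T z ^ n) 0 T <= RInt (fun z => h z ^ n) 0 T).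
  { apply RInt_le; [lra|now apply cont_ex|apply cont_ex, h_pow_continuous|].
    intros. apply hT_pow_le; lra. }
  assert (E5 : RInt (fun z => hT T (- z) ^ n) 0 (Rmax B T) <= RInt (fun z => h (- z) ^ n) 0 (Rmax B T)).
  { apply RInt_le; [lra|now apply cont_ex, (continuous_reflect (fun z => hT T z ^ n))|
      apply cont_ex, (continuous_reflect (fun z => h z ^ n)), h_pow_continuous|].
    intros. apply hT_pow_le; lra. }
  lra.
Qed.

Lemma Jint_lower e : 0 < e < 1 -> exists Z M, 0 < Z /\ forall T, Z <= T ->
  ((1 - e) * (p * sqrt PI)) ^ n * A T - M <= Jint p n T.
Proof.
  intros He. destruct (hT_lower p hp e He) as (K & Z & HK & HZ & Hl).
  pose (D := ((1 - e) * (p * sqrt PI)) ^ n).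
  assert (HD : 0 <= D).
  { apply pow_le. apply Rmult_le_pos; [lra|]. apply Rmult_le_pos; [lra|]. apply Rlt_le, sqrtPI_pos. }
  (* [hT_lower] is available only up to [T - K]. The missing piece [A T - A (T - K)] is at most
     [K * Z^al], because [y^al] decreases. *)
  exists (Z + K), (D * (A Z + K * Rpower Z al)). split; [lra|]. intros T HT. fold D.
  apply Rle_trans with (2 := Jint_ge p hp n hn T (T - K) ltac:(lra)).
  rewrite Jtrunc_split by lra.
  assert (C : forall x : R, continuous (fun z => hT T z ^ n) x) by (intros; apply hT_pow_continuous; auto; lra).
  assert (C' : forall x : R, continuous (fun z => hT T (- z) ^ n) x) by (now apply (continuous_reflect (fun z => hT T z ^ n))).
  assert (E1 : 0 <= RInt (fun z => hT T (- z) ^ n) 0 (T - K)).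
  { apply RInt_ge_0; [lra|now apply cont_ex|]. intros. apply pow_le, hT_nonneg; auto; lra. }
  assert (E2 : RInt (fun z => hT T z ^ n) Z (T - K) <= RInt (fun z => hT T z ^ n) 0 (T - K)).
  { apply RInt_nonneg_mono; auto; try lra. intros. apply pow_le, hT_nonneg; auto; lra. }
  assert (E3 : D * (A (T - K) - A Z) <= RInt (fun z => hT T z ^ n) Z (T - K)).
  { rewrite <- A_RInt by lra. rewrite <- RInt_scal_R by (apply al_ex; lra).
    apply RInt_le; [lra|apply (ex_RInt_scal (V := R_NormedModule)); apply al_ex; lra|now apply cont_ex|].
    intros z Hz. unfold D. rewrite <- pow_al by lra. apply pow_incr. split.
    - apply Rmult_le_pos; [|apply Rlt_le, exp_pos]. apply Rmult_le_pos; [lra|].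
      apply Rmult_le_pos; [lra|]. apply Rlt_le, sqrtPI_pos.
    - apply Hl; lra. }
  assert (E4 : A T - A (T - K) <= K * Rpower Z al).
  { rewrite <- A_RInt by lra. replace (K * Rpower Z al) with ((T - (T - K)) * Rpower Z al) by ring.
    rewrite <- RInt_const_R.
    apply RInt_le; [lra|apply al_ex; lra|apply (ex_RInt_const (V := R_NormedModule))|].
    intros z Hz. apply Rpower_neg_le; [generalize al_neg; lra|lra|lra]. }
  nra.
Qed.

(** [Jint] lies between multiples of [A T] up to additive constants, and these vanish after division
    because [A] diverges. *)
Lemma Jint_lim_primitive : is_lim A p_infty p_infty ->
  is_lim (fun T => Jint p n T / A T) p_infty ((p * sqrt PI) ^ n).
Proof.
  intros HL. apply is_lim_spec. intros eps. simpl.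
  pose (c := (p * sqrt PI) ^ n).
  assert (Hc : 0 < c) by (apply pow_lt, Rmult_lt_0_compat; [lra|apply sqrtPI_pos]).
  assert (He := cond_pos eps).
  (* Half of [eps] pays for the factors [(1 + d)^n] and [(1 - d)^n] multiplying [c], the other half
     for the additive constants. *)
  destruct (pow_near_1 n (eps / 2 / c)) as (d & Hd & D1 & D2).
  { repeat apply Rdiv_lt_0_compat; lra. }
  destruct (Jint_upper d (proj1 Hd)) as (Z1 & M1 & HZ1 & HM1).
  destruct (Jint_lower d Hd) as (Z2 & M2 & HZ2 & HM2).
  pose (M := Rmax (Rabs M1) (Rabs M2)).
  assert (M1 <= M) by (apply Rle_trans with (1 := Rle_abs M1), Rmax_l).
  assert (M2 <= M) by (apply Rle_trans with (1 := Rle_abs M2), Rmax_r).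
  destruct (proj2 (is_lim_spec _ _ _) HL (Rmax 1 (M / (eps / 2)))) as [X HX].
  exists (Rmax X (Rmax Z1 Z2)). intros T HT.
  assert (X < T /\ Z1 < T /\ Z2 < T) as (T1 & T2 & T3).
  { generalize (Rmax_l X (Rmax Z1 Z2)) (Rmax_r X (Rmax Z1 Z2)) (Rmax_l Z1 Z2) (Rmax_r Z1 Z2).
    repeat split; lra. }
  specialize (HX T T1). specialize (HM1 T ltac:(lra)). specialize (HM2 T ltac:(lra)).
  assert (HA0 : 0 < A T) by (generalize (Rmax_l 1 (M / (eps / 2))); lra).
  assert (HA1 : M < eps / 2 * A T).
  { assert (MA : M / (eps / 2) < A T) by (generalize (Rmax_r 1 (M / (eps / 2))); lra).
    apply Rlt_div_l in MA; lra. }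
  rewrite Rpow_mult_distr in HM1, HM2. fold c in HM1, HM2.
  assert (Q1 : (1 + d) ^ n * c < c + eps / 2).
  { apply Rmult_lt_compat_r with (r := c) in D1; auto.
    replace ((1 + eps / 2 / c) * c) with (c + eps / 2) in D1 by (field; lra). lra. }
  assert (Q2 : c - eps / 2 < (1 - d) ^ n * c).
  { apply Rmult_lt_compat_r with (r := c) in D2; auto.
    replace ((1 - eps / 2 / c) * c) with (c - eps / 2) in D2 by (field; lra). lra. }
  fold c. apply Rabs_def1.
  - apply Rlt_minus_l. apply Rlt_div_l; auto. nra.
  - assert (c - eps < Jint p n T / A T); [|lra]. apply Rlt_div_r; auto. nra.
Qed.

End Primitive.

Definition Apow y := Rpower y (al + 1) / (al + 1).

Lemma Apow_derive : al + 1 <> 0 -> forall y : R, 0 < y -> is_derive Apow y (Rpower y al).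
Proof.
  intros Ha y Hy.
  apply (is_derive_ext (fun y => / (al + 1) * Rpower y (al + 1))).
  { intros t. unfold Apow, Rdiv. apply Rmult_comm. }
  evar_last.
  - apply (is_derive_scal (fun y => Rpower y (al + 1))). now apply Rpower_derive.
  - replace (al + 1 - 1) with al by ring. 
    match goal with |- ?a = ?b => change (@eq R a b) end. field. auto.
Qed.

Lemma Jint_lim_above : 0 < al + 1 ->
  is_lim (fun T => Jint p n T / Rpower T (al + 1)) p_infty ((p * sqrt PI) ^ n / (al + 1)).
Proof.
  intros Ha.
  assert (L1 : is_lim Apow p_infty p_infty).
  { replace p_infty with (Rbar_mult (/ (al + 1)) p_infty) at 2.
    - apply (is_lim_ext (fun y => / (al + 1) * Rpower y (al + 1))).
      + intros y. unfold Apow, Rdiv. ring.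
      + apply is_lim_scal_l. now apply Rpower_lim.
    - assert (P : 0 < / (al + 1)) by now apply Rinv_0_lt_compat.
      simpl. destruct (Rle_dec 0 (/ (al + 1))); [|lra].
      destruct (Rle_lt_or_eq_dec 0 (/ (al + 1)) r); [reflexivity|lra]. }
  apply is_lim_ext with (fun T => / (al + 1) * (Jint p n T / Apow T)).
  - intros T. unfold Apow. assert (0 < Rpower T (al + 1)) by apply exp_pos. field. lra.
  - replace ((p * sqrt PI) ^ n / (al + 1)) with (/ (al + 1) * (p * sqrt PI) ^ n) by (unfold Rdiv; ring).
    apply (is_lim_scal_l _ (/ (al + 1)) p_infty ((p * sqrt PI) ^ n)).
    apply Jint_lim_primitive; auto. apply Apow_derive. lra.
Qed.

Lemma Jint_lim_equal : al + 1 = 0 ->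
  is_lim (fun T => Jint p n T / ln T) p_infty ((p * sqrt PI) ^ n).
Proof.
  intros Ha. apply Jint_lim_primitive.
  - intros y Hy. replace al with (Ropp 1) by lra. rewrite Rpower_Ropp, Rpower_1 by auto.
    apply is_derive_Reals. now apply derivable_pt_lim_ln.
  - apply is_lim_ln_p.
Qed.

(** * The case where the integral of [h^n] converges *)

Section Below.
Hypothesis Ha : al + 1 < 0.

(** With [al + 1 < 0] the primitive [Apow] is negative, so its increments from [Z] are bounded by
    [- Apow Z]. *)
Lemma int_hsum_bounded : exists M, forall b, 0 <= b -> RInt hsum 0 b <= M.
Proof.
  destruct (int_h_upper Apow (Apow_derive ltac:(lra)) 1 Rlt_0_1) as (Z & M & HZ & HM).
  pose (D := ((1 + 1) * (p * sqrt PI)) ^ n).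
  assert (HD : 0 <= D).
  { apply pow_le. apply Rmult_le_pos; [lra|]. apply Rmult_le_pos; [lra|]. apply Rlt_le, sqrtPI_pos. }
  exists (M + D * - Apow Z + hmax ^ n * sqrt PI). intros b Hb.
  apply Rle_trans with (RInt hsum 0 (Rmax b Z)).
  { apply RInt_nonneg_mono; try lra; [apply hsum_continuous|apply hsum_nonneg|apply Rmax_l]. }
  assert (HR := Rmax_r b Z). unfold hsum. rewrite RInt_plus_R.
  - apply Rplus_le_compat; [|apply int_h_neg; lra].
    apply Rle_trans with (1 := HM _ HR). apply Rplus_le_compat_l, Rmult_le_compat_l; auto.
    assert (0 < Rpower (Rmax b Z) (al + 1)) by apply exp_pos.
    assert (Apow (Rmax b Z) <= 0).
    { unfold Apow, Rdiv. assert (/ (al + 1) < 0) by now apply Rinv_lt_0_compat. nra. }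
    lra.
  - apply cont_ex, h_pow_continuous.
  - apply cont_ex, (continuous_reflect (fun z => h z ^ n)), h_pow_continuous.
Qed.

Lemma hsum_eq : (fun y => h_minus p y ^ n + h_plus p y ^ n) = hsum.
Proof.
  apply FunctionalExtensionality.functional_extensionality. intros y.
  now rewrite h_plus_eq.
Qed.

Definition hsum_int := int_0_inf (fun y => h_minus p y ^ n + h_plus p y ^ n).

Lemma hsum_nice Rng : nice Rng hsum.
Proof. intros x _ _. split; [apply hsum_continuous|apply hsum_nonneg]. Qed.

Lemma hsum_int_spec : int0 (Rbar_locally p_infty) hsum hsum_int.
Proof.
  apply improper_0_inf_iff. unfold hsum_int, int_0_inf. rewrite hsum_eq. apply epsilon_spec.
  destruct int_hsum_bounded as (M & HM).
  destruct (int0_exists _ _ upper_end_inf (fun _ _ _ h => h) hsum M (hsum_nice _)) as (v & Hv).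
  - intros a b Ha' Hab _. apply Rle_trans with (2 := HM b ltac:(lra)).
    apply RInt_nonneg_mono; try lra; [apply hsum_continuous|apply hsum_nonneg].
  - exists v. now apply improper_0_inf_iff.
Qed.

Lemma hsum_int_ge a b : 0 < a -> a <= b -> RInt hsum a b <= hsum_int.
Proof.
  intros H1 H2. apply (int0_ge _ _ upper_end_inf (fun _ _ _ h => h) _ _ _ _ (hsum_nice _) hsum_int_spec); auto.
Qed.

Lemma hsum_pos z : 0 < hsum z.
Proof.
  assert (0 < h z).
  { apply Rlt_le_trans with (2 := h_ge p hp z 1 2 ltac:(lra) ltac:(lra)).
    apply Rmult_lt_0_compat; [lra|]. apply RInt_gt_0; [lra| |].
    - intros; now apply ker_pos.
    - intros; apply ker_continuous; lra. }
  unfold hsum. assert (0 < h z ^ n) by now apply pow_lt.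
  assert (0 <= h (- z) ^ n) by apply pow_le, h_range. lra.
Qed.

(** Positivity of the constant is required both by the Tauberian theorem and for the final quotient
    to make sense. *)
Lemma hsum_int_pos : 0 < hsum_int.
Proof.
  apply Rlt_le_trans with (2 := hsum_int_ge 1 2 ltac:(lra) ltac:(lra)).
  apply RInt_gt_0; [lra| |].
  - intros; apply hsum_pos.
  - intros; apply hsum_continuous.
Qed.

Lemma hsum_le z : hsum z <= 2 * hmax ^ n.
Proof.
  unfold hsum. assert (h z ^ n <= hmax ^ n) by apply pow_incr, h_range.
  assert (h (- z) ^ n <= hmax ^ n) by apply pow_incr, h_range. lra.
Qed.

(** The improper integral sees only positive lower ends. As [hsum] is bounded, the piece near 0 is
    arbitrarily small. *)
Lemma hsum_int_ge_0 b : 0 < b -> RInt hsum 0 b <= hsum_int.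
Proof.
  intros Hb. apply le_epsilon. intros e He.
  assert (HP : 0 < 2 * hmax ^ n).
  { assert (0 < hmax ^ n) by (apply pow_lt; generalize hmax_ge_1; lra). lra. }
  pose (a := Rmin b (e / (2 * hmax ^ n))).
  assert (Ha0 : 0 < a) by (apply Rmin_glb_lt; [lra|now apply Rdiv_lt_0_compat]).
  assert (Hab : a <= b) by apply Rmin_l.
  assert (Hae : a * (2 * hmax ^ n) <= e) by (apply Rle_div_r; [lra|apply Rmin_r]).
  rewrite <- (RInt_Chasles_R hsum 0 a b) by apply cont_ex, hsum_continuous.
  assert (RInt hsum 0 a <= (a - 0) * (2 * hmax ^ n)).
  { rewrite <- RInt_const_R. apply RInt_le; [lra|apply cont_ex, hsum_continuous|
      apply (ex_RInt_const (V := R_NormedModule))|]. intros; apply hsum_le. }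
  generalize (hsum_int_ge a b Ha0 Hab). lra.
Qed.

(** From above, [hT <= h]. From below, a fixed interval carries all but [eps / 2] of the integral,
    and on it the convergence of [hT^n] to [h^n] is uniform. *)
Lemma Jint_lim_below : is_lim (Jint p n) p_infty hsum_int.
Proof.
  apply is_lim_spec. intros eps. assert (He := cond_pos eps). simpl.
  assert (exists a b, 0 < a /\ a <= b /\ hsum_int - eps / 2 < RInt hsum a b) as (a & b & Ha' & Hab & HV).
  { apply NNPP. intros C. apply (Rlt_not_le hsum_int (hsum_int - eps / 2)); [lra|].
    apply (int0_upper _ _ upper_end_inf _ _ _ hsum_int_spec). intros a b Ha' Hab _.
    apply Rnot_lt_le. intros D. apply C. now exists a, b. }
  (* Lipschitz constant of the power times the length, doubled for the two terms of [hsum]; the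
     added 1 keeps [c] positive when [a = b]. *)
  pose (c := 2 * (INR n * hmax ^ n) * (b - a) + 1).
  assert (HP : 0 < INR n * hmax ^ n).
  { apply Rmult_lt_0_compat; [apply lt_0_INR; lia|]. apply pow_lt; generalize hmax_ge_1; lra. }
  assert (Hc : 0 < c) by (unfold c; nra).
  destruct (tail_small p hp (eps / 2 / c)) as (T0 & HT0 & Ht).
  { apply Rdiv_lt_0_compat; lra. }
  exists T0. intros T HT. specialize (Ht T ltac:(lra)).
  pose (tau := p * sqrt PI * Rpower T (p - 1)). fold tau in Ht.
  assert (Htau : 0 <= tau).
  { apply Rmult_le_pos; [|apply Rlt_le, exp_pos]. apply Rmult_le_pos; [lra|]. apply Rlt_le, sqrtPI_pos. }
  apply Rlt_div_r in Ht; [|lra].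
  assert (Up : Jint p n T <= hsum_int).
  { apply Jint_le; auto; [lra|]. intros B HB.
    apply Rle_trans with (RInt hsum 0 B).
    - apply RInt_le; auto.
      + apply cont_ex. intros x. apply (continuous_plus (V := R_NormedModule) (fun z => hT T z ^ n) (fun z => hT T (- z) ^ n)).
        * apply hT_pow_continuous; auto; lra.
        * apply (continuous_reflect (fun z => hT T z ^ n)). intros; apply hT_pow_continuous; auto; lra.
      + apply cont_ex, hsum_continuous.
      + intros z _. apply Rplus_le_compat; apply hT_pow_le; lra.
    - apply Rle_trans with (RInt hsum 0 (B + 1)); [|apply hsum_int_ge_0; lra].
      apply RInt_nonneg_mono; try lra; [apply hsum_continuous|apply hsum_nonneg]. }
  assert (K : forall z, h z ^ n - hT T z ^ n <= INR n * hmax ^ n * tau).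
  { intros z. apply Rle_trans with (INR n * hmax ^ n * (h z - hT T z)).
    - apply pow_diff; [apply hT_nonneg; auto; lra|apply hT_le_h; auto; lra|apply h_range|apply hmax_ge_1].
    - apply Rmult_le_compat_l; [lra|]. generalize (h_le_hT p hp T z ltac:(lra)). fold tau. lra. }
  assert (Cf : forall x : R, continuous (fun z => hT T z ^ n + hT T (- z) ^ n) x).
  { intros x. apply (continuous_plus (V := R_NormedModule) (fun z => hT T z ^ n) (fun z => hT T (- z) ^ n)).
    - apply hT_pow_continuous; auto; lra.
    - apply (continuous_reflect (fun z => hT T z ^ n)). intros; apply hT_pow_continuous; auto; lra. }
  assert (Lo : RInt hsum a b - (b - a) * (2 * (INR n * hmax ^ n * tau)) <= Jint p n T).
  { apply Rle_trans with (2 := Jint_ge p hp n hn T b ltac:(lra)).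
    apply Rle_trans with (RInt (fun z => hT T z ^ n + hT T (- z) ^ n) a b).
    - rewrite <- RInt_const_R.
      assert (LE : RInt hsum a b <= RInt (fun z => (hT T z ^ n + hT T (- z) ^ n) + 2 * (INR n * hmax ^ n * tau)) a b).
      { apply RInt_le; auto.
        - apply cont_ex, hsum_continuous.
        - apply (ex_RInt_plus (V := R_NormedModule) (fun z => hT T z ^ n + hT T (- z) ^ n)); [now apply cont_ex|apply (ex_RInt_const (V := R_NormedModule))].
        - intros z _. unfold hsum. generalize (K z) (K (- z)). lra. }
      rewrite RInt_plus_R in LE; [lra|now apply cont_ex|apply (ex_RInt_const (V := R_NormedModule))].
    - apply RInt_nonneg_mono; auto; try lra.
      intros z. apply Rplus_le_le_0_compat; apply pow_le, hT_nonneg; auto; lra. }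
  unfold c in Ht. apply Rabs_def1; nra.
Qed.

End Below.
End Asymptotics.

(** * The Gamma integral *)

Lemma lim_mult f g (a b : R) : is_lim f p_infty a -> is_lim g p_infty b ->
  is_lim (fun s => f s * g s) p_infty (a * b).
Proof. intros H1 H2. now apply (is_lim_mult f g p_infty a b). Qed.

Lemma lim_scal f (a k : R) : is_lim f p_infty a -> is_lim (fun s => k * f s) p_infty (k * a).
Proof. intros H1. now apply (is_lim_scal_l f k p_infty a). Qed.

Lemma lim_comp f g (a : R) : continuity_pt g a -> is_lim f p_infty a ->
  is_lim (fun s => g (f s)) p_infty (g a).
Proof.
  intros Hg Hf. apply continuity_pt_filterlim in Hg.
  exact (filterlim_comp _ _ _ f g _ _ _ Hf Hg).
Qed.

Lemma lim_div f g (a b : R) : b <> 0 -> is_lim f p_infty a -> is_lim g p_infty b ->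
  is_lim (fun s => f s / g s) p_infty (a / b).
Proof.
  intros Hb H1 H2. apply lim_mult; auto.
  apply (lim_comp g Rinv); auto. apply continuity_pt_inv; auto.
  apply derivable_continuous_pt, derivable_pt_id.
Qed.

Lemma lim_scale f k (l : Rbar) : 0 < k -> is_lim f p_infty l -> is_lim (fun s => f (k * s)) p_infty l.
Proof.
  intros Hk H. apply (filterlim_comp _ _ _ (fun s => k * s) f _ (Rbar_locally p_infty)); [|exact H].
  intros P [M HM]. exists (M / k). intros x Hx. apply HM.
  apply Rlt_div_l in Hx; auto. lra.
Qed.

Lemma lim_ext_ev f g l S : (forall s, S < s -> f s = g s) -> is_lim f p_infty l -> is_lim g p_infty l.
Proof. intros H. apply is_lim_ext_loc. now exists S. Qed.

Lemma lim_lt f (l : R) M : is_lim f p_infty l -> l < M -> exists S, forall s, S < s -> f s < M.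
Proof.
  intros H HM. destruct (proj2 (is_lim_spec _ _ _) H (mkposreal (M - l) ltac:(lra))) as [S HS].
  exists S. intros s Hs. specialize (HS s Hs). simpl in HS. apply Rabs_def2 in HS. lra.
Qed.

Lemma lim_gt f (l : R) M : is_lim f p_infty l -> M < l -> exists S, forall s, S < s -> M < f s.
Proof.
  intros H HM. destruct (proj2 (is_lim_spec _ _ _) H (mkposreal (l - M) ltac:(lra))) as [S HS].
  exists S. intros s Hs. specialize (HS s Hs). simpl in HS. apply Rabs_def2 in HS. lra.
Qed.

Lemma int0_inf_scale f v j : 0 < j -> int0 (Rbar_locally p_infty) f v ->
  int0 (Rbar_locally p_infty) (fun t => f (j * t)) (v / j).
Proof.
  intros Hj H. apply (int0_spec _ _ upper_end_inf). intros eps He.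
  destruct (proj1 (int0_spec _ _ upper_end_inf f v) H (eps * j)) as (d & Hd & M & HM).
  { now apply Rmult_lt_0_compat. }
  exists (d / j). split; [now apply Rdiv_lt_0_compat|]. exists (M / j). intros b Hb a Ha.
  apply Rlt_div_l in Hb; auto. destruct Ha as [Ha0 Ha]. apply Rlt_div_r in Ha; auto.
  destruct (HM (j * b) ltac:(lra) (j * a)) as (w & Hw & Hv).
  { split; [now apply Rmult_lt_0_compat|lra]. }
  exists (/ j * w). split.
  - apply (is_RInt_ext (V := R_NormedModule) (fun t => / j * (j * f (j * t + 0)))).
    + intros x _. rewrite Rplus_0_r. match goal with |- ?a = ?b => change (@eq R a b) end. field. lra.
    + apply (is_RInt_scal (V := R_NormedModule) (fun t => j * f (j * t + 0)) a b (/ j)).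
      apply (is_RInt_comp_lin (V := R_NormedModule)). now rewrite !Rplus_0_r.
  - replace (/ j * w - v / j) with ((w - v) * / j) by (unfold Rdiv; ring).
    rewrite Rabs_mult, (Rabs_right (/ j)) by (apply Rle_ge, Rlt_le, Rinv_0_lt_compat; auto).
    apply Rlt_div_l; auto.
Qed.

Section GammaIntegral.
Context (d : R) (hd : 0 < d).

(** The inequality [ln u <= u] at [u = t / (2 d)] gives [t^d <= (2 d)^d exp (t / 2)], so half of the
    exponential decay remains. *)
Lemma gamma_dominated t : 0 < t -> Rpower t d * exp (- t) <= Rpower (2 * d) d * exp (- (t / 2)).
Proof.
  intros Ht. unfold Rpower. rewrite <- !exp_plus. apply exp_le_mono.
  assert (E : ln t = ln (t / (2 * d)) + ln (2 * d)).
  { rewrite <- ln_mult; try lra; [f_equal; field; lra|apply Rdiv_lt_0_compat; lra]. }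
  assert (P : 0 < t / (2 * d)) by (apply Rdiv_lt_0_compat; lra).
  assert (Q : ln (t / (2 * d)) <= t / (2 * d)).
  { rewrite <- (ln_exp (t / (2 * d))) at 2. apply ln_le; auto.
    generalize (exp_ineq1_le (t / (2 * d))). lra. }
  assert (Q2 : d * (t / (2 * d)) = t / 2) by (field; lra).
  rewrite E. nra.
Qed.

Lemma gamma_nice Rng : nice Rng (fun t => Rpower t d * exp (- t)).
Proof.
  intros x Hx _. split.
  - apply (continuous_mult (K := R_AbsRing) (fun t => Rpower t d) (fun t => exp (- t))).
    + now apply Rpower_continuous.
    + apply (ex_derive_continuous (K := R_AbsRing) (V := R_NormedModule)). auto_derive. trivial.
  - apply Rmult_le_pos; apply Rlt_le, exp_pos.
Qed.

Lemma Gamma_spec : int0 (Rbar_locally p_infty) (fun t => Rpower t d * exp (- t)) (Gamma (1 + d)).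
Proof.
  apply improper_0_inf_iff. unfold Gamma, int_0_inf.
  replace (1 + d - 1) with d by ring. apply epsilon_spec.
  destruct (int0_exists _ _ upper_end_inf (fun _ _ _ h => h) _ (Rpower (2 * d) d * 2) (gamma_nice _)) as (v & Hv).
  - intros a b Ha Hab _.
    assert (I : is_RInt (V := R_NormedModule) (fun t => Rpower (2 * d) d * exp (- (t / 2))) a b
      (Rpower (2 * d) d * (- 2 * exp (- (b / 2)) - - 2 * exp (- (a / 2))))).
    { apply (is_RInt_scal (V := R_NormedModule)).
      apply (is_RInt_derive (V := R_CompleteNormedModule) (fun t => - 2 * exp (- (t / 2)))).
      - intros x _. auto_derive; trivial. unfold Rdiv. field.
      - intros x _. apply (ex_derive_continuous (K := R_AbsRing) (V := R_NormedModule)).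
        auto_derive. trivial. }
    apply Rle_trans with (Rpower (2 * d) d * (- 2 * exp (- (b / 2)) - - 2 * exp (- (a / 2)))).
    + rewrite <- (is_RInt_unique _ _ _ _ I). apply RInt_le; auto.
      * now apply (nice_ex (fun _ => True) (fun _ _ _ h => h)); [apply gamma_nice| | |].
      * eexists; exact I.
      * intros x Hx. apply gamma_dominated. lra.
    + apply Rmult_le_compat_l; [apply Rlt_le, exp_pos|].
      assert (0 < exp (- (b / 2))) by apply exp_pos.
      assert (exp (- (a / 2)) <= 1) by (rewrite <- exp_0; apply exp_le_mono; lra). lra.
  - exists v. now apply improper_0_inf_iff.
Qed.

Lemma Gamma_pos : 0 < Gamma (1 + d).
Proof.
  apply Rlt_le_trans with (RInt (fun t => Rpower t d * exp (- t)) 1 2).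
  - apply RInt_gt_0; [lra| |].
    + intros. apply Rmult_lt_0_compat; apply exp_pos.
    + intros x Hx. apply (gamma_nice (fun _ => True)); auto; lra.
  - apply (int0_ge _ _ upper_end_inf (fun _ _ _ h => h) _ _ _ _ (gamma_nice _) Gamma_spec); auto; lra.
Qed.

Lemma Gamma_scaled j : 0 < j ->
  int0 (Rbar_locally p_infty) (fun t => exp (- (j * t)) * Rpower t d) (Gamma (1 + d) * Rpower j (- d) / j).
Proof.
  intros Hj. assert (Pj : 0 < Rpower j d) by apply exp_pos.
  assert (E := int0_scal _ _ upper_end_inf (Rpower j (- d)) _ _ (int0_inf_scale _ _ j Hj Gamma_spec)).
  replace (Gamma (1 + d) * Rpower j (- d) / j) with (Rpower j (- d) * (Gamma (1 + d) / j)) by (field; lra).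
  apply (int0_ext _ _ upper_end_inf) with (2 := E).
  exists 0. intros b _ x Hx. rewrite Rpower_mult_l by lra. rewrite Rpower_Ropp. field. lra.
Qed.

End GammaIntegral.

(** * A Tauberian theorem *)

(* [E phi] is the expectation of [phi Q] and [F] the distribution function of a
   nonnegative random variable [Q]. *)
Record law (E : (R -> R) -> R) (F : R -> R) : Prop := {
  law_lin : forall a b f g, continuity f -> continuity g ->
    E (fun q => a * f q + b * g q) = a * E f + b * E g;
  law_lower : forall f x, continuity f ->
    (forall q, 0 <= q -> f q <= if Rle_dec q x then 1 else 0) -> E f <= F x;
  law_upper : forall f x, continuity f ->
    (forall q, 0 <= q -> (if Rle_dec q x then 1 else 0) <= f q) -> F x <= E f }.

Lemma one_minus_exp_pow (K : nat) x : 0 <= x <= 1 -> (1 - x) ^ K <= exp (- (INR K * x)).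
Proof.
  intros Hx. apply Rle_trans with (exp (- x) ^ K).
  - apply pow_incr. split; [lra|]. generalize (exp_ineq1_le (- x)). lra.
  - rewrite <- Rpower_pow by apply exp_pos. unfold Rpower. rewrite ln_exp. apply exp_le_mono. lra.
Qed.

Lemma bernoulli (K : nat) x : 0 <= x <= 1 -> 1 - INR K * x <= (1 - x) ^ K.
Proof.
  intros Hx. induction K as [|K IH]; [simpl; lra|].
  rewrite S_INR. simpl. assert (P := pos_INR K).
  assert ((1 - x) * (1 - INR K * x) <= (1 - x) * (1 - x) ^ K) by (apply Rmult_le_compat_l; lra).
  nra.
Qed.

(** The probability that the maximum of [K] independent standard exponential variables exceeds [t].
    It is a polynomial in [exp (- t)] without constant term, so its expectation is a combination of
    values of the Laplace transform. *)
Definition GK (K : nat) (t : R) := 1 - (1 - exp (- t)) ^ K.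

(* Density of the maximum of [K] independent exponential variables. *)
Definition rho (K : nat) (t : R) := INR K * (1 - exp (- t)) ^ (pred K) * exp (- t).

Lemma exp_unit t : 0 <= t -> 0 <= exp (- t) <= 1.
Proof.
  intros Ht. split; [apply Rlt_le, exp_pos|]. rewrite <- exp_0. apply exp_le_mono. lra.
Qed.

Lemma GK_derive K (t : R) : is_derive (GK K) t (- rho K t).
Proof.
  unfold GK, rho. auto_derive; trivial. unfold Rminus. ring.
Qed.

Lemma GK_continuity K : continuity (GK K).
Proof.
  apply continuity_derivable. intros x. eexists. apply GK_derive.
Qed.

Lemma GK_bounds K t : 0 <= t -> 0 <= GK K t /\ GK K t <= 1 /\ GK K t <= INR K * exp (- t).
Proof.
  intros Ht. destruct (exp_unit t Ht) as [E0 E1]. unfold GK.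
  assert (0 <= (1 - exp (- t)) ^ K) by (apply pow_le; lra).
  assert ((1 - exp (- t)) ^ K <= 1 ^ K) by (apply pow_incr; lra). rewrite pow1 in H0.
  generalize (bernoulli K (exp (- t)) (conj E0 E1)). intros. repeat split; lra.
Qed.

Lemma GK_ge K t tau : 0 <= t -> t <= tau -> 1 - exp (- (INR K * exp (- tau))) <= GK K t.
Proof.
  intros Ht Htau. unfold GK.
  apply Rplus_le_compat_l, Ropp_le_contravar.
  apply Rle_trans with (2 := one_minus_exp_pow K (exp (- tau)) (exp_unit tau ltac:(lra))).
  apply pow_incr. destruct (exp_unit t Ht).
  assert (exp (- tau) <= exp (- t)) by (apply exp_le_mono; lra). lra.
Qed.

Lemma rho_continuous K (t : R) : continuous (rho K) t.
Proof.
  apply (ex_derive_continuous (K := R_AbsRing) (V := R_NormedModule)).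
  unfold rho. auto_derive. trivial.
Qed.

Lemma rho_nonneg K t : 0 <= t -> 0 <= rho K t.
Proof.
  intros Ht. destruct (exp_unit t Ht). unfold rho.
  repeat apply Rmult_le_pos; auto; [apply pos_INR|apply pow_le; lra].
Qed.

Lemma rho_le K t : 0 <= t -> rho K t <= INR K * exp (- t).
Proof.
  intros Ht. destruct (exp_unit t Ht). unfold rho.
  assert ((1 - exp (- t)) ^ pred K <= 1 ^ pred K) by (apply pow_incr; lra). rewrite pow1 in H1.
  apply Rmult_le_compat_r; auto. generalize (pos_INR K). nra.
Qed.

Lemma rho_RInt K a b : is_RInt (V := R_NormedModule) (rho K) a b (GK K a - GK K b).
Proof.
  assert (I : is_RInt (V := R_NormedModule) (rho K) a b (- GK K b - - GK K a)).
  { apply (is_RInt_derive (V := R_CompleteNormedModule) (fun t => - GK K t)).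
    - intros x _. evar_last; [apply (is_derive_opp (GK K)), GK_derive|].
      match goal with |- ?a = ?b => change (@eq R a b) end. unfold opp; simpl. ring.
    - intros x _. apply rho_continuous. }
  now replace (GK K a - GK K b) with (- GK K b - - GK K a) by ring.
Qed.

(** * Moments of the maximum of exponential variables *)

Section Moments.
Context (d : R) (hd : 0 < d).

Definition moment K c := int0 (Rbar_locally p_infty) (fun t => rho K t * Rpower t d) c.

Lemma moment_nice Rng K : nice Rng (fun t => rho K t * Rpower t d).
Proof.
  intros x Hx _. split.
  - apply (continuous_mult (K := R_AbsRing) (rho K) (fun t => Rpower t d)).
    + apply rho_continuous.
    + now apply Rpower_continuous.
  - apply Rmult_le_pos; [apply rho_nonneg; lra|apply Rlt_le, exp_pos].
Qed.

(** Markov's inequality for the [d]-th moment of the maximum, combined with the lower bound [GK_ge]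
    on the probability of exceeding [tau]. *)
Lemma moment_lower K c tau : moment K c -> 0 < tau ->
  Rpower tau d * (1 - exp (- (INR K * exp (- tau)))) <= c.
Proof.
  intros Hc Ht. assert (P : 0 < Rpower tau d) by apply exp_pos.
  apply le_epsilon. intros e He.
  pose (X := Rpower tau d * INR K + 1).
  assert (HX : 1 <= X) by (unfold X; generalize (pos_INR K); nra).
  (* Far enough out that the neglected mass [GK K b <= K exp (- b)], weighted by [tau^d], is at most
     [e]. *)
  pose (b := Rmax tau (ln (X / e))).
  assert (Hb : tau <= b) by apply Rmax_l.
  assert (Heb : Rpower tau d * (INR K * exp (- b)) <= e).
  { assert (exp (- b) <= e / X).
    { replace (e / X) with (exp (- ln (X / e))).
      - apply exp_le_mono. generalize (Rmax_r tau (ln (X / e))). fold b. lra.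
      - rewrite exp_Ropp, exp_ln by (apply Rdiv_lt_0_compat; lra). field. lra. }
    assert (0 < exp (- b)) by apply exp_pos.
    apply Rle_trans with (X * (e / X)); [|right; field; lra].
    rewrite <- Rmult_assoc. apply Rmult_le_compat; try lra.
    - apply Rmult_le_pos; [lra|apply pos_INR].
    - unfold X; lra. }
  assert (Q : Rpower tau d * (GK K tau - GK K b) <= c).
  { apply Rle_trans with (2 := int0_ge _ _ upper_end_inf (fun _ _ _ h => h) _ _ _ _ (moment_nice _ K) Hc Ht Hb I).
    apply (is_RInt_le (fun t => Rpower tau d * rho K t) (fun t => rho K t * Rpower t d) tau b); auto.
    - apply (is_RInt_scal (V := R_NormedModule)), rho_RInt.
    - apply (RInt_correct (V := R_CompleteNormedModule)).
      apply (nice_ex (fun _ => True) (fun _ _ _ h => h)); auto. apply moment_nice.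
    - intros x Hx. rewrite Rmult_comm. apply Rmult_le_compat_l; [apply rho_nonneg; lra|].
      apply Rle_Rpower_l; lra. }
  assert (G1 := GK_ge K tau tau ltac:(lra) (Rle_refl _)).
  destruct (GK_bounds K b ltac:(lra)) as (_ & _ & G2). nra.
Qed.

(** Below [tau] the moment is at most [tau^d] times a mass of at most 1. Above it the density is
    dominated by [m exp (- beta t)], whose moment is a Gamma integral. *)
Lemma moment_upper K c tau beta m : moment K c -> 0 < tau -> 0 < beta ->
  (forall t, tau <= t -> INR K * exp (- t) <= m * exp (- (beta * t))) -> 0 <= m ->
  c <= Rpower tau d + m * (Gamma (1 + d) * Rpower beta (- d) / beta).
Proof.
  intros Hc Ht Hb Hm Hm0.
  apply (int0_upper _ _ upper_end_inf _ _ _ Hc). intros a b Ha Hab _.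
  assert (gauge : nice (fun _ => True) (fun t => exp (- (beta * t)) * Rpower t d)).
  { intros x Hx _. split.
    - apply (continuous_mult (K := R_AbsRing) (fun t => exp (- (beta * t))) (fun t => Rpower t d)).
      + apply (ex_derive_continuous (K := R_AbsRing) (V := R_NormedModule)). auto_derive. trivial.
      + now apply Rpower_continuous.
    - apply Rmult_le_pos; apply Rlt_le, exp_pos. }
  assert (X : ex_RInt (V := R_NormedModule) (fun t => exp (- (beta * t)) * Rpower t d) a b)
    by (now apply (nice_ex (fun _ => True) (fun _ _ _ h => h))).
  apply Rle_trans with (Rpower tau d * (GK K a - GK K b) +
     m * RInt (fun t => exp (- (beta * t)) * Rpower t d) a b).
  - apply (is_RInt_le (fun t => rho K t * Rpower t d)
      (fun t => Rpower tau d * rho K t + m * (exp (- (beta * t)) * Rpower t d)) a b); auto.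
    + apply (RInt_correct (V := R_CompleteNormedModule)).
      apply (nice_ex (fun _ => True) (fun _ _ _ h => h)); auto. apply moment_nice.
    + apply (is_RInt_plus (V := R_NormedModule) (fun t => Rpower tau d * rho K t)
        (fun t => m * (exp (- (beta * t)) * Rpower t d))).
      * apply (is_RInt_scal (V := R_NormedModule)), rho_RInt.
      * apply (is_RInt_scal (V := R_NormedModule)).
        now apply (RInt_correct (V := R_CompleteNormedModule)).
    + intros x Hx. assert (P := rho_nonneg K x ltac:(lra)).
      assert (P1 : 0 < Rpower tau d) by apply exp_pos.
      assert (P2 : 0 < Rpower x d) by apply exp_pos.
      assert (P3 : 0 < exp (- (beta * x))) by apply exp_pos.
      destruct (Rle_lt_dec tau x) as [C|C].
      * assert (rho K x * Rpower x d <= m * (exp (- (beta * x)) * Rpower x d)).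
        { rewrite <- Rmult_assoc. apply Rmult_le_compat_r; [lra|].
          apply Rle_trans with (1 := rho_le K x ltac:(lra)). now apply Hm. }
        nra.
      * assert (Rpower x d <= Rpower tau d) by (apply Rle_Rpower_l; lra).
        assert (0 <= m * (exp (- (beta * x)) * Rpower x d)).
        { apply Rmult_le_pos; [lra|]. apply Rmult_le_pos; lra. }
        nra.
  - apply Rplus_le_compat.
    + rewrite <- (Rmult_1_r (Rpower tau d)) at 2. apply Rmult_le_compat_l; [apply Rlt_le, exp_pos|].
      destruct (GK_bounds K a ltac:(lra)) as (_ & G1 & _).
      destruct (GK_bounds K b ltac:(lra)) as (G2 & _ & _). lra.
    + apply Rmult_le_compat_l; auto.
      apply (int0_ge _ _ upper_end_inf (fun _ _ _ h => h) _ _ _ _ gauge (Gamma_scaled d hd beta Hb)); auto.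
Qed.

End Moments.

(** * From the Laplace transform to the distribution function *)

Section Tauber.
Context (E : (R -> R) -> R) (F : R -> R) (HE : law E F).
Context (d : R) (hd : 0 < d) (l : R -> R) (c : R) (hc : 0 < c).
Hypothesis l_pos : exists S, forall s, S < s -> 0 < l s.
Hypothesis l_slow : forall k, 0 < k -> is_lim (fun s => l (k * s) / l s) p_infty 1.

(** A regularly varying normalisation of index [d]. The slowly varying [l] will be 1 or, in the
    critical case, [ln]. *)
Definition gauge s := Rpower s d / l s.

Hypothesis laplace : is_lim (fun s => E (fun q => exp (- (s * q))) * gauge s) p_infty c.

Lemma gauge_ratio k : 0 < k -> is_lim (fun s => gauge s / gauge (k * s)) p_infty (Rpower k (- d)).
Proof.
  intros Hk. destruct l_pos as [S HS].
  assert (X := lim_scal _ _ (Rpower k (- d)) (l_slow k Hk)). rewrite Rmult_1_r in X.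
  apply (lim_ext_ev) with (2 := X) (S := Rmax 0 (Rmax S (S / k))).
  intros s Hs. generalize (Rmax_l 0 (Rmax S (S / k))) (Rmax_r 0 (Rmax S (S / k)))
    (Rmax_l S (S / k)) (Rmax_r S (S / k)). intros.
  assert (P1 := HS s ltac:(lra)).
  assert (P2 : 0 < l (k * s)).
  { apply HS. assert (S / k < s) by lra. apply Rlt_div_l in H3; lra. }
  unfold gauge. rewrite Rpower_mult_l by lra. rewrite Rpower_Ropp.
  assert (0 < Rpower k d) by apply exp_pos. assert (0 < Rpower s d) by apply exp_pos.
  field. lra.
Qed.

(** Replacing [s] by [k s] changes the gauge by an asymptotic factor [k^d], because [l] varies
    slowly. *)
Lemma lim_rescale phi (v k : R) : 0 < k ->
  is_lim (fun s => E (fun q => phi (s * q)) * gauge s) p_infty v ->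
  is_lim (fun s => E (fun q => phi (k * s * q)) * gauge s) p_infty (v * Rpower k (- d)).
Proof.
  intros Hk H. destruct l_pos as [S HS].
  apply lim_ext_ev with (2 := lim_mult _ _ _ _ (lim_scale _ k _ Hk H) (gauge_ratio k Hk)) (S := Rmax 0 (S / k)).
  intros s Hs. generalize (Rmax_l 0 (S / k)) (Rmax_r 0 (S / k)). intros.
  assert (P2 : 0 < l (k * s)).
  { apply HS. assert (S / k < s) by lra. apply Rlt_div_l in H2; lra. }
  assert (0 < gauge (k * s)) by (apply Rdiv_lt_0_compat; [apply exp_pos|auto]).
  field. lra.
Qed.

(* Functions [phi] for which [E (phi (s Q)) * gauge s] tends to
   [c / Gamma (1 + d) * int_0^oo (- phi' t) t^d dt]. *)
Definition good phi := continuity phi /\ exists psi v,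
  (forall t : R, is_derive phi t (- psi t)) /\
  int0 (Rbar_locally p_infty) (fun t => psi t * Rpower t d) v /\
  is_lim (fun s => E (fun q => phi (s * q)) * gauge s) p_infty (c * v / Gamma (1 + d)).

Lemma continuity_dilate f s : continuity f -> continuity (fun q => f (s * q)).
Proof.
  intros Hf q. apply (continuity_pt_comp (fun q => s * q) f); [|apply Hf].
  apply derivable_continuous_pt, derivable_pt_scal, derivable_pt_id.
Qed.

Lemma good_lin a b f g : good f -> good g -> good (fun t => a * f t + b * g t).
Proof.
  intros [Cf (psi & v & D1 & I1 & L1)] [Cg (chi & w & D2 & I2 & L2)]. split.
  - intros x. apply (continuity_pt_plus (fun t => a * f t) (fun t => b * g t));
    apply continuity_pt_scal; auto.
  - exists (fun t => a * psi t + b * chi t), (a * v + b * w). split; [|split].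
    + intros t. evar_last.
      * apply (is_derive_plus (K := R_AbsRing) (V := R_NormedModule) (fun t => a * f t) (fun t => b * g t));
        apply is_derive_scal; auto.
      * unfold plus; simpl. match goal with |- ?a = ?b => change (@eq R a b) end. ring.
    + apply (int0_ext _ _ upper_end_inf) with (2 := int0_lin _ _ upper_end_inf a b _ _ _ _ I1 I2).
      exists 0. intros; ring.
    + replace (c * (a * v + b * w) / Gamma (1 + d)) with
        (a * (c * v / Gamma (1 + d)) + b * (c * w / Gamma (1 + d))) by (unfold Rdiv; ring).
      apply (is_lim_ext (fun s => a * (E (fun q => f (s * q)) * gauge s) + b * (E (fun q => g (s * q)) * gauge s))).
      * intros s. rewrite (law_lin _ _ HE a b (fun q => f (s * q)) (fun q => g (s * q)));
          [ring|now apply continuity_dilate|now apply continuity_dilate].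
      * apply is_lim_plus'; now apply lim_scal.
Qed.

Lemma good_exp j : 0 < j -> good (fun t => exp (- (j * t))).
Proof.
  intros Hj. assert (G := Gamma_pos d hd). split; [apply continuity_expn|].
  exists (fun t => j * exp (- (j * t))), (Gamma (1 + d) * Rpower j (- d)). split; [|split].
  - intros t. auto_derive; trivial. ring.
  - assert (X := int0_scal _ _ upper_end_inf j _ _ (Gamma_scaled d hd j Hj)).
    replace (j * (Gamma (1 + d) * Rpower j (- d) / j)) with (Gamma (1 + d) * Rpower j (- d)) in X by (field; lra).
    apply (int0_ext _ _ upper_end_inf) with (2 := X). exists 0. intros; ring.
  - replace (c * (Gamma (1 + d) * Rpower j (- d)) / Gamma (1 + d)) with (c * Rpower j (- d)) by (field; lra).
    apply (is_lim_ext (fun s => E (fun q => exp (- (j * s * q))) * gauge s)).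
    + intros s. do 3 f_equal. extensionality q. do 2 f_equal. ring.
    + apply (lim_rescale (fun t => exp (- t)) c j Hj). exact laplace.
Qed.

(** Splitting off one factor [1 - exp (- t)] yields two terms with exponents [j] and [j + 1]. The
    induction over all [j] avoids the binomial expansion. *)
Lemma good_exp_pow k : forall j, 0 < j -> good (fun t => exp (- (j * t)) * (1 - exp (- t)) ^ k).
Proof.
  induction k as [|k IH]; intros j Hj.
  - replace (fun t => exp (- (j * t)) * (1 - exp (- t)) ^ 0) with (fun t => exp (- (j * t))).
    + now apply good_exp.
    + extensionality t. simpl. ring.
  - replace (fun t => exp (- (j * t)) * (1 - exp (- t)) ^ S k) with
      (fun t => 1 * (exp (- (j * t)) * (1 - exp (- t)) ^ k) + -1 * (exp (- ((j + 1) * t)) * (1 - exp (- t)) ^ k)).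
    + apply good_lin; apply IH; lra.
    + extensionality t. replace (- ((j + 1) * t)) with (- (j * t) + - t) by ring.
      rewrite exp_plus. simpl. ring.
Qed.

(** Telescoping: [GK (K + 1) - GK K = exp (- t) (1 - exp (- t))^K]. *)
Lemma good_GK K : good (GK K).
Proof.
  induction K as [|K IH].
  - replace (GK 0) with (fun t => 0 * exp (- (1 * t)) + 0 * exp (- (1 * t))).
    + apply good_lin; apply good_exp; lra.
    + extensionality t. unfold GK. simpl. ring.
  - replace (GK (S K)) with (fun t => 1 * GK K t + 1 * (exp (- (1 * t)) * (1 - exp (- t)) ^ K)).
    + apply good_lin; auto. apply good_exp_pow. lra.
    + extensionality t. unfold GK. replace (1 * t) with t by ring. simpl. ring.
Qed.

Lemma GK_moment K : exists v, moment d K v /\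
  is_lim (fun s => E (fun q => GK K (s * q)) * gauge s) p_infty (c * v / Gamma (1 + d)).
Proof.
  destruct (good_GK K) as [_ (psi & v & D & I & Lm)]. exists v. split; auto.
  (* The function [psi] hidden in [good] is minus the derivative of [GK K], hence equal to
     [rho K]. *)
  apply (int0_ext _ _ upper_end_inf) with (2 := I). exists 0. intros b _ x _. f_equal.
  assert (A1 := is_derive_unique _ _ _ (D x)). assert (A2 := is_derive_unique _ _ _ (GK_derive K x)).
  lra.
Qed.

Lemma gauge_pos : exists S, 0 < S /\ forall s, S < s -> 0 < gauge s.
Proof.
  destruct l_pos as [S HS]. exists (Rmax 1 S). split; [generalize (Rmax_l 1 S); lra|].
  intros s Hs. apply Rdiv_lt_0_compat; [apply exp_pos|]. apply HS.
  generalize (Rmax_r 1 S). lra.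
Qed.

Lemma large_K M : exists K : nat, 0 < INR K /\ M < ln (INR K).
Proof.
  destruct (INR_unbounded (exp M)) as [K HK]. exists K.
  assert (0 < exp M) by apply exp_pos. split; [lra|].
  rewrite <- (ln_exp M). apply ln_increasing; lra.
Qed.

Section Eta.
Context (eta : R) (heta : 1 < eta).

(** Chosen so that for [t >= eta ln K] the decay of [K exp (- t)] splits into a vanishing prefactor
    [K^(-(eta-1)/2)] and an exponential [exp (- beta t)] that is still integrable against [t^d]. *)
Let beta := (eta - 1) / (2 * eta).

Lemma beta_pos : 0 < beta.
Proof. apply Rdiv_lt_0_compat; lra. Qed.

Lemma exp_cut K t : 0 < INR K -> eta * ln (INR K) <= t ->
  INR K * exp (- t) <= exp (- ((eta - 1) / 2 * ln (INR K))) * exp (- (beta * t)).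
Proof.
  intros HK Ht. rewrite <- (exp_ln (INR K)) at 1 by auto. rewrite <- !exp_plus.
  apply exp_le_mono.
  assert (P : 0 < (eta + 1) / (2 * eta)) by (apply Rdiv_lt_0_compat; lra).
  assert (Q : (eta + 1) / (2 * eta) * (eta * ln (INR K)) <= (eta + 1) / (2 * eta) * t)
    by (apply Rmult_le_compat_l; lra).
  replace ((eta + 1) / (2 * eta) * (eta * ln (INR K))) with ((eta + 1) / 2 * ln (INR K)) in Q by (field; lra).
  replace (beta * t) with (t - (eta + 1) / (2 * eta) * t) by (unfold beta; field; lra).
  lra.
Qed.

(** With [lam = ln K] this is [exp (- K^(1 - 1/eta))], a bound on how far [GK K] stays below 1 up to
    [lam / eta]. *)
Let gap lam := exp (- exp ((1 - / eta) * lam)).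

Lemma gap_eq K : 0 < INR K -> exp (- (INR K * exp (- (ln (INR K) / eta)))) = gap (ln (INR K)).
Proof.
  intros HK. unfold gap. do 2 f_equal. rewrite <- (exp_ln (INR K)) at 1 by auto.
  rewrite <- exp_plus. f_equal. field. lra.
Qed.

Lemma lim_exp_neg k : 0 < k -> is_lim (fun lam => exp (- (k * lam))) p_infty 0.
Proof.
  intros Hk. apply is_lim_spec. intros e. assert (He := cond_pos e). exists (- ln e / k). intros x Hx. simpl.
  rewrite Rminus_0_r, Rabs_right by apply Rle_ge, Rlt_le, exp_pos.
  rewrite <- (exp_ln e) by auto. apply exp_increasing. apply Rlt_div_l in Hx; lra.
Qed.

Lemma eta_inv : 0 < 1 - / eta.
Proof. assert (/ eta < / 1) by (apply Rinv_lt_contravar; lra). rewrite Rinv_1 in H. lra. Qed.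

Lemma gap_lim : is_lim gap p_infty 0.
Proof.
  apply is_lim_spec. intros e. assert (He := cond_pos e).
  assert (P := eta_inv).
  exists (- ln e / (1 - / eta)). intros x Hx. simpl. unfold gap.
  rewrite Rminus_0_r, Rabs_right by apply Rle_ge, Rlt_le, exp_pos.
  rewrite <- (exp_ln e) by auto. apply exp_increasing.
  apply Rlt_div_l in Hx; auto. generalize (exp_ineq1_le ((1 - / eta) * x)). lra.
Qed.

Lemma Rpower_neg_lim k : 0 < k -> is_lim (fun lam => Rpower (k * lam) (- d)) p_infty 0.
Proof.
  intros Hk. apply (lim_scale (fun x => Rpower x (- d)) k 0 Hk).
  apply (is_lim_ext (fun x => / Rpower x d)).
  - intros x. now rewrite Rpower_Ropp.
  - apply (is_lim_inv (fun x => Rpower x d) p_infty p_infty); [now apply Rpower_lim|discriminate].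
Qed.

(** The dilation [lam / eta] sends [q <= 1 / s] into the region where [GK K >= 1 - gap lam]. The
    moment is about [(eta lam)^d] at most, and dividing by [(lam / eta)^d] leaves [eta^(2d)]. *)
Lemma F_upper e : 0 < e -> exists S, forall s, S < s ->
  F (1 / s) * gauge s < c / Gamma (1 + d) * Rpower (eta * eta) d + e.
Proof.
  intros He. assert (G := Gamma_pos d hd). assert (Hb := beta_pos).
  pose (B := Gamma (1 + d) * Rpower beta (- d) / beta).
  (* [U] is the bound obtained for a fixed [K] after [s -> oo], as a function of [lam = ln K]. Its
     limit allows [K] to be fixed before [s]. *)
  pose (U := fun lam => c / Gamma (1 + d) * (Rpower (eta * eta) d +
     B * (exp (- ((eta - 1) / 2 * lam)) * Rpower (/ eta * lam) (- d))) / (1 - gap lam)).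
  assert (LU : is_lim U p_infty (c / Gamma (1 + d) * Rpower (eta * eta) d)).
  { replace (c / Gamma (1 + d) * Rpower (eta * eta) d) with
      (c / Gamma (1 + d) * (Rpower (eta * eta) d + B * (0 * 0)) / (1 - 0)) by (field; lra).
    apply lim_div; [lra| |].
    - apply lim_scal. apply is_lim_plus'; [apply is_lim_const|]. apply lim_scal. apply lim_mult.
      + apply lim_exp_neg. lra.
      + apply Rpower_neg_lim. apply Rinv_0_lt_compat; lra.
    - apply is_lim_minus'; [apply is_lim_const|apply gap_lim]. }
  destruct (lim_lt _ _ (c / Gamma (1 + d) * Rpower (eta * eta) d + e) LU ltac:(lra)) as [M HM].
  destruct (large_K (Rmax 1 M)) as (K & HK0 & HK).
  specialize (HM (ln (INR K)) ltac:(generalize (Rmax_r 1 M); lra)).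
  assert (Hlam : 1 < ln (INR K)) by (generalize (Rmax_l 1 M); lra).
  pose (lam := ln (INR K)). fold lam in HM, Hlam.
  destruct (GK_moment K) as (v & Hv & Lim).
  assert (Hr : 0 < / eta * lam).
  { apply Rmult_lt_0_compat; [apply Rinv_0_lt_compat; lra|lra]. }
  assert (Lim' := lim_rescale (GK K) _ (/ eta * lam) Hr Lim).
  assert (Hgap : 0 < 1 - gap lam).
  { unfold gap. assert (exp (- exp ((1 - / eta) * lam)) < exp 0).
    { apply exp_increasing. generalize (exp_pos ((1 - / eta) * lam)). lra. }
    rewrite exp_0 in H. lra. }
  assert (Hvle : v <= Rpower (eta * lam) d + exp (- ((eta - 1) / 2 * lam)) * B).
  { apply (moment_upper d hd K v (eta * lam) beta); auto.
    - apply Rmult_lt_0_compat; lra.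
    - intros t Ht. now apply exp_cut.
    - apply Rlt_le, exp_pos. }
  assert (Hlt : c * v / Gamma (1 + d) * Rpower (/ eta * lam) (- d) / (1 - gap lam) <= U lam).
  { unfold U. apply Rmult_le_compat_r; [apply Rlt_le, Rinv_0_lt_compat; lra|].
    replace (c * v / Gamma (1 + d) * Rpower (/ eta * lam) (- d)) with
      (c / Gamma (1 + d) * (v * Rpower (/ eta * lam) (- d))) by (unfold Rdiv; ring).
    apply Rmult_le_compat_l; [apply Rlt_le, Rdiv_lt_0_compat; lra|].
    apply Rle_trans with ((Rpower (eta * lam) d + exp (- ((eta - 1) / 2 * lam)) * B) * Rpower (/ eta * lam) (- d)).
    - apply Rmult_le_compat_r; [apply Rlt_le, exp_pos|auto].
    - right. rewrite Rmult_plus_distr_r. f_equal; [|ring].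
      replace (eta * lam) with ((eta * eta) * (/ eta * lam)) by (field; lra).
      rewrite Rpower_mult_l by nra. rewrite Rmult_assoc, <- Rpower_plus.
      replace (d + - d) with 0 by ring. rewrite Rpower_O by auto. ring. }
  destruct (lim_lt _ _ ((1 - gap lam) * (c / Gamma (1 + d) * Rpower (eta * eta) d + e)) Lim') as [S1 HS1].
  { apply Rmult_lt_reg_r with (/ (1 - gap lam)); [now apply Rinv_0_lt_compat|].
    replace ((1 - gap lam) * (c / Gamma (1 + d) * Rpower (eta * eta) d + e) * / (1 - gap lam)) with
      (c / Gamma (1 + d) * Rpower (eta * eta) d + e) by (field; lra).
    unfold Rdiv at 1 in Hlt. unfold Rdiv in Hlt. unfold Rdiv in HM. unfold Rdiv. lra. }
  destruct gauge_pos as (S2 & HS2 & HN).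
  exists (Rmax S1 S2). intros s Hs. generalize (Rmax_l S1 S2) (Rmax_r S1 S2). intros.
  specialize (HS1 s ltac:(lra)). assert (N0 := HN s ltac:(lra)).
  assert (HF : F (1 / s) <= / (1 - gap lam) * E (fun q => GK K (/ eta * lam * s * q))).
  { assert (C1 : continuity (fun q => GK K (/ eta * lam * s * q))).
    { apply (continuity_dilate (GK K)), GK_continuity. }
    assert (EQ := law_lin _ _ HE (/ (1 - gap lam)) 0 _ _ C1 C1).
    apply Rle_trans with (/ (1 - gap lam) * E (fun q => GK K (/ eta * lam * s * q)) +
      0 * E (fun q => GK K (/ eta * lam * s * q))); [|lra].
    rewrite <- EQ. apply (law_upper _ _ HE).
    - intros x. apply (continuity_pt_plus (fun q => / (1 - gap lam) * GK K (/ eta * lam * s * q)) (fun q => 0 * GK K (/ eta * lam * s * q)));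
      apply continuity_pt_scal, C1.
    - intros q Hq. assert (0 < / eta * lam * s) by (apply Rmult_lt_0_compat; lra).
      assert (Ht : 0 <= / eta * lam * s * q) by (apply Rmult_le_pos; lra).
      destruct (GK_bounds K _ Ht) as (G0 & _ & _).
      assert (I0 : 0 < / (1 - gap lam)) by now apply Rinv_0_lt_compat.
      destruct (Rle_dec q (1 / s)) as [C|C]; [|nra].
      assert (G1 : 1 - gap lam <= GK K (/ eta * lam * s * q)).
      { unfold lam at 1. rewrite <- gap_eq by auto. apply GK_ge; auto.
        apply Rle_div_r in C; [|lra]. fold lam.
        replace (lam / eta) with (/ eta * lam * 1) by (unfold Rdiv; ring).
        rewrite Rmult_assoc. apply Rmult_le_compat_l; lra. }
      apply Rmult_le_compat_l with (r := / (1 - gap lam)) in G1; [|lra].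
      rewrite Rinv_l in G1; lra. }
  apply Rle_lt_trans with (/ (1 - gap lam) * E (fun q => GK K (/ eta * lam * s * q)) * gauge s).
  - apply Rmult_le_compat_r; lra.
  - apply Rmult_lt_reg_l with (1 - gap lam); auto.
    replace ((1 - gap lam) * (/ (1 - gap lam) * E (fun q => GK K (/ eta * lam * s * q)) * gauge s)) with
      (E (fun q => GK K (/ eta * lam * s * q)) * gauge s) by (field; lra). auto.
Qed.

(** The dilation [eta * lam] sends [q > 1 / s] past [eta ln K], where [GK K] is small but positive.
    Subtracting the majorant of [exp_cut] makes the test function nonpositive there, and the
    subtracted term vanishes as [K] grows. The main term is at least about
    [(lam / eta)^d / (eta lam)^d]. *)
Lemma F_lower e : 0 < e -> exists S, forall s, S < s ->
  c / Gamma (1 + d) * Rpower (eta * eta) (- d) - e < F (1 / s) * gauge s.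
Proof.
  intros He. assert (G := Gamma_pos d hd). assert (Hb := beta_pos).
  pose (U := fun lam => c / Gamma (1 + d) * (Rpower (eta * eta) (- d) * (1 - gap lam)) -
     c * (exp (- ((eta - 1) / 2 * lam)) * Rpower (beta * eta * lam) (- d))).
  assert (LU : is_lim U p_infty (c / Gamma (1 + d) * Rpower (eta * eta) (- d))).
  { replace (c / Gamma (1 + d) * Rpower (eta * eta) (- d)) with
      (c / Gamma (1 + d) * (Rpower (eta * eta) (- d) * (1 - 0)) - c * (0 * 0)) by ring.
    apply is_lim_minus'.
    - apply lim_scal, lim_scal. apply is_lim_minus'; [apply is_lim_const|apply gap_lim].
    - apply lim_scal, lim_mult.
      + apply lim_exp_neg. lra.
      + apply Rpower_neg_lim. apply Rmult_lt_0_compat; lra. }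
  destruct (lim_gt _ _ (c / Gamma (1 + d) * Rpower (eta * eta) (- d) - e) LU ltac:(lra)) as [M HM].
  destruct (large_K (Rmax 1 M)) as (K & HK0 & HK).
  specialize (HM (ln (INR K)) ltac:(generalize (Rmax_r 1 M); lra)).
  assert (Hlam : 1 < ln (INR K)) by (generalize (Rmax_l 1 M); lra).
  pose (lam := ln (INR K)). fold lam in HM, Hlam.
  destruct (GK_moment K) as (v & Hv & Lim).
  assert (Hr : 0 < eta * lam) by (apply Rmult_lt_0_compat; lra).
  assert (Hr' : 0 < beta * eta * lam) by (rewrite Rmult_assoc; apply Rmult_lt_0_compat; lra).
  assert (Lim1 := lim_rescale (GK K) _ (eta * lam) Hr Lim).
  assert (Lim2 := lim_rescale (fun t => exp (- t)) c (beta * eta * lam) Hr' laplace).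
  pose (m := exp (- ((eta - 1) / 2 * lam))).
  assert (Lim3 := is_lim_minus' _ _ _ _ _ Lim1 (lim_scal _ _ m Lim2)). cbv beta in Lim3.
  assert (Hvge : Rpower (lam / eta) d * (1 - gap lam) <= v).
  { unfold lam at 2. rewrite <- gap_eq by auto. apply (moment_lower d hd K v); auto.
    fold lam. apply Rdiv_lt_0_compat; lra. }
  assert (Hge : U lam <= c * v / Gamma (1 + d) * Rpower (eta * lam) (- d) -
     m * (c * Rpower (beta * eta * lam) (- d))).
  { unfold U. fold m. apply Rplus_le_compat; [|right; ring].
    replace (c * v / Gamma (1 + d) * Rpower (eta * lam) (- d)) with
      (c / Gamma (1 + d) * (v * Rpower (eta * lam) (- d))) by (unfold Rdiv; ring).
    apply Rmult_le_compat_l; [apply Rlt_le, Rdiv_lt_0_compat; lra|].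
    apply Rle_trans with (Rpower (lam / eta) d * (1 - gap lam) * Rpower (eta * lam) (- d)).
    - right. replace (eta * lam) with ((eta * eta) * (lam / eta)) by (field; lra).
      assert (0 < lam / eta) by (apply Rdiv_lt_0_compat; lra).
      rewrite (Rpower_mult_l (eta * eta)) by nra. rewrite (Rpower_Ropp (lam / eta)).
      assert (0 < Rpower (lam / eta) d) by apply exp_pos. field. lra.
    - apply Rmult_le_compat_r; [apply Rlt_le, exp_pos|auto]. }
  destruct (lim_gt _ _ (c / Gamma (1 + d) * Rpower (eta * eta) (- d) - e) Lim3 ltac:(lra)) as [S1 HS1].
  destruct gauge_pos as (S2 & HS2 & HN).
  exists (Rmax S1 S2). intros s Hs. generalize (Rmax_l S1 S2) (Rmax_r S1 S2). intros.
  specialize (HS1 s ltac:(lra)). assert (N0 := HN s ltac:(lra)).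
  assert (HF : 1 * E (fun q => GK K (eta * lam * s * q)) + - m * E (fun q => exp (- (beta * eta * lam * s * q))) <= F (1 / s)).
  { assert (C1 : continuity (fun q => GK K (eta * lam * s * q))).
    { apply (continuity_dilate (GK K)), GK_continuity. }
    assert (C2 : continuity (fun q => exp (- (beta * eta * lam * s * q)))) by apply continuity_expn.
    rewrite <- (law_lin _ _ HE 1 (- m) _ _ C1 C2). apply (law_lower _ _ HE).
    - intros x. apply (continuity_pt_plus (fun q => 1 * GK K (eta * lam * s * q)) (fun q => - m * exp (- (beta * eta * lam * s * q))));
      apply continuity_pt_scal; auto.
    - intros q Hq. assert (0 < eta * lam * s) by (apply Rmult_lt_0_compat; lra).
      assert (Ht : 0 <= eta * lam * s * q) by (apply Rmult_le_pos; lra).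
      destruct (GK_bounds K _ Ht) as (_ & G1 & G2).
      assert (0 < m * exp (- (beta * eta * lam * s * q))) by (apply Rmult_lt_0_compat; apply exp_pos).
      destruct (Rle_dec q (1 / s)) as [C|C]; [lra|].
      assert (Hq' : eta * ln (INR K) <= eta * lam * s * q).
      { fold lam. assert (1 / s < q) by lra. apply Rlt_div_l in H3; [|lra].
        rewrite Rmult_assoc. rewrite <- (Rmult_1_r (eta * lam)) at 1. apply Rmult_le_compat_l; lra. }
      assert (G3 := exp_cut K _ HK0 Hq'). fold lam in G3. fold m in G3.
      replace (beta * (eta * lam * s * q)) with (beta * eta * lam * s * q) in G3 by ring. lra. }
  apply Rmult_le_compat_r with (r := gauge s) in HF; [|lra].
  apply Rlt_le_trans with (2 := HF). apply Rlt_le_trans with (1 := HS1). lra.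
Qed.

End Eta.

Lemma karamata : is_lim (fun s => F (1 / s) * gauge s) p_infty (c / Gamma (1 + d)).
Proof.
  assert (G := Gamma_pos d hd).
  pose (C := c / Gamma (1 + d)). assert (HC : 0 < C) by (apply Rdiv_lt_0_compat; lra).
  apply is_lim_spec. intros eps. assert (He := cond_pos eps).
  assert (CT : forall q, continuity_pt (fun x => C * Rpower x q) 1).
  { intros q. apply continuity_pt_scal, continuity_pt_filterlim, Rpower_continuous. lra. }
  destruct (CT d (eps / 2) ltac:(lra)) as (d1 & Hd1 & K1).
  destruct (CT (- d) (eps / 2) ltac:(lra)) as (d2 & Hd2 & K2).
  (* With [eta = 1 + r], [eta^2 - 1 <= 3 r] is smaller than both continuity radii [d1] and [d2]. *)
  pose (r := Rmin 1 (Rmin d1 d2) / 4).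
  assert (Hr : 0 < r /\ r <= 1 / 4 /\ r <= d1 / 4 /\ r <= d2 / 4).
  { unfold r. generalize (Rmin_l 1 (Rmin d1 d2)) (Rmin_r 1 (Rmin d1 d2)) (Rmin_l d1 d2) (Rmin_r d1 d2).
    assert (0 < Rmin 1 (Rmin d1 d2)) by (repeat apply Rmin_glb_lt; lra). intros. repeat split; lra. }
  assert (E1 : (1 + r) * (1 + r) <> 1) by nra.
  assert (E2 : Rabs ((1 + r) * (1 + r) - 1) <= 3 * r) by (rewrite Rabs_right; nra).
  specialize (K1 ((1 + r) * (1 + r))). specialize (K2 ((1 + r) * (1 + r))).
  simpl in K1, K2. unfold R_dist, D_x, no_cond in K1, K2. rewrite !Rpower_1_l in K1, K2.
  specialize (K1 ltac:(split; [split; auto|lra])). specialize (K2 ltac:(split; [split; auto|lra])).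
  apply Rabs_def2 in K1. apply Rabs_def2 in K2.
  destruct (F_upper (1 + r) ltac:(lra) (eps / 2) ltac:(lra)) as [S1 HS1].
  destruct (F_lower (1 + r) ltac:(lra) (eps / 2) ltac:(lra)) as [S2 HS2].
  exists (Rmax S1 S2). intros s Hs. generalize (Rmax_l S1 S2) (Rmax_r S1 S2). intros.
  specialize (HS1 s ltac:(lra)). specialize (HS2 s ltac:(lra)). fold C in HS1, HS2.
  simpl. fold C. apply Rabs_def1; lra.
Qed.

End Tauber.

(** * Conclusion *)

Lemma F_Q_law p n : 0 < p -> (2 <= n)%nat -> law (expectQ p n) (F_Q p n).
Proof.
  intros hp hn. assert (hn0 : n <> 0%nat) by lia. constructor.
  - intros a b f g Hf Hg. unfold expectQ. now apply expect_lin; auto; apply UCB_phi.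
  - intros f x Hf H. apply (iter_expect_le p hp n) with (3 := F_Q_spec p hp n x hn)
      (2 := expect_spec p hp n _ (UCB_phi n hn0 f Hf)).
    intros l _. apply H, Qstat_nonneg.
  - intros f x Hf H. apply (iter_expect_le p hp n) with (2 := F_Q_spec p hp n x hn)
      (3 := expect_spec p hp n _ (UCB_phi n hn0 f Hf)).
    intros l _. apply H, Qstat_nonneg.
Qed.

Lemma equiv_of_lim F d l C : 0 < C -> (exists S, forall s, S < s -> 0 < l s) ->
  is_lim (fun s => F (1 / s) * (Rpower s d / l s)) p_infty C ->
  equiv_at_0plus F (fun x => C * Rpower x d * l (1 / x)).
Proof.
  intros HC [S HS] H eps He.
  destruct (proj2 (is_lim_spec _ _ _) H (mkposreal (eps * C) ltac:(apply Rmult_lt_0_compat; lra))) as [M HM].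
  simpl in HM. pose (X := Rmax 1 (Rmax S M)).
  assert (1 <= X /\ S <= X /\ M <= X) as (X1 & X2 & X3).
  { unfold X. generalize (Rmax_l 1 (Rmax S M)) (Rmax_r 1 (Rmax S M)) (Rmax_l S M) (Rmax_r S M).
    intros; repeat split; lra. }
  exists (/ X). split; [apply Rinv_0_lt_compat; lra|]. intros x [Hx0 Hx].
  assert (Hs : X < 1 / x).
  { apply Rlt_div_r; auto. apply Rmult_lt_compat_r with (r := X) in Hx; [|lra].
    rewrite Rinv_l in Hx; lra. }
  specialize (HM (1 / x) ltac:(lra)). specialize (HS (1 / x) ltac:(lra)).
  assert (E : 1 / (1 / x) = x) by (field; lra). rewrite E in HM.
  assert (P : 0 < Rpower x d) by apply exp_pos.
  assert (E2 : Rpower (1 / x) d = / Rpower x d).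
  { rewrite <- Rpower_Ropp. unfold Rpower, Rdiv. rewrite Rmult_1_l, ln_Rinv by auto. f_equal. ring. }
  rewrite E2 in HM.
  replace (F x / (C * Rpower x d * l (1 / x)) - 1) with
    ((F x * (/ Rpower x d / l (1 / x)) - C) / C) by (field; lra).
  unfold Rdiv at 1. rewrite Rabs_mult, (Rabs_right (/ C)) by (apply Rle_ge, Rlt_le, Rinv_0_lt_compat; auto).
  apply Rlt_div_l; auto.
Qed.

Lemma lim_sqrt f (v : Rbar) : is_lim f p_infty v -> is_lim (fun s => f (sqrt s)) p_infty v.
Proof.
  intros H. apply (filterlim_comp _ _ _ sqrt f _ (Rbar_locally p_infty)); [|exact H].
  intros P [M HM]. exists (Rmax 0 M ^ 2). intros x Hx. apply HM.
  apply Rle_lt_trans with (1 := Rmax_r 0 M). rewrite <- (sqrt_pow2 (Rmax 0 M)) by apply Rmax_l.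
  apply sqrt_lt_1_alt. split; [apply pow2_ge_0|exact Hx].
Qed.

Lemma ln_slow k : 0 < k -> is_lim (fun s => ln (k * s) / ln s) p_infty 1.
Proof.
  intros Hk.
  assert (X : is_lim (fun s => ln k * / ln s + 1) p_infty (ln k * 0 + 1)).
  { apply is_lim_plus'; [|apply is_lim_const]. apply lim_scal.
    apply (is_lim_inv ln p_infty p_infty); [apply is_lim_ln_p|discriminate]. }
  replace (ln k * 0 + 1) with 1 in X by ring.
  apply lim_ext_ev with (2 := X) (S := 1). intros s Hs.
  rewrite ln_mult by lra. assert (0 < ln s) by (rewrite <- ln_1; apply ln_increasing; lra).
  field. lra.
Qed.

Section Main.
Context (p : R) (n : nat) (hp : 0 < p < 1) (hn : (2 <= n)%nat).

Let hn0 : n <> 0%nat.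
Proof. lia. Qed.

Let sigma := sqrt (PI / INR n).

Let sigma_pos : 0 < sigma.
Proof. apply sqrt_lt_R0, Rdiv_lt_0_compat; [apply PI_RGT_0|apply INR_n_pos; exact hn0]. Qed.

Lemma laplaceQ_Jint s : 0 < s -> laplaceQ p n s * Rpower s (INR n * p / 2) = Jint p n (sqrt s) / sigma.
Proof.
  intros Hs. unfold Jint. rewrite pow2_sqrt by lra. fold sigma.
  rewrite <- (Rpower_sqrt s Hs), Rpower_mult.
  replace (/ 2 * (INR n * p)) with (INR n * p / 2) by field.
  assert (Sg := sigma_pos). field. lra.
Qed.

(** [Jint] contains the power [s^(n p / 2)]; the exponent [d - n p / 2] corrects it to the gauge, so
    one statement serves all three regimes. *)
Lemma F_Q_equiv d l K : 0 < d -> 0 < K ->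
  (exists S, forall s, S < s -> 0 < l s) ->
  (forall k, 0 < k -> is_lim (fun s => l (k * s) / l s) p_infty 1) ->
  is_lim (fun s => Jint p n (sqrt s) * (Rpower s (d - INR n * p / 2) / l s)) p_infty K ->
  equiv_at_0plus (F_Q p n) (fun x => K / (Gamma (1 + d) * sigma) * Rpower x d * l (1 / x)).
Proof.
  intros Hd HK Hl Hslow HJ. assert (Sg := sigma_pos). assert (G := Gamma_pos d Hd).
  apply equiv_of_lim; auto.
  { apply Rdiv_lt_0_compat; auto. now apply Rmult_lt_0_compat. }
  replace (K / (Gamma (1 + d) * sigma)) with (K / sigma / Gamma (1 + d)) by (field; lra).
  apply (karamata (expectQ p n) (F_Q p n) (F_Q_law p n (proj1 hp) hn) d Hd l (K / sigma)); auto.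
  - now apply Rdiv_lt_0_compat.
  - replace (K / sigma) with (/ sigma * K) by (unfold Rdiv; ring).
    apply lim_ext_ev with (2 := lim_scal _ _ (/ sigma) HJ) (S := 0). intros s Hs.
    unfold gauge. change (expectQ p n (fun q => exp (- (s * q)))) with (laplaceQ p n s).
    assert (E := laplaceQ_Jint s Hs).
    replace d with (INR n * p / 2 + (d - INR n * p / 2)) at 2 by ring.
    rewrite Rpower_plus. unfold Rdiv in *. rewrite <- !Rmult_assoc. rewrite E. ring.
Qed.

Lemma INR_n_ge_2 : 2 <= INR n.
Proof. change 2 with (INR 2). now apply le_INR. Qed.

Lemma const_slow : forall k, 0 < k -> is_lim (fun s => (fun _ => 1) (k * s) / (fun _ : R => 1) s) p_infty 1.
Proof.
  intros k _. apply (is_lim_ext (fun _ => 1)); [|apply is_lim_const]. intros; field.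
Qed.

End Main.

Theorem theorem3 (p : R) (n : nat) (hp : 0 < p < 1) (hn : (2 <= n)%nat) :
  (INR n * p <> INR n - 1 ->
     equiv_at_0plus (F_Q p n) (fun x => C_pn p n * Rpower x (delta p n))) /\
  (INR n * p = INR n - 1 ->
     equiv_at_0plus (F_Q p n)
       (fun x => C_pn p n * Rpower x ((INR n - 1) / 2) * ln (1 / x))).
Proof.
  assert (hn0 : n <> 0%nat) by lia.
  assert (n2 := INR_n_ge_2 n hn).
  assert (Pc : 0 < (p * sqrt PI) ^ n).
  { apply pow_lt, Rmult_lt_0_compat; [lra|apply sqrtPI_pos]. }
  assert (Eal : al p n + 1 = INR n * p - (INR n - 1)) by (unfold al; ring).
  split.
  - intros Hne.
    (* Away from the critical case the slowly varying factor is the constant 1. *)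
    replace (fun x => C_pn p n * Rpower x (delta p n)) with
      (fun x => K_pn p n / (Gamma (1 + delta p n) * sqrt (PI / INR n)) * Rpower x (delta p n) * (fun _ => 1) (1 / x))
      by (extensionality x; unfold C_pn; ring).
    unfold K_pn, delta. destruct (Rlt_dec (INR n * p) (INR n - 1)) as [C|C].
    + rewrite Rmin_left by lra.
      apply (F_Q_equiv p n hp hn (INR n * p / 2) (fun _ => 1)).
      * nra.
      * apply (hsum_int_pos p hp n hn0). lra.
      * exists 0. intros; lra.
      * apply const_slow.
      * apply (lim_ext_ev (fun s => Jint p n (sqrt s))) with (S := 0).
        -- intros s Hs. replace (INR n * p / 2 - INR n * p / 2) with 0 by ring.
           rewrite Rpower_O by auto. field.
        -- apply (lim_sqrt (Jint p n)). apply (Jint_lim_below p hp n hn0). lra.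
    + destruct (Rlt_dec (INR n - 1) (INR n * p)) as [D|D]; [|lra].
      rewrite Rmin_right by lra.
      assert (E1 : (p - 1) * INR n + 1 = al p n + 1) by (unfold al; ring). rewrite E1.
      apply (F_Q_equiv p n hp hn ((INR n - 1) / 2) (fun _ => 1)).
      * lra.
      * apply Rdiv_lt_0_compat; lra.
      * exists 0. intros; lra.
      * apply const_slow.
      (* With [T = sqrt s], [T^(al+1)] is [s] to the power [(n p - (n - 1)) / 2], which is minus the
         correcting exponent. *)
      * apply (lim_ext_ev (fun s => Jint p n (sqrt s) / Rpower (sqrt s) (al p n + 1))) with (S := 0).
        -- intros s Hs. rewrite <- (Rpower_sqrt s Hs) at 2. rewrite Rpower_mult.
           replace ((INR n - 1) / 2 - INR n * p / 2) with (- (/ 2 * (al p n + 1))) by (rewrite Eal; field).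
           rewrite Rpower_Ropp. field. apply Rgt_not_eq, exp_pos.
        -- apply (lim_sqrt (fun T => Jint p n T / Rpower T (al p n + 1))).
           apply (Jint_lim_above p hp n hn0). lra.
  - intros Heq.
    assert (E2 : delta p n = (INR n - 1) / 2) by (unfold delta; rewrite Rmin_right; lra).
    unfold C_pn. rewrite E2. unfold K_pn.
    destruct (Rlt_dec (INR n * p) (INR n - 1)) as [C|C]; [lra|].
    destruct (Rlt_dec (INR n - 1) (INR n * p)) as [D|D]; [lra|].
    apply (F_Q_equiv p n hp hn ((INR n - 1) / 2) ln).
    + lra.
    + lra.
    + exists 1. intros s Hs. rewrite <- ln_1. apply ln_increasing; lra.
    + apply ln_slow.
    (* The identity [ln (sqrt s) = ln s / 2] is the origin of the factor 1/2 in the constant of the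
       critical case. *)
    + apply (lim_ext_ev (fun s => / 2 * (Jint p n (sqrt s) / ln (sqrt s)))) with (S := 1).
      * intros s Hs. assert (L0 : 0 < ln s) by (rewrite <- ln_1; apply ln_increasing; lra).
        replace ((INR n - 1) / 2 - INR n * p / 2) with 0 by (rewrite Heq; field).
        rewrite Rpower_O by lra. rewrite <- (Rpower_sqrt s) at 2 by lra.
        unfold Rpower. rewrite ln_exp. field. lra.
      * replace ((p * sqrt PI) ^ n / 2) with (/ 2 * (p * sqrt PI) ^ n) by field.
        apply lim_scal. apply (lim_sqrt (fun T => Jint p n T / ln T)).
        apply (Jint_lim_equal p hp n hn0). lra.
Qed.
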